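(* Let $n\geq 2$ and $a>0$, and let $$D(a)=\left\{z\in\mathbb{C}^n:\ \left||z_k|^2-|z_n|^2\right|<\frac{1}{(|z_n|^2+1)^{a}}\ \text{ for } k=1,\ldots,n-1\right\}.$$ If $a>\frac{1}{n-1}$, then $$A^2(D(a))=\mathrm{Span}\{z^p:\ p\in\mathbb{N}_0^n,\ |p|<(n-1)a-1\}.$$ Consequently, $$\dim A^2(D(a))=\begin{cases}0 & \text{if } 0<a\leq \frac{1}{n-1},\\[2pt] \binom{n+k}{k} & \text{if } \frac{k+1}{n-1}<a\leq\frac{k+2}{n-1}\ \ (k\in\mathbb{N}_0).\end{cases}$$
   Context: $\mathbb{N}_0$ denotes the nonnegative integers. For a domain $\Omega\subset\mathbb{C}^n$, $A^2(\Omega)$ is the Bergman space: the Hilbert space of holomorphic functions $f$ on $\Omega$ with $\int_\Omega|f|^2\,dV<\infty$, $dV$ being Lebesgue measure on $\mathbb{C}^n$. For $p=(p_1,\ldots,p_n)\in\mathbb{N}_0^n$ and $z\in\mathbb{C}^n$, $|p|=p_1+\cdots+p_n$ and $z^p=z_1^{p_1}\cdots z_n^{p_n}$. *)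

(* Defs.v *)
From HB Require Import structures.
From mathcomp Require Import all_boot all_order all_algebra.
From mathcomp Require Import all_classical all_reals all_analysis.
From mathcomp Require Import complex.

Set Implicit Arguments.
Unset Strict Implicit.
Unset Printing Implicit Defensive.

Import Order.TTheory GRing.Theory Num.Theory.
Local Open Scope ring_scope.
Local Open Scope complex_scope.

Section Defs.
Variable R : realType.
Local Notation C := R[i].

Definition holomorphic_on (n : nat) (D : set ('I_n -> C))
    (f : ('I_n -> C) -> C) : Prop :=
  forall z, D z ->
  exists c : 'I_n -> C,
  forall eps : R, 0 < eps -> exists2 delta : R, 0 < delta &
  forall h : 'I_n -> C, \sum_(k < n) Normc.normc (h k) < delta ->
    Normc.normc (f (fun k => z k + h k) - f z - \sum_(k < n) c k * h k)
      <= eps * \sum_(k < n) Normc.normc (h k).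

(* Iterated Lebesgue integral over R^m of a function of real coordinates
   v : nat -> R (only v 0, ..., v (m-1) matter). *)
Fixpoint iter_int (m : nat) (g : (nat -> R) -> \bar R) : \bar R :=
  match m with
  | 0 => g (fun _ => 0)
  | m'.+1 => (\int[@lebesgue_measure R]_x
                 iter_int m' (fun v => g (fun j => if j is j'.+1 then v j' else x)))%E
  end.

Definition cplx_of_reals (n : nat) (v : nat -> R) : 'I_n -> C :=
  fun k => v (2 * k)%N +i* v (2 * k).+1.

Definition L2_norm2 (n : nat) (D : set ('I_n -> C)) (f : ('I_n -> C) -> C)
    : \bar R :=
  iter_int (2 * n) (fun v => ((\1_D (cplx_of_reals (n:=n) v) : R)
                              * Normc.normc (f (cplx_of_reals (n:=n) v)) ^+ 2)%:E).

Definition bergman (n : nat) (D : set ('I_n -> C)) (f : ('I_n -> C) -> C)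
    : Prop :=
  holomorphic_on D f /\ (L2_norm2 D f < +oo)%E.

Definition monomial (n : nat) (p : 'I_n -> nat) (z : 'I_n -> C) : C :=
  \prod_(k < n) z k ^+ p k.
Definition mi_size (n : nat) (p : 'I_n -> nat) : nat := (\sum_(k < n) p k)%N.

Definition Dom (n : nat) (a : R) : set ('I_n -> C) :=
  [set z | forall k l : 'I_n, val l = n.-1 -> (val k < n.-1)%N ->
     `| Normc.normc (z k) ^+ 2 - Normc.normc (z l) ^+ 2 |
        < 1 / ((Normc.normc (z l) ^+ 2 + 1) `^ a)].

Definition in_monomial_span (n : nat) (D : set ('I_n -> C))
    (P : ('I_n -> nat) -> Prop) (f : ('I_n -> C) -> C) : Prop :=
  exists s : seq (C * ('I_n -> nat)),
    (forall q, q \in s -> P q.2) /\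
    (forall z, D z -> f z = \sum_(q <- s) q.1 * monomial q.2 z).

Definition has_dim (n : nat) (D : set ('I_n -> C))
    (V : (('I_n -> C) -> C) -> Prop) (m : nat) : Prop :=
  exists b : 'I_m -> ('I_n -> C) -> C,
    (forall i, V (b i)) /\
    (forall c : 'I_m -> C, (forall z, D z -> \sum_(i < m) c i * b i z = 0) ->
        forall i, c i = 0) /\
    (forall f, V f -> exists c : 'I_m -> C,
        forall z, D z -> f z = \sum_(i < m) c i * b i z).

End Defs.
Arguments Dom {R} n a.

(* Main.v *)
(* D(a) contains the polytori |z_1| = ... = |z_n|, together with boxes around their
   points whose width decays polynomially in the radius, so the sub-mean value
   property bounds a square-integrable holomorphic f there by a power of the radius.
   By Liouville, f is a polynomial along the complex lines through 0 and such points.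
   Near 0 this holds on all lines, and interpolating f along them extends it to an
   entire function of polynomial growth, that is, a polynomial.  It agrees with f on
   D(a), because a point of D(a) is reached from a polytorus by moving the moduli of
   the coordinates one at a time towards |z_n| inside D(a).

   Integrability then fixes the degree.  Over w = z_1 the slice of D(a) is, up to
   constants, a product of n-1 annuli ||z_k|^2 - |w|^2| < c |w|^(-2a), whose areas are
   of the order of |w|^(-2a), so the squared norm of a polynomial of degree d behaves
   like the integral of |w|^(2d - 2a(n-1)), which is finite iff d < (n-1)a - 1.  For the
   divergence it suffices to integrate over a region asymptotic to a cone on which the
   leading homogeneous part stays away from 0. *)
Require Import Defs.
From HB Require Import structures.
From mathcomp Require Import all_boot all_order all_algebra.
From mathcomp Require Import all_classical all_reals all_analysis.
From mathcomp Require Import complex measurable_realfun.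
From mathcomp Require Import ring lra.

Set Implicit Arguments.
Unset Strict Implicit.
Unset Printing Implicit Defensive.

Import Order.TTheory GRing.Theory Num.Theory.
Import numFieldNormedType.Exports.
Local Open Scope ring_scope.
Local Open Scope complex_scope.

(** Both [holomorphic_on] and [L2_norm2] speak of arbitrary functions, and the iterated integral
    carries no measurability. The multiple integrals are therefore handled essentially through
    monotonicity and positive scaling; Tonelli and additivity are applied only on the plane, to
    lower semicontinuous functions. Cauchy's theory is built on rectangles, whose edges are
    intervals, and the factor [2 pi i] is kept as an integral of which only a lower bound is used.

    [L2_norm2] integrates over z_1 outermost, whereas D(a) compares everything with z_n. Hence both
    integrability estimates slice over z_1 and transfer the widths from |z_n| to |z_1| at the cost
    of a constant.

    The obstacle in the extension step is that the lines through a general point leave D(a); only a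
    segment near 0 is available. The degree bound known on polytori is therefore expressed as an
    interpolation identity with fixed nodes: it passes from polytori to a polydisc by the identity
    theorem, and it recovers the value at z from arbitrarily small dilates of z. *)

Notation nm := Normc.normc.
Notation cRe := complex.Re.
Notation cIm := complex.Im.

(** * Complex differentiability *)

Section Modulus.
Variable R : realType.
Local Notation C := R[i].
Implicit Types z w u : C.

Lemma nmD z w : nm (z + w) <= nm z + nm w.
Proof. exact: complex.le_normcD. Qed.

Lemma nmN z : nm (- z) = nm z.
Proof. exact: complex.normcN. Qed.

Lemma nmM z w : nm (z * w) = nm z * nm w.
Proof. exact: Normc.normcM. Qed.

Lemma nmV z : nm z^-1 = (nm z)^-1.
Proof. exact: Normc.normcV. Qed.

Lemma nm0 : nm (0 : C) = 0.
Proof. exact: Normc.normc0. Qed.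

Lemma nm1 : nm (1 : C) = 1.
Proof. exact: Normc.normc1. Qed.

Lemma nm_ge0 z : 0 <= nm z.
Proof. by case: z => a b; rewrite /Normc.normc sqrtr_ge0. Qed.

Lemma nmX z k : nm (z ^+ k) = nm z ^+ k.
Proof. by elim: k => [|k IH]; rewrite ?expr0 ?nm1 // !exprS nmM IH. Qed.

Lemma nm_eq0 z : (nm z == 0) = (z == 0).
Proof.
apply/eqP/eqP => [/Normc.eq0_normc //|->]; exact: nm0.
Qed.

Lemma nm_gt0 z : (0 < nm z) = (z != 0).
Proof. by rewrite lt0r nm_ge0 andbT nm_eq0. Qed.

Lemma nmB z w : nm (z - w) = nm (w - z).
Proof. by rewrite -nmN opprB. Qed.

Lemma nmBD z w : nm (z - w) <= nm z + nm w.
Proof. by apply: le_trans (nmD _ _) _; rewrite nmN. Qed.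

Lemma nm_lerB z w : nm z - nm w <= nm (z - w).
Proof. by have := nmD (z - w) w; rewrite subrK; lra. Qed.

Lemma nm_sqr z : nm z ^+ 2 = cRe z ^+ 2 + cIm z ^+ 2.
Proof.
by case: z => a b; rewrite /Normc.normc /= sqr_sqrtr // addr_ge0 // sqr_ge0.
Qed.

Lemma nm_Re z : `|cRe z| <= nm z.
Proof.
case: z => a b; rewrite /Normc.normc /= -sqrtr_sqr ler_wsqrtr //.
by rewrite lerDl sqr_ge0.
Qed.

Lemma nm_Im z : `|cIm z| <= nm z.
Proof.
case: z => a b; rewrite /Normc.normc /= -sqrtr_sqr ler_wsqrtr //.
by rewrite lerDr sqr_ge0.
Qed.

Lemma nm_real (x : R) : nm x%:C = `|x|.
Proof. by rewrite /Normc.normc /= expr0n /= addr0 sqrtr_sqr. Qed.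

Lemma nm_i : nm ('i : C) = 1.
Proof. by rewrite /Normc.normc /= expr0n expr1n /= add0r sqrtr1. Qed.

Lemma nm_le_ReIm z : nm z <= `|cRe z| + `|cIm z|.
Proof.
rewrite -(ler_pXn2r (n := 2)) // ?nnegrE ?nm_ge0 ?addr_ge0 //.
rewrite nm_sqr -(real_normK (num_real (cRe z))) -(real_normK (num_real (cIm z))).
by have := normr_ge0 (cRe z); have := normr_ge0 (cIm z); nra.
Qed.

Lemma nm_sum (I : Type) (r : seq I) (P : pred I) (F : I -> C) :
  nm (\sum_(i <- r | P i) F i) <= \sum_(i <- r | P i) nm (F i).
Proof.
elim/big_rec2: _ => [|i y x _ IH]; first by rewrite nm0.
by apply: le_trans (nmD _ _) _; rewrite lerD2l.
Qed.

Lemma nm_prod (I : Type) (r : seq I) (P : pred I) (F : I -> C) :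
  nm (\prod_(i <- r | P i) F i) = \prod_(i <- r | P i) nm (F i).
Proof. exact: (big_morph _ nmM nm1). Qed.

Lemma nm0P z : (forall e : R, 0 < e -> nm z <= e) -> z = 0.
Proof.
move=> H; apply/eqP; rewrite -nm_eq0 eq_le nm_ge0 andbT.
by apply/ler_addgt0Pr => e e0; rewrite add0r; exact: H.
Qed.

End Modulus.

Arguments Normc.normc : simpl never.

Section SmallO.
Variables (R : realType) (U : Type) (N : U -> R).
Hypothesis N0 : forall u, 0 <= N u.
Local Notation C := R[i].
Implicit Types r p q : U -> C.

(** An abstract domain [U] with a size [N] lets one calculus serve derivatives on C, with the
    modulus, and on C^n, with the l1 norm. *)
Definition is_o r := forall e : R, 0 < e ->
  exists2 d : R, 0 < d & forall u, N u < d -> nm (r u) <= e * N u.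

Definition is_O r := exists2 K : R, 0 < K &
  exists2 d : R, 0 < d & forall u, N u < d -> nm (r u) <= K * N u.

Definition near_bounded r := exists2 K : R, 0 < K &
  exists2 d : R, 0 < d & forall u, N u < d -> nm (r u) <= K.

Lemma is_o_is_O r : is_o r -> is_O r.
Proof. by move=> /(_ 1 ltr01) H; exists 1. Qed.

Lemma is_O_cvg r : is_O r -> forall e : R, 0 < e ->
  exists2 d : R, 0 < d & forall u, N u < d -> nm (r u) < e.
Proof.
move=> [K K0 [d d0 H]] e e0; exists (Num.min d (e / K)).
  by rewrite lt_min d0 divr_gt0.
move=> u; rewrite lt_min => /andP[/H /le_lt_trans + ue]; apply.
by rewrite mulrC -ltr_pdivlMr.
Qed.

Lemma is_o_near r p (d : R) : 0 < d -> (forall u, N u < d -> r u = p u) ->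
  is_o r -> is_o p.
Proof.
move=> d0 rp H e /H[d' d'0 {}H]; exists (Num.min d d').
  by rewrite lt_min d0.
by move=> u; rewrite lt_min => /andP[/rp <- /H].
Qed.

Lemma eq_is_o r p : r =1 p -> is_o r -> is_o p.
Proof. by move=> rp; exact: (is_o_near ltr01). Qed.

Lemma eq_is_O r p : r =1 p -> is_O r -> is_O p.
Proof. by move=> /funext ->. Qed.

Lemma is_o0 : is_o (fun=> 0).
Proof. by move=> e e0; exists 1 => // u _; rewrite nm0 mulr_ge0 // ltW. Qed.

Lemma is_oD r p : is_o r -> is_o p -> is_o (fun u => r u + p u).
Proof.
move=> Hr Hp e e0; have e20 : 0 < e / 2 by rewrite divr_gt0.
have [d1 d10 H1] := Hr _ e20; have [d2 d20 H2] := Hp _ e20.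
exists (Num.min d1 d2); first by rewrite lt_min d10.
move=> u; rewrite lt_min => /andP[/H1 h1 /H2 h2].
by apply: le_trans (nmD _ _) _; lra.
Qed.

Lemma is_OD r p : is_O r -> is_O p -> is_O (fun u => r u + p u).
Proof.
move=> [K K0 [d d0 H]] [L L0 [f f0 G]]; exists (K + L); first exact: addr_gt0.
exists (Num.min d f); first by rewrite lt_min d0.
move=> u; rewrite lt_min => /andP[/H h1 /G h2].
by apply: le_trans (nmD _ _) _; lra.
Qed.

Lemma is_oM_bounded r p : near_bounded p -> is_o r -> is_o (fun u => p u * r u).
Proof.
move=> [K K0 [d d0 H]] Hr e e0; have eK : 0 < e / K by rewrite divr_gt0.
have [d1 d10 H1] := Hr _ eK.
exists (Num.min d d1); first by rewrite lt_min d0.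
move=> u; rewrite lt_min => /andP[/H h1 /H1 h2]; rewrite nmM.
apply: le_trans (ler_pM (nm_ge0 _) (nm_ge0 _) h1 h2) _.
by rewrite mulrA mulrCA divff ?mulr1 // gt_eqF.
Qed.

Lemma is_OM r p : is_O p -> is_O r -> is_o (fun u => p u * r u).
Proof.
move=> [K K0 [d d0 H]] [L L0 [f f0 G]] e e0.
have ek : 0 < e / (K * L) by rewrite divr_gt0 // mulr_gt0.
exists (Num.min (Num.min d f) (e / (K * L))); first by rewrite !lt_min d0 f0.
move=> u; rewrite !lt_min => /andP[/andP[/H h1 /G h2] h3]; rewrite nmM.
apply: le_trans (ler_pM (nm_ge0 _) (nm_ge0 _) h1 h2) _.
move: h3; rewrite ltr_pdivlMr ?mulr_gt0 // => h3.
have -> : K * N u * (L * N u) = N u * (K * L) * N u by ring.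
by rewrite ler_wpM2r // ltW.
Qed.

Lemma near_bounded_cst (c : C) : near_bounded (fun=> c).
Proof.
exists (nm c + 1); first by rewrite ltr_wpDl ?nm_ge0.
by exists 1 => // u _; rewrite lerDl.
Qed.

End SmallO.

Section ComplexDerivative.
Variable R : realType.
Local Notation C := R[i].
Implicit Types (f g h : C -> C) (z w u c : C).

Definition has_cderiv h z c :=
  is_o (@Normc.normc R) (fun u => h (z + u) - h z - c * u).

Definition cdiff h z := exists c, has_cderiv h z c.

Lemma cdiff_near f g z (d : R) : 0 < d ->
  (forall u, nm u < d -> f (z + u) = g (z + u)) -> cdiff f z -> cdiff g z.
Proof.
move=> d0 fg [c H]; exists c; apply: (is_o_near d0 _ H) => u ud.
by have := fg 0; rewrite nm0 addr0 fg // => ->.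
Qed.

Lemma eq_cdiff f g z : f =1 g -> cdiff f z -> cdiff g z.
Proof. by move=> /funext ->. Qed.

Lemma is_O_scale c : is_O (@Normc.normc R) (fun u => c * u).
Proof.
exists (nm c + 1); first by rewrite ltr_wpDl ?nm_ge0.
exists 1 => // u _; rewrite nmM ler_wpM2r ?nm_ge0 //; lra.
Qed.

Lemma cdiff_O h z : cdiff h z -> is_O (@Normc.normc R) (fun u => h (z + u) - h z).
Proof.
move=> [c /is_o_is_O /is_OD - /(_ _ (is_O_scale c))].
by apply: eq_is_O => u; rewrite subrK.
Qed.

Lemma cdiff_cvg h z : cdiff h z -> forall e : R, 0 < e ->
  exists2 d : R, 0 < d & forall u, nm u < d -> nm (h (z + u) - h z) < e.
Proof. by move/cdiff_O/is_O_cvg. Qed.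

Lemma cdiff_cst c z : cdiff (fun=> c) z.
Proof.
exists 0; apply: eq_is_o (is_o0 (@nm_ge0 R)) => u.
by rewrite subrr mul0r subrr.
Qed.

Lemma cdiff_id z : cdiff id z.
Proof.
exists 1; apply: eq_is_o (is_o0 (@nm_ge0 R)) => u.
by rewrite mul1r; ring.
Qed.

Lemma cdiffD f g z : cdiff f z -> cdiff g z -> cdiff (fun w => f w + g w) z.
Proof.
move=> [c H] [d G]; exists (c + d).
by apply: eq_is_o (is_oD H G) => u; ring.
Qed.

Lemma cdiffM f g z : cdiff f z -> cdiff g z -> cdiff (fun w => f w * g w) z.
Proof.
move=> df dg; have [c H] := df; have [d G] := dg; exists (c * g z + f z * d).
have N0 := @nm_ge0 R.
have h1 := is_oM_bounded (near_bounded_cst _ (g z)) H.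
have h2 := is_oM_bounded (near_bounded_cst _ (f z)) G.
have h3 := is_OM N0 (cdiff_O df) (cdiff_O dg).
by apply: eq_is_o (is_oD (is_oD h1 h2) h3) => u; ring.
Qed.

Lemma cdiffN f z : cdiff f z -> cdiff (fun w => - f w) z.
Proof.
move=> H; apply: eq_cdiff (cdiffM (cdiff_cst (-1) z) H) => w.
by rewrite mulN1r.
Qed.

Lemma cdiffB f g z : cdiff f z -> cdiff g z -> cdiff (fun w => f w - g w) z.
Proof. by move=> H G; exact: (cdiffD H (cdiffN G)). Qed.

Lemma cdiff_sum (I : Type) (r : seq I) (F : I -> C -> C) z :
  (forall i, cdiff (F i) z) -> cdiff (fun w => \sum_(i <- r) F i w) z.
Proof.
move=> H; elim: r => [|i r IH].
  by apply: eq_cdiff (cdiff_cst 0 z) => w; rewrite big_nil.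
by apply: eq_cdiff (cdiffD (H i) IH) => w; rewrite big_cons.
Qed.

Lemma cdiffX f z k : cdiff f z -> cdiff (fun w => f w ^+ k) z.
Proof.
move=> H; elim: k => [|k IH].
  by apply: eq_cdiff (cdiff_cst 1 z) => w; rewrite expr0.
by apply: eq_cdiff (cdiffM H IH) => w; rewrite exprS.
Qed.

Lemma cdiff_inv (a z : C) : z != a -> cdiff (fun w => (w - a)^-1) z.
Proof.
move=> za; have za0 : z - a != 0 by rewrite subr_eq0.
have N0 := @nm_ge0 R; have m0 : 0 < nm (z - a) / 2 by rewrite divr_gt0 // nm_gt0.
have low u : nm u < nm (z - a) / 2 -> nm (z - a) / 2 <= nm (z + u - a).
  move=> H; have := nm_lerB (z - a) (- u).
  by rewrite nmN opprK addrAC; lra.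
have ne u : nm u < nm (z - a) / 2 -> z + u - a != 0.
  by move=> /low H; rewrite -nm_gt0; apply: lt_le_trans H.
exists (- (z - a) ^- 2).
(* The remainder is exactly [u^2 / ((z - a)^2 (z + u - a))], and the denominator stays away from 0
   for [|u| < |z - a| / 2]. *)
apply: (@is_o_near _ _ _ (fun u => ((z - a) ^- 2 * (z + u - a)^-1) * (u * u))
  _ _ m0).
  move=> u /ne ne0.
  have : z + u - a != 0 by [].
  by move=> ?; field; rewrite za0.
have hu : is_O (@Normc.normc R) id.
  by apply: eq_is_O (is_O_scale 1) => u; rewrite mul1r.
apply: (is_oM_bounded _ (is_OM N0 hu hu)).
exists (nm ((z - a) ^- 2) * (nm (z - a) / 2)^-1).
  by rewrite mulr_gt0 ?invr_gt0 // nm_gt0 invr_neq0 // expf_neq0.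
exists (nm (z - a) / 2) => // u H; rewrite nmM ler_wpM2l ?nm_ge0 //.
by rewrite nmV lef_pV2 ?posrE ?low // nm_gt0 ne.
Qed.

Lemma cdiff_aff h (a b z : C) : cdiff h (a + b * z) -> cdiff (fun w => h (a + b * w)) z.
Proof.
move=> [c H]; exists (c * b) => e e0.
have eb : 0 < e / (nm b + 1) by rewrite divr_gt0 // ltr_wpDl ?nm_ge0.
have b1 : 0 < nm b + 1 by rewrite ltr_wpDl ?nm_ge0.
have [d d0 {}H] := H _ eb; exists (d / (nm b + 1)); first by rewrite divr_gt0.
move=> u; rewrite ltr_pdivlMr // => ud.
have bu : nm (b * u) <= (nm b + 1) * nm u.
  by rewrite nmM ler_wpM2r ?nm_ge0 //; lra.
have /H : nm (b * u) < d by apply: le_lt_trans bu _; rewrite mulrC.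
rewrite mulrDr addrA mulrA => /le_trans; apply.
apply: le_trans (ler_wpM2l (ltW eb) bu) _.
by rewrite mulrA divfK // gt_eqF.
Qed.

End ComplexDerivative.

(** * Integration without measurability assumptions *)

Section NonnegativeIntegral.
Context d (T : measurableType d) (R : realType).
Variable mu : {measure set T -> \bar R}.
Implicit Types (D : set T) (f g : T -> \bar R).
Local Open Scope ereal_scope.

(* Holds without measurability because the integral of a nonnegative function
   is a supremum over the simple functions below it. *)
Lemma ge0_integral_mono D f g : (forall x, D x -> 0 <= f x) ->
  (forall x, D x -> f x <= g x) -> \int[mu]_(x in D) f x <= \int[mu]_(x in D) g x.
Proof.
move=> f0 fg; rewrite !ge0_integralE //; last first.
  by move=> x Dx; apply: le_trans (f0 x Dx) (fg x Dx).
apply: ge_ereal_sup => _ [h hf <-]; apply: ereal_sup_ubound.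
exists h => // x; apply: le_trans (hf x) _.
by rewrite !patchE; case: ifPn => //; rewrite inE => /fg.
Qed.

Lemma ge0_integral_le_setT D f g : (forall x, 0 <= g x) ->
  (forall x, D x -> 0 <= f x) -> (forall x, D x -> f x <= g x) ->
  \int[mu]_(x in D) f x <= \int[mu]_x g x.
Proof.
move=> g0 f0 fg; rewrite integral_mkcond.
by apply: ge0_integral_mono => x _; rewrite patchE; case: ifPn => //; rewrite inE;
  [exact: f0|exact: fg].
Qed.

Lemma ge0_integral_scale_le D f (c : R) : (0 < c)%R -> (forall x, D x -> 0 <= f x) ->
  c%:E * \int[mu]_(x in D) f x <= \int[mu]_(x in D) (c%:E * f x).
Proof.
move=> c0 f0; rewrite muleC -lee_pdivlMr // !ge0_integralE //; last first.
  by move=> x Dx; rewrite mule_ge0 ?f0 // lee_fin ltW.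
apply: ge_ereal_sup => _ [h /= hf <-]; rewrite lee_pdivlMr // muleC.
rewrite -sintegralrM; apply: ereal_sup_ubound.
exists (scale_nnsfun h (ltW c0)) => // x /=.
have := hf x; rewrite !patchE EFinM; case: ifPn => _ hx.
  by rewrite lee_pmul2l.
by rewrite -[leRHS](mule0 c%:E) lee_pmul2l.
Qed.

(** One inequality scales the simple functions below [f]; the other is the same inequality for
    [c^-1] and the function [c * f]. *)
Lemma ge0_integral_scale D f (c : R) : (0 < c)%R -> (forall x, D x -> 0 <= f x) ->
  \int[mu]_(x in D) (c%:E * f x) = c%:E * \int[mu]_(x in D) f x.
Proof.
move=> c0 f0; apply/eqP; rewrite eq_le ge0_integral_scale_le // andbT.
have ci0 : (0 < c^-1)%R by rewrite invr_gt0.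
have H x : D x -> 0 <= c%:E * f x by move=> /f0 ?; rewrite mule_ge0 // lee_fin ltW.
rewrite muleC -lee_pdivrMr // muleC.
apply: le_trans (ge0_integral_scale_le ci0 H) _.
apply: ge0_integral_mono => x Dx; first by rewrite mule_ge0 ?H // lee_fin ltW.
by rewrite muleA -EFinM mulVf ?mul1e // gt_eqF.
Qed.

End NonnegativeIntegral.

Section ComplexIntegral.
Variable R : realType.
Local Notation C := R[i].
Local Notation mu := (@lebesgue_measure R).
Implicit Types (f g h : R -> C) (a b m x : R).

Definition rint a b (g : R -> R) : R := \int[mu]_(x in `[a, b]) g x.

Definition cint a b h : C := rint a b (fun x => cRe (h x)) +i* rint a b (fun x => cIm (h x)).

Definition rintble a b (g : R -> R) := mu.-integrable `[a, b] (EFin \o g).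

Definition cintble a b h :=
  rintble a b (fun x => cRe (h x)) /\ rintble a b (fun x => cIm (h x)).

Definition ccont h x := forall e : R, 0 < e ->
  exists2 d : R, 0 < d & forall u : R, `|u| < d -> nm (h (x + u) - h x) < e.

Lemma cont_rintble (g : R -> R) a b :
  (forall x, a <= x <= b -> {for x, continuous g}) -> rintble a b g.
Proof.
move=> H; apply: continuous_compact_integrable; first exact: segment_compact.
apply: continuous_in_subspaceT => x; rewrite inE /= in_itv /= => ?; exact: H.
Qed.

Lemma ccont_cintble h a b : (forall x, a <= x <= b -> ccont h x) -> cintble a b h.
Proof.
move=> H; split; apply: cont_rintble => x /H {}H.
- apply/cvgrPdist_lt => e /H[d d0 hd]; apply/nbhs_ballP; exists d => //= y.
  rewrite /ball /= distrC => /hd; rewrite [x + _]addrC subrK => /(le_lt_trans _); apply.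
  by rewrite distrC -raddfB; exact: nm_Re.
- apply/cvgrPdist_lt => e /H[d d0 hd]; apply/nbhs_ballP; exists d => //= y.
  rewrite /ball /= distrC => /hd; rewrite [x + _]addrC subrK => /(le_lt_trans _); apply.
  by rewrite distrC -raddfB; exact: nm_Im.
Qed.

Lemma rint_eq (g1 g2 : R -> R) a b : (forall x, a <= x <= b -> g1 x = g2 x) ->
  rint a b g1 = rint a b g2.
Proof.
by move=> H; apply: eq_Rintegral => x; rewrite inE /= in_itv /= => /H.
Qed.

Lemma cint_eq f g a b : (forall x, a <= x <= b -> f x = g x) ->
  cint a b f = cint a b g.
Proof. by move=> H; congr (_ +i* _); apply: rint_eq => x /H ->. Qed.

Lemma rintble_eq (g1 g2 : R -> R) a b : (forall x, a <= x <= b -> g1 x = g2 x) ->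
  rintble a b g1 -> rintble a b g2.
Proof.
move=> H; apply: eq_integrable => // x; rewrite inE /= in_itv /= => /H.
by move=> /= ->.
Qed.

Lemma cintble_eq f g a b : (forall x, a <= x <= b -> f x = g x) -> cintble a b f -> cintble a b g.
Proof. by move=> H [h1 h2]; split; [apply: rintble_eq h1|apply: rintble_eq h2] => x /H ->. Qed.

Lemma rintbleD (g1 g2 : R -> R) a b : rintble a b g1 -> rintble a b g2 ->
  rintble a b (fun x => g1 x + g2 x).
Proof. by move=> h1 h2; exact: (integrableD _ h1 h2). Qed.

Lemma rintbleZ (g : R -> R) k a b : rintble a b g -> rintble a b (fun x => k * g x).
Proof. by move=> h; exact: (integrableZl _ k h). Qed.

Lemma rintD (g1 g2 : R -> R) a b : rintble a b g1 -> rintble a b g2 ->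
  rint a b (fun x => g1 x + g2 x) = rint a b g1 + rint a b g2.
Proof. by move=> h1 h2; exact: RintegralD. Qed.

Lemma rintZ (g : R -> R) k a b : rintble a b g ->
  rint a b (fun x => k * g x) = k * rint a b g.
Proof. by move=> h1; exact: RintegralZl. Qed.

Lemma cintbleD f g a b : cintble a b f -> cintble a b g -> cintble a b (fun x => f x + g x).
Proof.
move=> [f1 f2] [g1 g2]; split.
- by apply: rintble_eq (rintbleD f1 g1) => x _; rewrite raddfD.
- by apply: rintble_eq (rintbleD f2 g2) => x _; rewrite raddfD.
Qed.

Lemma cintD f g a b : cintble a b f -> cintble a b g ->
  cint a b (fun x => f x + g x) = cint a b f + cint a b g.
Proof.
move=> [f1 f2] [g1 g2]; rewrite /cint.
transitivity ((rint a b (fun x => cRe (f x)) + rint a b (fun x => cRe (g x))) +i*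
  (rint a b (fun x => cIm (f x)) + rint a b (fun x => cIm (g x)))); last by [].
by rewrite -!rintD //; congr (_ +i* _); apply: rint_eq => x _; rewrite raddfD.
Qed.

Lemma cReM (z w : C) : cRe (z * w) = cRe z * cRe w + - cIm z * cIm w.
Proof. by case: z => a b; case: w => c d /=; rewrite mulNr. Qed.

Lemma cImM (z w : C) : cIm (z * w) = cRe z * cIm w + cIm z * cRe w.
Proof. by case: z => a b; case: w => c d. Qed.

Lemma cintbleZ f c a b : cintble a b f -> cintble a b (fun x => c * f x).
Proof.
move=> [f1 f2]; split.
- by apply: rintble_eq (rintbleD (rintbleZ (cRe c) f1) (rintbleZ (- cIm c) f2)) => x _; rewrite cReM.
- by apply: rintble_eq (rintbleD (rintbleZ (cRe c) f2) (rintbleZ (cIm c) f1)) => x _; rewrite cImM.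
Qed.

Lemma cintZ f c a b : cintble a b f -> cint a b (fun x => c * f x) = c * cint a b f.
Proof.
move=> [f1 f2]; rewrite /cint; apply/eqP; rewrite eq_complex /=; apply/andP; split.
- rewrite (rint_eq (g2 := fun x => cRe c * cRe (f x) + - cIm c * cIm (f x))).
    by rewrite rintD ?rintZ //; [case: c => c1 c2 /=; rewrite mulNr|exact: rintbleZ..].
  by move=> x _; rewrite cReM.
- rewrite (rint_eq (g2 := fun x => cRe c * cIm (f x) + cIm c * cRe (f x))).
    by rewrite rintD ?rintZ //; [case: c|exact: rintbleZ..].
  by move=> x _; rewrite cImM.
Qed.

Lemma cintbleB f g a b : cintble a b f -> cintble a b g -> cintble a b (fun x => f x - g x).
Proof.
move=> hf hg; apply: cintble_eq (cintbleD hf (cintbleZ (-1) hg)) => x _; by rewrite mulN1r.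
Qed.

Lemma cintB f g a b : cintble a b f -> cintble a b g ->
  cint a b (fun x => f x - g x) = cint a b f - cint a b g.
Proof.
move=> hf hg; rewrite -mulN1r -cintZ // -cintD //; last exact: cintbleZ.
by apply: cint_eq => x _; rewrite mulN1r.
Qed.

Lemma rint_split (g : R -> R) a m b : a <= m -> m <= b -> rintble a b g ->
  rint a b g = rint a m g + rint m b g.
Proof.
move=> am mb h; apply/eqP; rewrite addrC -subr_eq; apply/eqP.
rewrite [LHS](Rintegral_itvB h) // Rintegral_itv_obnd_cbnd //.
apply: integrableS h => //; apply: subset_itvr.
by rewrite bnd_simp.
Qed.

Lemma rintbleS (g : R -> R) a b c d : a <= c -> d <= b -> rintble a b g -> rintble c d g.
Proof.
move=> ac db; apply: integrableS => //; apply: subset_itv; by rewrite bnd_simp.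
Qed.

Lemma cintbleS f a b c d : a <= c -> d <= b -> cintble a b f -> cintble c d f.
Proof. by move=> ac db [h1 h2]; split; exact: rintbleS ac db _. Qed.

Lemma cint_split f a m b : a <= m -> m <= b -> cintble a b f ->
  cint a b f = cint a m f + cint m b f.
Proof. by move=> am mb [h1 h2]; rewrite /cint !(rint_split am mb). Qed.

Lemma rintble_cst k a b : rintble a b (fun=> k).
Proof. by apply: cont_rintble => x _; exact: cvg_cst. Qed.

Lemma cintble_cst (c : C) a b : cintble a b (fun=> c).
Proof. by split; exact: rintble_cst. Qed.

Lemma rint_cst k a b : a <= b -> rint a b (fun=> k) = k * (b - a).
Proof.
move=> ab; rewrite /rint Rintegral_cst //= lebesgue_measure_itv /= lte_fin.
by case: ltgtP ab => [//|//|->]; rewrite ?subrr.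
Qed.

Lemma cint_cst (c : C) a b : a <= b -> cint a b (fun=> c) = c * (b - a)%:C.
Proof.
move=> ab; rewrite /cint !rint_cst //.
by case: c => c1 c2 /=; apply/eqP; rewrite eq_complex /= !mulr0 subr0 add0r !eqxx.
Qed.

Lemma rint_bound (g : R -> R) a b (M : R) : a <= b -> rintble a b g ->
  (forall x, a <= x <= b -> `|g x| <= M) -> `|rint a b g| <= M * (b - a).
Proof.
move=> ab h H; rewrite -rint_cst //; apply: le_trans (le_normr_Rintegral _ h) _ => //.
by apply: le_Rintegral => //; [exact: (integrable_abse h)|exact: (rintble_cst M a b)].
Qed.

(** The factor 2 is the price of bounding the real and imaginary parts separately. *)
Lemma cint_bound f a b (M : R) : a <= b -> cintble a b f ->
  (forall x, a <= x <= b -> nm (f x) <= M) -> nm (cint a b f) <= 2 * (M * (b - a)).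
Proof.
move=> ab [h1 h2] H; apply: le_trans (nm_le_ReIm _) _ => /=.
have := rint_bound ab h1 (fun x hx => le_trans (nm_Re _) (H x hx)).
have := rint_bound ab h2 (fun x hx => le_trans (nm_Im _) (H x hx)).
by lra.
Qed.

(** The right-hand side is an extended real, so that the integral of the modulus may be used before
    it is known to be finite. *)
Lemma cint_abs f a b : cintble a b f ->
  ((nm (cint a b f))%:E <= 2%:E * \int[mu]_(x in `[a, b]) (nm (f x))%:E)%E.
Proof.
move=> [h1 h2].
have main (g : R -> R) : rintble a b g -> (forall x, `|g x| <= nm (f x)) ->
    (`|rint a b g|%:E <= \int[mu]_(x in `[a, b]) (nm (f x))%:E)%E.
  move=> hg H; rewrite EFin_normr_Rintegral //.
  apply: le_trans (le_abse_integral _ _ (measurable_int _ hg)) _ => //.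
  by apply: ge0_integral_mono => x _; rewrite ?abse_ge0 //= lee_fin.
have := main _ h1 (fun x => nm_Re _); have := main _ h2 (fun x => nm_Im _).
move=> H2 H1; apply: (@le_trans _ _ (`|rint a b (fun x => cRe (f x))|%:E +
  `|rint a b (fun x => cIm (f x))|%:E)%E).
  by rewrite -EFinD lee_fin; exact: (nm_le_ReIm (cint a b f)).
rewrite (_ : 2%:E = 1 + 1)%E // ge0_muleDl ?mul1e ?leeD //.
Qed.

End ComplexIntegral.

(** * Cauchy's theorem for rectangles and its consequences *)

Section Quartering.
Variable R : realType.
Implicit Types a b c d x y : R.

Lemma mid_itv a b : a <= b -> (a <= (a + b) / 2) /\ ((a + b) / 2 <= b).
Proof. by move=> ab; split; lra. Qed.

Lemma nested_intervals (a b : nat -> R) :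
  (forall n, a n <= a n.+1) -> (forall n, b n.+1 <= b n) -> (forall n, a n <= b n) ->
  exists x, forall n, a n <= x <= b n.
Proof.
move=> ha hb hab.
have am m n : (m <= n)%N -> a m <= a n by apply: (homo_leq (@lexx _ R) le_trans).
have bm m n : (m <= n)%N -> b n <= b m.
  by apply: (homo_leq (r := fun u v => v <= u)) => // u v w vu wv; exact: le_trans wv vu.
have ub m n : a n <= b m.
  have [mn|nm] := leqP m n; first exact: le_trans (hab n) (bm _ _ mn).
  exact: le_trans (am _ _ (ltnW nm)) (hab m).
have S : has_sup (range a).
  by split; [exists (a 0%N), 0%N|exists (b 0%N) => _ [n _ <-]; exact: ub].
exists (sup (range a)) => n; apply/andP; split.
  by apply: sup_upper_bound => //; exists n.
by apply: ge_sup => [|_ [m _ <-]]; [case: S|exact: ub].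
Qed.

Definition quarter (t : R * R * R * R) (q : bool * bool) : R * R * R * R :=
  let: (a, b, c, d) := t in
  let m := (a + b) / 2 in let n := (c + d) / 2 in
  (if q.1 then m else a, if q.1 then b else m,
   if q.2 then n else c, if q.2 then d else n).

(** Goursat's bisection separated from integrals: if [P] failed on the whole rectangle, nested
    quarters on which it fails would shrink to a point, against the local hypothesis there. *)
Lemma quartering_induction (P : R -> R -> R -> R -> Prop) a0 b0 c0 d0 :
  a0 <= b0 -> c0 <= d0 ->
  (forall a b c d, a0 <= a -> a <= b -> b <= b0 -> c0 <= c -> c <= d -> d <= d0 ->
    let m := (a + b) / 2 in let n := (c + d) / 2 in
    P a m c n -> P m b c n -> P a m n d -> P m b n d -> P a b c d) ->
  (forall x y, a0 <= x <= b0 -> c0 <= y <= d0 -> exists2 e : R, 0 < e &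
    forall a b c d, a0 <= a -> b <= b0 -> c0 <= c -> d <= d0 ->
      a <= x <= b -> c <= y <= d -> (b - a) + (d - c) < e -> P a b c d) ->
  P a0 b0 c0 d0.
Proof.
move=> ab0 cd0 Hq Hl; apply: contrapT => NP.
pose Pt (t : R * R * R * R) := let: (a, b, c, d) := t in P a b c d.
pose inv (t : R * R * R * R) := let: (a, b, c, d) := t in
  [/\ a0 <= a, a <= b, b <= b0 & [/\ c0 <= c, c <= d & d <= d0]].
(* The implications sit under the existential so that the choice function is total and can be
   iterated. *)
have step t : exists q, inv t -> ~ Pt t -> ~ Pt (quarter t q).
  apply: contrapT => /forallNP H.
  have it : inv t by apply: contrapT => it; apply: (H (true, true)).
  have nP : ~ Pt t by move=> Pt'; apply: (H (true, true)).
  have {}H q : Pt (quarter t q).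
    by apply: contrapT => nq; apply: (H q).
  apply: nP; move: it H; case: t => [[[a b] c] d] /= [h1 h2 h3 [h4 h5 h6]] H.
  apply: Hq => //=; [exact: (H (false, false))|exact: (H (true, false))|
    exact: (H (false, true))|exact: (H (true, true))].
have [f hf] := choice step.
pose s n := iter n (fun t => quarter t (f t)) (a0, b0, c0, d0).
have quart t q : inv t -> inv (quarter t q).
  case: t => [[[a b] c] d] /= [h1 h2 h3 [h4 h5 h6]].
  have [am mb] := mid_itv h2; have [cm md] := mid_itv h5.
  have [? ?] := (le_trans h1 am, le_trans mb h3).
  have [? ?] := (le_trans h4 cm, le_trans md h6).
  by case: q => [[] []].
have is_ n : inv (s n).
  by elim: n => [|n IH] /=; [split|exact: quart].
have ns n : ~ Pt (s n).
  by elim: n => [//|n IH] /=; exact: hf.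
pose A n := (s n).1.1.1; pose B n := (s n).1.1.2.
pose E n := (s n).1.2; pose F n := (s n).2.
have AB n : B n - A n = (b0 - a0) / 2 ^+ n /\ F n - E n = (d0 - c0) / 2 ^+ n.
  elim: n => [|n [IH1 IH2]]; first by rewrite /A /B /E /F expr0 !divr1.
  move: IH1 IH2; rewrite /A /B /E /F /= exprSr; case: (f (s n)) => q1 q2.
  case: (s n) => [[[a b] c] d] /= h1 h2; rewrite !invfM !mulrA -h1 -h2.
  by case: q1; case: q2; split; field.
have mon n : [/\ A n <= A n.+1, B n.+1 <= B n, E n <= E n.+1 & F n.+1 <= F n].
  have := is_ n; rewrite /A /B /E /F /=; case: (f (s n)) => q1 q2.
  case: (s n) => [[[a b] c] d] /= [h1 h2 h3 [h4 h5 h6]].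
  have [? ?] := mid_itv h2; have [? ?] := mid_itv h5.
  by case: q1; case: q2; split.
have bnds n : [/\ a0 <= A n, A n <= B n, B n <= b0 & [/\ c0 <= E n, E n <= F n & F n <= d0]].
  by have := is_ n; rewrite /A /B /E /F; case: (s n) => [[[a b] c] d].
have [||n|x hx] := @nested_intervals A B; [by move=> n; case: (mon n)..|by case: (bnds n)|].
have [||n|y hy] := @nested_intervals E F; [by move=> n; case: (mon n)..|by case: (bnds n) => ? ? ? []|].
have [e e0 He] := Hl x y (hx 0%N) (hy 0%N).
have [n hn] : exists n : nat, ((b0 - a0) + (d0 - c0)) / 2 ^+ n < e.
  have [n hn] : exists n : nat, ((b0 - a0) + (d0 - c0)) / e < n%:R.
    by exists (Num.bound (((b0 - a0) + (d0 - c0)) / e)); apply: archi_boundP; rewrite divr_ge0 ?(ltW e0) //; lra.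
  exists n; rewrite ltr_pdivrMr ?exprn_gt0 // mulrC -ltr_pdivrMr //.
  apply: lt_le_trans hn _; rewrite -natrX ler_nat; exact/ltnW/ltn_expl.
apply: (ns n); have := He (A n) (B n) (E n) (F n).
have [b1 b2 b3 [b4 b5 b6]] := bnds n; have [w1 w2] := AB n.
move=> /(_ b1 b3 b4 b6 (hx n) (hy n)); rewrite w1 w2 -mulrDl => /(_ hn).
by rewrite /Pt /A /B /E /F; case: (s n) => [[[a b] c] d].
Qed.

End Quartering.

Section Goursat.
Variable R : realType.
Local Notation C := R[i].
Implicit Types (h g : C -> C) (a b c d m x y t : R).

(* The integral of [h w dw] along the boundary of [a,b] x [c,d], opposite edges
   being paired so that constants cancel in the integrands. *)
Definition oint h a b c d : C :=
  cint a b (fun x => h (x +i* c) - h (x +i* d)) +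
  'i * cint c d (fun y => h (b +i* y) - h (a +i* y)).

Arguments oint : simpl never.

Definition edges_ok h a b c d :=
  [/\ cintble a b (fun x => h (x +i* c)), cintble a b (fun x => h (x +i* d)),
      cintble c d (fun y => h (a +i* y)) & cintble c d (fun y => h (b +i* y))].

Lemma cdiff_ccont_h h x y : cdiff h (x +i* y) -> ccont (fun t => h (t +i* y)) x.
Proof.
move=> H e /(cdiff_cvg H)[d d0 hd]; exists d => // u ud.
have := hd u%:C; rewrite nm_real => /(_ ud).
by rewrite (_ : (x +i* y) + u%:C = (x + u) +i* y) //; apply/eqP; rewrite eq_complex /= addr0 !eqxx.
Qed.

Lemma cdiff_ccont_v h x y : cdiff h (x +i* y) -> ccont (fun t => h (x +i* t)) y.
Proof.
move=> H e /(cdiff_cvg H)[d d0 hd]; exists d => // u ud.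
have := hd (0 +i* u); rewrite /Normc.normc expr0n /= add0r sqrtr_sqr => /(_ ud).
by rewrite (_ : (x +i* y) + (0 +i* u) = x +i* (y + u)) //; apply/eqP; rewrite eq_complex /= addr0 !eqxx.
Qed.

Lemma hedge_ok h a b y : (forall x, a <= x <= b -> cdiff h (x +i* y)) ->
  cintble a b (fun x => h (x +i* y)).
Proof. by move=> H; apply: ccont_cintble => x /H /cdiff_ccont_h. Qed.

Lemma vedge_ok h c d x : (forall y, c <= y <= d -> cdiff h (x +i* y)) ->
  cintble c d (fun y => h (x +i* y)).
Proof. by move=> H; apply: ccont_cintble => y /H /cdiff_ccont_v. Qed.

Lemma cdiff_edges_ok h a b c d : a <= b -> c <= d ->
  (forall x y, a <= x <= b -> c <= y <= d -> cdiff h (x +i* y)) ->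
  edges_ok h a b c d.
Proof.
move=> ab cd H; split; [apply: hedge_ok => ? ?|apply: hedge_ok => ? ?|
  apply: vedge_ok => ? ?|apply: vedge_ok => ? ?]; apply: H => //; lra.
Qed.

Lemma ointE h a b c d : edges_ok h a b c d ->
  oint h a b c d = cint a b (fun x => h (x +i* c)) - cint a b (fun x => h (x +i* d)) +
    'i * (cint c d (fun y => h (b +i* y)) - cint c d (fun y => h (a +i* y))).
Proof. by move=> [h1 h2 h3 h4]; rewrite -!cintB. Qed.

Lemma oint_splitx h a m b c d : a <= m -> m <= b ->
  edges_ok h a b c d -> cintble c d (fun y => h (m +i* y)) ->
  oint h a b c d = oint h a m c d + oint h m b c d.
Proof.
move=> am mb ok h5; have [h1 h2 h3 h4] := ok.
rewrite !ointE //; last 2 first.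
- by split => //; [exact: cintbleS h1|exact: cintbleS h2].
- by split => //; [exact: cintbleS h1|exact: cintbleS h2].
rewrite (cint_split am mb h1) (cint_split am mb h2); ring.
Qed.

Lemma oint_splity h a b c m d : c <= m -> m <= d ->
  edges_ok h a b c d -> cintble a b (fun x => h (x +i* m)) ->
  oint h a b c d = oint h a b c m + oint h a b m d.
Proof.
move=> cm md ok h5; have [h1 h2 h3 h4] := ok.
rewrite !ointE //; last 2 first.
- by split => //; [exact: cintbleS h3|exact: cintbleS h4].
- by split => //; [exact: cintbleS h3|exact: cintbleS h4].
rewrite (cint_split cm md h3) (cint_split cm md h4); ring.
Qed.

Lemma eq_oint h g a b c d : a <= b -> c <= d ->
  (forall x y, a <= x <= b -> c <= y <= d -> x = a \/ x = b \/ y = c \/ y = d ->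
     h (x +i* y) = g (x +i* y)) -> oint h a b c d = oint g a b c d.
Proof.
move=> ab cd H; rewrite /oint; congr (_ + 'i * _); apply: cint_eq => t ht.
- by rewrite !H //; lra || tauto.
- by rewrite !H //; lra || tauto.
Qed.

Lemma edges_okD h g a b c d : edges_ok h a b c d -> edges_ok g a b c d ->
  edges_ok (fun w => h w + g w) a b c d.
Proof. by move=> [? ? ? ?] [? ? ? ?]; split; exact: cintbleD. Qed.

Lemma edges_okZ h k a b c d : edges_ok h a b c d ->
  edges_ok (fun w => k * h w) a b c d.
Proof. by move=> [? ? ? ?]; split; exact: cintbleZ. Qed.

Lemma ointZ h k a b c d : edges_ok h a b c d ->
  oint (fun w => k * h w) a b c d = k * oint h a b c d.
Proof.
move=> ok; have okk := edges_okZ k ok; rewrite !ointE //.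
case: ok => h1 h2 h3 h4; rewrite !cintZ //; ring.
Qed.

Lemma ointD h g a b c d : edges_ok h a b c d -> edges_ok g a b c d ->
  oint (fun w => h w + g w) a b c d = oint h a b c d + oint g a b c d.
Proof.
move=> okh okg; have okD := edges_okD okh okg; rewrite !ointE //.
case: okh => h1 h2 h3 h4; case: okg => g1 g2 g3 g4; rewrite !cintD //; ring.
Qed.

Lemma oint_bound h a b c d (M : R) : a <= b -> c <= d -> edges_ok h a b c d ->
  (forall x y, a <= x <= b -> c <= y <= d -> x = a \/ x = b \/ y = c \/ y = d ->
     nm (h (x +i* y)) <= M) ->
  nm (oint h a b c d) <= 4 * M * ((b - a) + (d - c)).
Proof.
move=> ab cd [h1 h2 h3 h4] H; apply: le_trans (nmD _ _) _; rewrite nmM nm_i mul1r.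
have b1 : nm (cint a b (fun x => h (x +i* c) - h (x +i* d))) <= 2 * (2 * M * (b - a)).
  apply: cint_bound => //; first exact: cintbleB.
  move=> x xab; apply: le_trans (nmBD _ _) _.
  have := H x c xab; have := H x d xab; rewrite !lexx !cd /=.
  by move=> /(_ isT ltac:(tauto)) ? /(_ isT ltac:(tauto)) ?; lra.
have b2 : nm (cint c d (fun y => h (b +i* y) - h (a +i* y))) <= 2 * (2 * M * (d - c)).
  apply: cint_bound => //; first exact: cintbleB.
  move=> y ycd; apply: le_trans (nmBD _ _) _.
  have := H a y; have := H b y; rewrite !lexx !ab /=.
  by move=> /(_ isT ycd ltac:(tauto)) ? /(_ isT ycd ltac:(tauto)) ?; lra.
lra.
Qed.

Lemma oint_cst (k : C) a b c d : a <= b -> c <= d -> oint (fun=> k) a b c d = 0.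
Proof. by move=> ab cd; rewrite /oint !cint_cst // subrr !mul0r mulr0 addr0. Qed.

Lemma oint_id a b c d : a <= b -> c <= d -> oint id a b c d = 0.
Proof.
move=> ab cd; rewrite /oint.
rewrite (cint_eq (g := fun=> 0 +i* (c - d))); last first.
  by move=> x _; apply/eqP; rewrite eq_complex /= subrr !eqxx.
rewrite (cint_eq (f := fun y => _ - _) (g := fun=> (b - a)%:C)); last first.
  by move=> x _; apply/eqP; rewrite eq_complex /= subrr !eqxx.
rewrite !cint_cst //; apply/eqP; rewrite eq_complex /=.
by apply/andP; split; apply/eqP; ring.
Qed.

Lemma edges_ok_cst (k : C) a b c d : edges_ok (fun=> k) a b c d.
Proof. by split; exact: cintble_cst. Qed.

(** The induction runs on the bound [e * s], where [s] is the square of width plus height: its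
    values on the four quarters add up exactly to its value on the rectangle, so the bound passes
    upwards. Locally it comes from complex differentiability. *)
Theorem goursat h a0 b0 c0 d0 : a0 <= b0 -> c0 <= d0 ->
  (forall x y, a0 <= x <= b0 -> c0 <= y <= d0 -> cdiff h (x +i* y)) ->
  oint h a0 b0 c0 d0 = 0.
Proof.
move=> ab cd H.
pose s a b c d := ((b - a) + (d - c)) ^+ 2.
suff key e : 0 < e -> nm (oint h a0 b0 c0 d0) <= e * s a0 b0 c0 d0.
  apply: nm0P => e e0; have s0 : 0 < s a0 b0 c0 d0 + 1 by rewrite ltr_wpDl // sqr_ge0.
  apply: le_trans (key (e / (s a0 b0 c0 d0 + 1)) (divr_gt0 e0 s0)) _.
  rewrite -mulrA ler_piMr ?(ltW e0) // mulrC ler_pdivrMr // mul1r; lra.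
move=> e0.
apply: (@quartering_induction _ (fun a b c d => nm (oint h a b c d) <= e * s a b c d)) => //.
  move=> a b c d aa ab' bb cc cd' dd m n; rewrite /m /n => {m n}.
  set m := (a + b) / 2; set n := (c + d) / 2 => P1 P2 P3 P4.
  have [am mb] := mid_itv ab'.
  have [cn nd] := mid_itv cd'.
  have ok x1 x2 y1 y2 : a <= x1 -> x1 <= x2 -> x2 <= b -> c <= y1 -> y1 <= y2 ->
      y2 <= d -> edges_ok h x1 x2 y1 y2.
    move=> ax x12 xb cy y12 yd; apply: cdiff_edges_ok => // x y hx hy.
    by apply: H; [clear - aa bb ax xb hx|clear - cc dd cy yd hy]; lra.
  have e1 : oint h a b c d = oint h a m c d + oint h m b c d.
    by apply: oint_splitx => //; [exact: ok|case: (ok a m c d)].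
  have e2 : oint h a m c d = oint h a m c n + oint h a m n d.
    by apply: oint_splity => //; [exact: ok|case: (ok a m c n)].
  have e3 : oint h m b c d = oint h m b c n + oint h m b n d.
    by apply: oint_splity => //; [exact: ok|case: (ok m b c n)].
  rewrite e1 e2 e3.
  have := nmD (oint h a m c n + oint h a m n d) (oint h m b c n + oint h m b n d).
  have := nmD (oint h a m c n) (oint h a m n d).
  have := nmD (oint h m b c n) (oint h m b n d).
  have -> : e * s a b c d = e * s a m c n + e * s m b c n + e * s a m n d + e * s m b n d.
    by rewrite /s /m /n; field.
  lra.
move=> x0 y0 hx hy; have [k hk] := H _ _ hx hy.
have e80 : 0 < e / 4 by rewrite divr_gt0.
have [dl dl0 hd] := hk _ e80; exists dl => // a b c d aa bb cc dd xab ycd small.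
set p := x0 +i* y0 in hk hd.
have ab' : a <= b by lra.
have cd' : c <= d by lra.
(* [r] is [h] minus its first-order expansion at [p]; the subtracted affine function has zero
   boundary integral. *)
pose r w := h w + ((- k) * w + (k * p - h p)).
have okh : edges_ok h a b c d by apply: cdiff_edges_ok => // *; apply: H; lra.
have oki : edges_ok (fun w : C => w) a b c d.
  by apply: cdiff_edges_ok => // *; exact: cdiff_id.
have okl := edges_okD (edges_okZ (- k) oki) (edges_ok_cst (k * p - h p) a b c d).
have <- : oint r a b c d = oint h a b c d.
  rewrite /r ointD // ointD //; [|exact: edges_okZ|exact: edges_ok_cst].
  by rewrite ointZ // oint_id // oint_cst // mulr0 !addr0.
have -> : e * s a b c d = 4 * (e / 4 * ((b - a) + (d - c))) * ((b - a) + (d - c)).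
  by rewrite /s; field.
apply: oint_bound => //; first exact: edges_okD.
move=> x y xh yh _; set w := x +i* y.
have wp : nm (w - p) <= (b - a) + (d - c).
  apply: le_trans (nm_le_ReIm _) _ => /=.
  by rewrite lerD // ler_norml; lra.
have := hd (w - p) (le_lt_trans wp small).
rewrite (_ : h (p + (w - p)) - h p - k * (w - p) = r w); last by rewrite [p + _]addrC subrK /r; ring.
by move=> /le_trans; apply; rewrite ler_wpM2l // ltW.
Qed.

End Goursat.

Section CauchyFormula.
Variable R : realType.
Local Notation C := R[i].
Implicit Types (h g : C -> C) (a b c d x y t : R) (z w : C).

Lemma boundary_edges_ok h a b c d : a <= b -> c <= d ->
  (forall x y, a <= x <= b -> c <= y <= d -> x = a \/ x = b \/ y = c \/ y = d ->
     cdiff h (x +i* y)) -> edges_ok h a b c d.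
Proof.
move=> ab cd H; have [aab bab] : a <= a <= b /\ a <= b <= b by rewrite !lexx ab.
have [ccd dcd] : c <= c <= d /\ c <= d <= d by rewrite !lexx cd.
split; [apply: hedge_ok => ? ?|apply: hedge_ok => ? ?|
  apply: vedge_ok => ? ?|apply: vedge_ok => ? ?]; apply: H => //; tauto.
Qed.

(** The frame between the two rectangles is cut into full-height strips on the left and right and
    two remaining pieces below and above; Goursat's theorem kills each of the four. *)
Lemma oint_frame h a a' b' b c c' d' d :
  a <= a' -> a' <= b' -> b' <= b -> c <= c' -> c' <= d' -> d' <= d ->
  (forall x y, a <= x <= b -> c <= y <= d -> ~~ ((a' < x < b') && (c' < y < d')) ->
     cdiff h (x +i* y)) ->
  oint h a b c d = oint h a' b' c' d'.
Proof.
move=> aa ab bb cc cd dd H.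
have [ab' a'b] := (le_trans aa ab, le_trans ab bb).
have [cd' c'd] := (le_trans cc cd, le_trans cd dd).
have [abl cdl] := (le_trans ab' bb, le_trans cd' dd).
have Hx x y : a <= x <= b -> c <= y <= d -> x <= a' \/ b' <= x -> cdiff h (x +i* y).
  move=> hx hy hxx; apply: H => //; rewrite negb_and; apply/orP; left.
  by rewrite negb_and -!leNgt; case: hxx => ->; rewrite ?orbT.
have Hy x y : a <= x <= b -> c <= y <= d -> y <= c' \/ d' <= y -> cdiff h (x +i* y).
  move=> hx hy hyy; apply: H => //; rewrite negb_and; apply/orP; right.
  by rewrite negb_and -!leNgt; case: hyy => ->; rewrite ?orbT.
have vok x l u : c <= l -> u <= d -> a <= x <= b -> x <= a' \/ b' <= x ->
    cintble l u (fun y => h (x +i* y)).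
  move=> cl ud hx hxx; apply: vedge_ok => y /andP[ly yu]; apply: Hx => //.
  by rewrite (le_trans cl ly) (le_trans yu ud).
have hok y l u : a <= l -> u <= b -> c <= y <= d -> y <= c' \/ d' <= y ->
    cintble l u (fun x => h (x +i* y)).
  move=> al ub hy hyy; apply: hedge_ok => x /andP[lx xu]; apply: Hy => //.
  by rewrite (le_trans al lx) (le_trans xu ub).
have e1 : oint h a b c d = oint h a a' c d + oint h a' b c d.
  apply: oint_splitx => //; last by apply: vok; rewrite ?aa //; left.
  by split; [apply: hok|apply: hok|apply: vok|apply: vok]; rewrite ?lexx ?abl ?cdl //; auto.
have e2 : oint h a' b c d = oint h a' b' c d + oint h b' b c d.
  apply: oint_splitx => //; last by apply: vok; rewrite ?ab' //; right.
  by split; [apply: hok|apply: hok|apply: vok|apply: vok]; rewrite ?lexx ?aa ?abl ?cdl //; auto.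
have e3 : oint h a' b' c d = oint h a' b' c c' + oint h a' b' c' d.
  apply: oint_splity => //; last by apply: hok; rewrite ?cc //; left.
  by split; [apply: hok|apply: hok|apply: vok|apply: vok]; rewrite ?lexx ?aa ?ab' ?abl ?cdl //; auto.
have e4 : oint h a' b' c' d = oint h a' b' c' d' + oint h a' b' d' d.
  apply: oint_splity => //; last by apply: hok; rewrite ?cd' //; right.
  by split; [apply: hok|apply: hok|apply: vok|apply: vok]; rewrite ?lexx ?aa ?cc ?ab' ?abl ?cdl //; auto.
have z1 : oint h a a' c d = 0.
  apply: goursat => // x y /andP[ax xb] hy; apply: Hx => //; last by left.
  by rewrite ax (le_trans xb a'b).
have z2 : oint h b' b c d = 0.
  apply: goursat => // x y /andP[ax xb] hy; apply: Hx => //; last by right.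
  by rewrite xb (le_trans ab' ax).
have z3 : oint h a' b' c c' = 0.
  apply: goursat => // x y /andP[ax xb] /andP[cy yd]; apply: Hy; last by left.
    by rewrite (le_trans aa ax) (le_trans xb bb).
  by rewrite cy (le_trans yd c'd).
have z4 : oint h a' b' d' d = 0.
  apply: goursat => // x y /andP[ax xb] /andP[cy yd]; apply: Hy; last by right.
    by rewrite (le_trans aa ax) (le_trans xb bb).
  by rewrite yd (le_trans cd' cy).
by rewrite e1 e2 e3 e4 z1 z2 z3 z4 !add0r !addr0.
Qed.

Lemma cImD z w : cIm (z + w) = cIm z + cIm w.
Proof. by case: z; case: w. Qed.

Lemma rint_lb (g : R -> R) a b (M : R) : a <= b -> rintble a b g ->
  (forall x, a <= x <= b -> M <= g x) -> M * (b - a) <= rint a b g.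
Proof.
move=> ab h H; rewrite -rint_cst //.
by apply: le_Rintegral => //; exact: (rintble_cst M a b).
Qed.

Definition square_oint (z : C) t := fun h => oint h (cRe z - t) (cRe z + t) (cIm z - t) (cIm z + t).

Arguments square_oint : simpl never.

(* The exact value is [2 pi i], which is not needed. *)
Lemma winding_square_lb z t : 0 < t -> 4 <= nm (square_oint z t (fun w => (w - z)^-1)).
Proof.
case: z => x0 y0 t0; apply: le_trans (le_trans _ (nm_Im _)); last exact: ler_norm.
have ok : edges_ok (fun w => (w - (x0 +i* y0))^-1) (x0 - t) (x0 + t) (y0 - t) (y0 + t).
  apply: boundary_edges_ok; [lra|lra|] => x y _ _ hb; apply: cdiff_inv.
  by apply/eqP => -[xx yy]; move: hb; rewrite xx yy; lra.
have [h1 h2 h3 h4] := ok.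
have [h12 _] := cintbleB h1 h2; have [_ h12'] := cintbleB h1 h2.
have [h43 _] := cintbleB h4 h3.
rewrite /square_oint /oint cImD cImM [cRe 'i]/= [cIm 'i]/= mul0r mul1r add0r /cint [cRe (x0 +i* y0)]/= [cIm (x0 +i* y0)]/= [cIm (_ +i* _)]/= [cRe (_ +i* _)]/=.
(* On each pair of opposite edges the integrand has the form [2t / (s^2 + t^2)], at least [1/t] over
   a length [2t]; the two pairs contribute 2 each. *)
have low (s : R) : - t <= s <= t -> t^-1 <= t / (s ^+ 2 + t ^+ 2) + t / (s ^+ 2 + t ^+ 2).
  move=> /andP[s1 s2]; have t20 : 0 < t ^+ 2 by rewrite exprn_gt0.
  have p : 0 < s ^+ 2 + t ^+ 2 by rewrite ltr_wpDl // sqr_ge0.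
  rewrite -mulrDl ler_pdivlMr // mulrC ler_pdivrMr //; nra.
have b1 : t^-1 * ((x0 + t) - (x0 - t)) <= rint (x0 - t) (x0 + t) (fun x =>
    cIm ((x +i* (y0 - t) - (x0 +i* y0))^-1 - (x +i* (y0 + t) - (x0 +i* y0))^-1)).
  apply: rint_lb => //; first lra.
  move=> x hx; rewrite raddfB /=.
  have -> : y0 - t - y0 = - t by ring.
  have -> : y0 + t - y0 = t by ring.
  rewrite mulNr sqrrN !opprK; apply: low; lra.
have b2 : t^-1 * ((y0 + t) - (y0 - t)) <= rint (y0 - t) (y0 + t) (fun y =>
    cRe (((x0 + t) +i* y - (x0 +i* y0))^-1 - ((x0 - t) +i* y - (x0 +i* y0))^-1)).
  apply: rint_lb => //; first lra.
  move=> y hy; rewrite raddfB /=.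
  have -> : x0 - t - x0 = - t by ring.
  have -> : x0 + t - x0 = t by ring.
  rewrite mulNr opprK sqrrN [t ^+ 2 + _]addrC; apply: low; lra.
have e (u : R) : t^-1 * ((u + t) - (u - t)) = 2.
  by have tn : t != 0 by [rewrite gt_eqF]; field.
move: b1 b2; rewrite !e; lra.
Qed.

(** Differentiability at [z] bounds the quotient nearby, so after shrinking the rectangle to a
    square of half-side [t] about [z] the integral is [O(t)]. *)
Lemma cauchy_quotient h z a b c d : a < cRe z < b -> c < cIm z < d ->
  (forall x y, a <= x <= b -> c <= y <= d -> cdiff h (x +i* y)) ->
  oint (fun w => (h w - h z) * (w - z)^-1) a b c d = 0.
Proof.
case: z => x0 y0 /= /andP[ax xb] /andP[cy yd] H; set z := x0 +i* y0.
have Hq x y : a <= x <= b -> c <= y <= d -> (x +i* y) != z ->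
    cdiff (fun w => (h w - h z) * (w - z)^-1) (x +i* y).
  move=> hx hy ne; apply: cdiffM; last exact: cdiff_inv.
  by apply: cdiffB; [exact: H|exact: cdiff_cst].
have [K K0 [dl dl0 hd]] := cdiff_O (H x0 y0 ltac:(lra) ltac:(lra)).
apply: nm0P => e e0.
(* The square must fit in the rectangle and in the disc where the quotient is at most [K]; its
   boundary integral is then at most [16 K t <= e]. *)
pose t := Num.min (Num.min (Num.min (x0 - a) (b - x0)) (Num.min (y0 - c) (d - y0)))
  (Num.min (dl / 4) (e / (16 * K))).
have t0 : 0 < t by rewrite /t !lt_min !subr_gt0 ax xb cy yd !divr_gt0 // mulr_gt0.
have [t1 t2 t3 [t4 t5 t6]] : [/\ t <= x0 - a, t <= b - x0, t <= y0 - c &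
    [/\ t <= d - y0, t <= dl / 4 & t <= e / (16 * K)]].
  by split; last split; rewrite /t !ge_min lexx ?orbT.
rewrite (@oint_frame _ a (x0 - t) (x0 + t) b c (y0 - t) (y0 + t) d); try lra; last first.
  move=> x y hx hy nin; apply: Hq => //; apply: contra nin => /eqP[-> ->].
  by rewrite !ltrBlDr !ltrDl t0.
apply: le_trans (oint_bound (M := K) _ _ _ _) _; try lra.
- apply: boundary_edges_ok; [lra|lra|] => x y hx hy hb; apply: Hq; [lra|lra|].
  by apply/eqP => -[xx yy]; move: hb; rewrite xx yy; lra.
- move=> x y hx hy hb; rewrite nmM nmV; set w := x +i* y.
  have wz : w - z != 0.
    by rewrite subr_eq0; apply/eqP => -[xx yy]; move: hb; rewrite xx yy; lra.
  rewrite ler_pdivrMr ?nm_gt0 //.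
  have -> : h w = h (z + (w - z)) by rewrite [z + _]addrC subrK.
  apply: hd; apply: le_lt_trans (nm_le_ReIm _) _ => /=.
  have : `|x - x0| <= t by rewrite ler_norml; lra.
  have : `|y - y0| <= t by rewrite ler_norml; lra.
  lra.
- move: t6; rewrite ler_pdivlMr ?mulr_gt0 //; lra.
Qed.

End CauchyFormula.

(** * Taylor expansion with remainder on squares *)

Section Taylor.
Variable R : realType.
Local Notation C := R[i].
Implicit Types (h g : C -> C) (r : R) (z w : C).

Lemma square_boundary z0 r x y : 0 < r ->
  cRe z0 - r <= x <= cRe z0 + r -> cIm z0 - r <= y <= cIm z0 + r ->
  x = cRe z0 - r \/ x = cRe z0 + r \/ y = cIm z0 - r \/ y = cIm z0 + r ->
  r <= nm ((x +i* y) - z0).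
Proof.
case: z0 => a b /= r0 hx hy hb.
have [hr|hr] : `|x - a| = r \/ `|y - b| = r.
  have e1 (u : R) : `|u - r - u| = r by rewrite (_ : _ - _ = - r) ?normrN ?gtr0_norm //; ring.
  have e2 (u : R) : `|u + r - u| = r by rewrite (_ : _ - _ = r) ?gtr0_norm //; ring.
  by case: hb => [->|[->|[->|->]]]; [left|left|right|right]; rewrite ?e1 ?e2.
- by rewrite -hr; exact: (nm_Re ((x +i* y) - (a +i* b))).
- by rewrite -hr; exact: (nm_Im ((x +i* y) - (a +i* b))).
Qed.

Lemma square_in_disc z0 r x y :
  cRe z0 - r <= x <= cRe z0 + r -> cIm z0 - r <= y <= cIm z0 + r ->
  nm ((x +i* y) - z0) <= 2 * r.
Proof.
case: z0 => a b hx hy; apply: le_trans (nm_le_ReIm _) _; move: hx hy => /= hx hy.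
have : `|x - a| <= r by rewrite ler_norml; lra.
have : `|y - b| <= r by rewrite ler_norml; lra.
lra.
Qed.

(** The boundary of a square of half-side [r] lies in the ring [r <= |w - z0| <= 2r]; hypotheses are
    put on that ring so that later arguments involve only moduli. *)
Lemma square_edges_ok h z0 r : 0 < r ->
  (forall w, r <= nm (w - z0) -> nm (w - z0) <= 2 * r -> cdiff h w) ->
  edges_ok h (cRe z0 - r) (cRe z0 + r) (cIm z0 - r) (cIm z0 + r).
Proof.
move=> r0 H; apply: boundary_edges_ok; [lra|lra|] => x y hx hy hb; apply: H.
  exact: square_boundary hx hy hb.
exact: square_in_disc hx hy.
Qed.

Lemma square_oint_bound h z0 r (M : R) : 0 < r ->
  (forall w, r <= nm (w - z0) -> nm (w - z0) <= 2 * r -> cdiff h w) ->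
  (forall w, r <= nm (w - z0) -> nm (w - z0) <= 2 * r -> nm (h w) <= M) ->
  nm (square_oint z0 r h) <= 16 * M * r.
Proof.
move=> r0 dh hM; apply: le_trans (oint_bound (M := M) _ _ (square_edges_ok r0 dh) _) _; try lra.
move=> x y hx hy hb; apply: hM; first exact: square_boundary hx hy hb.
exact: square_in_disc hx hy.
Qed.

Lemma square_oint_frame h z0 r r' : 0 < r -> r <= r' ->
  (forall w, r <= nm (w - z0) -> nm (w - z0) <= 2 * r' -> cdiff h w) ->
  square_oint z0 r' h = square_oint z0 r h.
Proof.
move=> r0 rr H; apply: oint_frame; try lra.
move=> x y hx hy hn; apply: H; last exact: square_in_disc hx hy.
move: hn; rewrite negb_and !negb_and -!leNgt => hn.
have [hr|hr] : r <= `|x - cRe z0| \/ r <= `|y - cIm z0|.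
- move: hn => /orP[/orP[hn|hn]|/orP[hn|hn]]; [left|left|right|right].
  + by rewrite ler0_norm; lra.
  + by rewrite ger0_norm; lra.
  + by rewrite ler0_norm; lra.
  + by rewrite ger0_norm; lra.
- by apply: le_trans hr _; case: z0 {hx hy hn} => a b; exact: (nm_Re ((x +i* y) - (a +i* b))).
- by apply: le_trans hr _; case: z0 {hx hy hn} => a b; exact: (nm_Im ((x +i* y) - (a +i* b))).
Qed.

Lemma winding_rect_lb z a b c d : a < cRe z < b -> c < cIm z < d ->
  4 <= nm (oint (fun w => (w - z)^-1) a b c d).
Proof.
move=> /andP[ax xb] /andP[cy yd].
pose t := Num.min (Num.min (b - cRe z) (cRe z - a)) (Num.min (d - cIm z) (cIm z - c)).
have t0 : 0 < t by rewrite /t !lt_min !subr_gt0 ax xb cy yd.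
have [t1 t2 t3 t4] : [/\ t <= b - cRe z, t <= cRe z - a, t <= d - cIm z & t <= cIm z - c].
  by split; rewrite /t !ge_min lexx ?orbT.
apply: le_trans (winding_square_lb z t0) _; rewrite /square_oint.
rewrite (@oint_frame _ _ a (cRe z - t) (cRe z + t) b c (cIm z - t) (cIm z + t) d) //; try lra.
move=> x y hx hy nin; apply: cdiff_inv; apply: contra nin => /eqP <- /=.
by rewrite !ltrBlDr !ltrDl t0.
Qed.

Lemma winding_lb z z0 r : nm (z - z0) < r -> 4 <= nm (square_oint z0 r (fun w => (w - z)^-1)).
Proof.
case: z z0 => x y [a b] zr.
have hR : `|x - a| < r.
  by apply: le_lt_trans zr; exact: (nm_Re ((x +i* y) - (a +i* b))).
have hI : `|y - b| < r.
  by apply: le_lt_trans zr; exact: (nm_Im ((x +i* y) - (a +i* b))).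
by move: hR hI; rewrite !ltr_norml => hR hI; apply: winding_rect_lb => /=; lra.
Qed.

(** The Taylor coefficient times [2 pi i]. The normalising factor stays on the left of the expansion
    in [taylor], as the integral of [1 / (w - z)]. *)
Definition taylor_coef h z0 r p := square_oint z0 r (fun w => h w * ((w - z0)^-1) ^+ p.+1).

Definition taylor_rem h z0 r m z := square_oint z0 r (fun w => h w * ((w - z0)^-1) ^+ m * (w - z)^-1).

Arguments taylor_coef : simpl never.
Arguments taylor_rem : simpl never.

Lemma cdiff_invX h z0 w p : w != z0 -> cdiff h w ->
  cdiff (fun w => h w * ((w - z0)^-1) ^+ p) w.
Proof. by move=> ne hh; apply: cdiffM => //; apply: cdiffX; exact: cdiff_inv. Qed.

Lemma away_neq z0 r w : 0 < r -> r <= nm (w - z0) -> w != z0.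
Proof. by move=> r0 /(lt_le_trans r0); rewrite nm_gt0 subr_eq0. Qed.

(** For [m = 0] this is Cauchy's formula. The induction step integrates [1/(w-z) = 1/(w-z0) +
    (z-z0)/((w-z0)(w-z))] against [h w / (w-z0)^m]. *)
Lemma taylor h z0 r z m : nm (z - z0) < r ->
  (forall w, nm (w - z0) <= 2 * r -> cdiff h w) ->
  h z * square_oint z0 r (fun w => (w - z)^-1) =
  \sum_(p < m) (z - z0) ^+ p * taylor_coef h z0 r p + (z - z0) ^+ m * taylor_rem h z0 r m z.
Proof.
move=> zr dh; have r0 : 0 < r by apply: le_lt_trans zr; exact: nm_ge0.
have zne w : r <= nm (w - z0) -> w != z.
  by move=> rw; apply: contraL zr => /eqP <-; rewrite -leNgt.
have dinv w : r <= nm (w - z0) -> nm (w - z0) <= 2 * r -> cdiff (fun w => (w - z)^-1) w.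
  by move=> h1 _; apply: cdiff_inv; exact: zne.
elim: m => [|m IH].
  rewrite big_ord0 add0r expr0 mul1r /taylor_rem.
  have okq : edges_ok (fun w => (h w - h z) * (w - z)^-1) (cRe z0 - r) (cRe z0 + r) (cIm z0 - r) (cIm z0 + r).
    apply: square_edges_ok => // w h1 h2; apply: cdiffM; last exact: dinv.
    by apply: cdiffB; [exact: dh|exact: cdiff_cst].
  have q0 : oint (fun w => (h w - h z) * (w - z)^-1) (cRe z0 - r) (cRe z0 + r) (cIm z0 - r) (cIm z0 + r) = 0.
    apply: cauchy_quotient.
    - have : `|cRe z - cRe z0| < r.
        by apply: le_lt_trans zr; case: (z) (z0) => a b [a' b']; exact: (nm_Re ((a +i* b) - (a' +i* b'))).
      by rewrite ltr_norml; lra.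
    - have : `|cIm z - cIm z0| < r.
        by apply: le_lt_trans zr; case: (z) (z0) => a b [a' b']; exact: (nm_Im ((a +i* b) - (a' +i* b'))).
      by rewrite ltr_norml; lra.
    - by move=> x y hx hy; apply: dh; exact: square_in_disc hx hy.
  have oki := square_edges_ok r0 dinv.
  rewrite /square_oint -(ointZ (h z) oki) -[LHS]add0r -q0 -ointD //; last exact: edges_okZ.
  by apply: eq_oint => [||x y _ _ _]; [lra|lra|rewrite expr0 mulr1 -mulrDl subrK].
rewrite IH big_ord_recr /= -addrA; congr (_ + _); rewrite exprSr -mulrA -mulrDr; congr (_ * _).
have dA w : r <= nm (w - z0) -> nm (w - z0) <= 2 * r ->
    cdiff (fun w => h w * ((w - z0)^-1) ^+ m.+1) w.
  by move=> h1 h2; apply: cdiff_invX; [exact: away_neq h1|exact: dh].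
have okA := square_edges_ok r0 dA.
have okB : edges_ok (fun w => h w * ((w - z0)^-1) ^+ m.+1 * (w - z)^-1) (cRe z0 - r) (cRe z0 + r) (cIm z0 - r) (cIm z0 + r).
  by apply: square_edges_ok => // w h1 h2; apply: cdiffM; [exact: dA|exact: dinv].
rewrite /taylor_coef /taylor_rem /square_oint -ointZ // -ointD //; last exact: edges_okZ.
apply: eq_oint; [lra|lra|] => x y hx hy hb.
have rb := square_boundary r0 hx hy hb; set w := x +i* y in rb *.
have w0 : w - z0 != 0 by rewrite subr_eq0; exact: away_neq rb.
have w1 : w - z != 0 by rewrite subr_eq0; exact: zne.
rewrite !exprS; set q := _ ^+ m; field; by rewrite w0 w1.
Qed.

Lemma taylor_rem_bound h z0 r z m (M : R) : nm (z - z0) < r ->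
  (forall w, nm (w - z0) <= 2 * r -> cdiff h w) ->
  (forall w, nm (w - z0) <= 2 * r -> nm (h w) <= M) ->
  nm (taylor_rem h z0 r m z) <= 16 * (M / (r ^+ m * (r - nm (z - z0)))) * r.
Proof.
move=> zr dh hM; have r0 : 0 < r by apply: le_lt_trans zr; exact: nm_ge0.
apply: square_oint_bound => // w h1 h2.
  apply: cdiffM; first by apply: cdiff_invX; [exact: away_neq h1|exact: dh].
  by apply: cdiff_inv; apply: contraL zr => /eqP <-; rewrite -leNgt.
rewrite nmM nmM nmX !nmV invfM mulrA.
have p1 : 0 < r - nm (z - z0) by rewrite subr_gt0.
have p2 : r - nm (z - z0) <= nm (w - z).
  have := nm_lerB (w - z0) (z - z0); rewrite (_ : w - z0 - (z - z0) = w - z); last by ring.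
  by lra.
apply: ler_pM; rewrite ?mulr_ge0 ?invr_ge0 ?exprn_ge0 ?nm_ge0 ?invr_ge0 ?nm_ge0 //; last first.
  by rewrite lef_pV2 // posrE //; exact: lt_le_trans p2.
apply: ler_pM; rewrite ?invr_ge0 ?exprn_ge0 ?nm_ge0 ?invr_ge0 ?nm_ge0 ?hM //.
rewrite -exprVn lerXn2r ?nnegrE ?invr_ge0 ?nm_ge0 ?(ltW r0) //.
by rewrite lef_pV2 // posrE //; exact: lt_le_trans h1.
Qed.

End Taylor.

(** * The identity theorem along a segment *)

Section Identity.
Variable R : realType.
Local Notation C := R[i].
Implicit Types (h g : C -> C) (r : R) (z w : C).

Lemma le0_geometric (B q : R) (x : R) : 0 <= q -> q < 1 ->
  (forall m : nat, x <= B * q ^+ m) -> x <= 0.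
Proof.
move=> q0 q1 H; apply/ler_addgt0Pr => e e0; rewrite add0r.
have [B0|B0] := leP B 0.
  by apply: le_trans (H 0%N) _; rewrite expr0 mulr1; lra.
have : ((fun m => B * q ^+ m) @ \oo --> (B * 0 : R^o))%classic.
  by apply: cvgMl_tmp; apply: cvg_expr; rewrite ger0_norm.
rewrite mulr0 => /cvgrPdist_lt /(_ e e0) [m _ /(_ m (leqnn m))].
rewrite sub0r normrN => /(le_lt_trans (ler_norm _)) /ltW; exact: le_trans (H m).
Qed.

Definition holo_at h z := exists2 d : R, 0 < d & forall w, nm (w - z) < d -> cdiff h w.

Definition zero_accum h z0 := forall e : R, 0 < e ->
  exists z, [/\ z != z0, nm (z - z0) < e & h z = 0].

(** If the coefficients below [p] vanish, the expansion at a zero [z != z0] reads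
    [coef p = - (z - z0) * remainder], which is arbitrarily small as [z] tends to [z0]; so all
    coefficients vanish by strong induction. *)
Lemma local_identity h z0 : holo_at h z0 -> zero_accum h z0 ->
  exists2 r : R, 0 < r & forall z, nm (z - z0) < r -> h z = 0.
Proof.
move=> [dl dl0 dh] hz.
have d0 : cdiff h z0 by apply: dh; rewrite subrr nm0.
have [d1 d10 hd1] := cdiff_cvg d0 ltr01.
pose M := nm (h z0) + 1.
pose r := Num.min dl d1 / 4.
have mi0 : 0 < Num.min dl d1 by rewrite lt_min dl0.
have r0 : 0 < r by rewrite divr_gt0.
have r2 w : nm (w - z0) <= 2 * r -> nm (w - z0) < Num.min dl d1.
  by move=> /le_lt_trans; apply; rewrite /r; lra.
have {}dh w : nm (w - z0) <= 2 * r -> cdiff h w.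
  by move=> /r2; rewrite lt_min => /andP[/dh].
have hM w : nm (w - z0) <= 2 * r -> nm (h w) <= M.
  move=> /r2; rewrite lt_min => /andP[_ /hd1]; rewrite [z0 + _]addrC subrK => hw.
  by have := nmD (h w - h z0) (h z0); rewrite subrK /M; lra.
have M0 : 0 <= M by rewrite addr_ge0 ?nm_ge0.
have kne z : nm (z - z0) < r -> square_oint z0 r (fun w => (w - z)^-1) != 0.
  by move=> /winding_lb k4; rewrite -nm_gt0; apply: lt_le_trans k4.
have coef0 p : taylor_coef h z0 r p = 0.
  elim/ltn_ind: p => p IH; apply: nm0P => e e0.
  pose B := 16 * (M / (r ^+ p.+1 * (r / 2))) * r.
  have B0 : 0 <= B.
    apply: mulr_ge0; last exact: ltW.
    apply: mulr_ge0 => //; apply: divr_ge0 => //; apply: mulr_ge0; first exact/exprn_ge0/ltW.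
    exact/ltW/divr_gt0.
  have [z [zne zsmall hz0]] : exists z, [/\ z != z0, nm (z - z0) < Num.min (r / 2) (e / (B + 1)) & h z = 0].
    by apply: hz; rewrite lt_min !divr_gt0 // ltr_wpDl.
  move: zsmall; rewrite lt_min => /andP[zr ze].
  have zr' : nm (z - z0) < r by lra.
  have := taylor p.+1 zr' dh; rewrite hz0 mul0r big_ord_recr /= big1 ?add0r; last first.
    by move=> i _; rewrite IH ?mulr0.
  rewrite exprSr -mulrA -mulrDr => /esym /eqP; rewrite mulf_eq0 expf_eq0 subr_eq0 (negbTE zne) andbF /=.
  rewrite addr_eq0 => /eqP ->; rewrite nmN nmM.
  have /le_trans tb : nm (taylor_rem h z0 r p.+1 z) <= B.
    apply: le_trans (taylor_rem_bound p.+1 zr' dh hM) _.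
    rewrite /B; apply: ler_wpM2r; first exact: ltW.
    apply: ler_wpM2l => //; apply: ler_wpM2l => //.
    have rp : 0 < r ^+ p.+1 by rewrite exprn_gt0.
    rewrite lef_pV2 ?posrE ?mulr_gt0 ?ler_pM2l ?divr_gt0 //; lra.
  apply: (@le_trans _ _ (e / (B + 1) * B)).
    by apply: ler_pM; rewrite ?nm_ge0 ?(ltW ze) //; apply: tb.
  rewrite mulrAC ler_pdivrMr ?ltr_wpDl // ler_pM2l //; lra.
exists r => // z zr; apply/eqP.
have : h z * square_oint z0 r (fun w => (w - z)^-1) = 0.
  apply/eqP; rewrite -nm_eq0 eq_le nm_ge0 andbT.
  have q1 : nm (z - z0) / r < 1 by rewrite ltr_pdivrMr // mul1r.
  have q0 : 0 <= nm (z - z0) / r by rewrite divr_ge0 ?nm_ge0 ?ltW.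
  (* With all coefficients zero only the remainder is left, and it is of order [(|z - z0| / r)^m]
     for every [m]. *)
  apply: (le0_geometric (B := 16 * M / (r - nm (z - z0)) * r) q0 q1) => m.
  rewrite (taylor m zr dh) big1 ?add0r; last by move=> i _; rewrite coef0 mulr0.
  rewrite nmM nmX expr_div_n.
  apply: le_trans (ler_wpM2l _ (taylor_rem_bound m zr dh hM)) _; first by rewrite exprn_ge0 ?nm_ge0.
  rewrite le_eqVlt; apply/orP; left; apply/eqP.
  have rn : r != 0 by rewrite gt_eqF.
  have rzn : r - nm (z - z0) != 0 by rewrite gt_eqF // subr_gt0.
  by rewrite invfM; field; rewrite rzn expf_neq0.
by move/eqP; rewrite mulf_eq0 (negbTE (kne z zr)) orbF.
Qed.

(** Connectedness of the segment: let [tau] be the supremum of the parameters up to which [h]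
    vanishes. Zeros accumulate at [p tau], by hypothesis if [tau = 0] and from below otherwise, so
    [local_identity] carries the vanishing past [tau] unless the end is reached. *)
Lemma path_identity h z0 v :
  (forall t : R, 0 <= t <= 1 -> holo_at h (z0 + t%:C * v)) ->
  zero_accum h z0 -> h (z0 + v) = 0.
Proof.
move=> hol hz; pose p (t : R) := z0 + t%:C * v.
have p0 : p 0 = z0 by rewrite /p mul0r addr0.
have p1 : p 1 = z0 + v by rewrite /p mul1r.
have h0 : h z0 = 0.
  have [|r r0 H] := @local_identity h z0 _ hz; last by apply: H; rewrite subrr nm0.
  by have := hol 0; rewrite -/(p 0) p0; apply; rewrite lexx ler01.
have [->|v0] := eqVneq v 0; first by rewrite addr0.
have nv : 0 < nm v by rewrite nm_gt0.
have pB s t : nm (p s - p t) = `|s - t| * nm v.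
  rewrite (_ : p s - p t = (s - t)%:C * v); first by rewrite nmM nm_real.
  by rewrite rmorphB /= /p; ring.
pose S : set R := [set t | 0 <= t <= 1 /\ forall s, 0 <= s <= t -> h (p s) = 0]%classic.
have S0 : S 0.
  split; first by rewrite lexx ler01.
  by move=> s s0; have -> : s = 0 by [lra]; rewrite p0.
have supS : has_sup S by split; [exists 0|exists 1 => t [/andP[]]].
pose tau := sup S.
have tau0 : 0 <= tau by apply: sup_upper_bound.
have tau1 : tau <= 1 by apply: ge_sup => [|t [/andP[]]] //; exists 0.
have below s : 0 <= s -> s < tau -> h (p s) = 0.
  move=> s0 st; have [t St ts] : exists2 t, S t & s < t.
    have [t St ts] := sup_adherent (eps := tau - s) ltac:(by rewrite subr_gt0) supS.
    by exists t => //; move: ts; rewrite -/tau; lra.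
  by case: St => _; apply; rewrite s0 ltW.
have acc : zero_accum h (p tau).
  move: tau0; rewrite le_eqVlt => /orP[/eqP <-|tau0]; first by rewrite p0.
  move=> e e0; pose s := Num.max 0 (tau - e / (2 * nm v)).
  have ep : 0 < e / (2 * nm v) by rewrite divr_gt0 // mulr_gt0.
  have sl : s < tau by rewrite /s gt_max tau0; lra.
  have s0 : 0 <= s by rewrite /s le_max lexx.
  have sb : tau - s <= e / (2 * nm v).
    by have : tau - e / (2 * nm v) <= s; [rewrite /s le_max lexx orbT|lra].
  exists (p s); split; last exact: below.
    rewrite -subr_eq0 -nm_eq0 pB mulf_neq0 ?gt_eqF // normr_gt0 subr_eq0.
    by rewrite lt_eqF.
  rewrite pB ler0_norm ?subr_le0 ?ltW // opprB.
  move: sb; rewrite ler_pdivlMr ?mulr_gt0 //; lra.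
have [r r0 Hr] := local_identity (hol tau ltac:(by rewrite tau0 tau1)) acc.
have near s : `|s - tau| < r / nm v -> h (p s) = 0.
  by move=> hs; apply: Hr; rewrite -/(p tau) pB -ltr_pdivlMr.
have rv : 0 < r / nm v by rewrite divr_gt0.
have [t1|t1] := leP 1 tau.
  by rewrite -p1; apply: near; have -> : tau = 1; [lra|rewrite subrr normr0].
pose t := Num.min 1 (tau + r / nm v / 2).
have tt : tau < t by rewrite /t lt_min t1; lra.
have tr : t <= tau + r / nm v / 2 by rewrite /t ge_min lexx orbT.
have St : S t.
  split; first by rewrite (le_trans tau0 (ltW tt)) /t ge_min lexx.
  move=> s /andP[s0 st]; have [stau|stau] := ltP s tau; first exact: below.
  apply: near; rewrite ger0_norm ?subr_ge0 //; lra.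
by have := sup_upper_bound supS St; rewrite leNgt -/tau tt.
Qed.

End Identity.

(** * Liouville's theorem for polynomial growth, and Lagrange interpolation *)

Section Liouville.
Variable R : realType.
Local Notation C := R[i].
Implicit Types (h : C -> C) (p q : {poly C}) (z w : C) (N : nat).

Definition entire h := forall z, cdiff h z.

Definition growth N h := exists2 K : R, 0 <= K & forall w, nm (h w) <= K * (1 + nm w) ^+ N.

Lemma le0_inv (x B r0 : R) : (forall r, r0 <= r -> x <= B / r) -> x <= 0.
Proof.
move=> H; apply/ler_addgt0Pr => e e0; rewrite add0r.
pose r := Num.max (Num.max r0 1) (B / e).
have r0' : r0 <= r by rewrite /r !le_max lexx.
have r1 : 0 < r by apply: (lt_le_trans ltr01); rewrite /r !le_max lexx orbT.
apply: le_trans (H r r0') _; rewrite ler_pdivrMr // mulrC -ler_pdivrMr //.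
by rewrite /r le_max lexx orbT.
Qed.

(** The coefficients do not depend on the square, so they are fixed on the one of half-side 1 while
    [r] grows; the remainder of order [N + 1] is then [O(1/r)]. The winding integral remains as a
    factor, whence a limit statement instead of an equality with [p]. *)
Lemma growth_taylor N h : entire h -> growth N h ->
  exists p : {poly C}, (size p <= N.+1)%N /\ forall z, exists B : R, forall r : R,
    2 * nm z + 1 <= r -> nm (h z * square_oint 0 r (fun w => (w - z)^-1) - p.[z]) <= B / r.
Proof.
move=> eh [K K0 hK]; exists (\poly_(i < N.+1) taylor_coef h 0 1 i); split; first exact: size_poly.
move=> z; exists (nm z ^+ N.+1 * (32 * (K * 3 ^+ N))) => r hr.
have z0 := nm_ge0 z.
have r1 : 1 <= r by lra.
have r0 : 0 < r by lra.
have zr : nm (z - 0) < r by rewrite subr0; lra.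
have coefr k : taylor_coef h 0 r k = taylor_coef h 0 1 k.
  apply: square_oint_frame => // w w1 _; apply: cdiff_invX; last exact: eh.
  exact: away_neq w1.
rewrite (taylor N.+1 zr) // horner_poly subr0.
under eq_bigr do rewrite coefr mulrC.
rewrite addrAC subrr add0r nmM nmX -mulrA; apply: ler_wpM2l; first exact: exprn_ge0.
have hM w : nm (w - 0) <= 2 * r -> nm (h w) <= K * (3 * r) ^+ N.
  rewrite subr0 => wr; apply: le_trans (hK w) _; apply: ler_wpM2l => //.
  by apply: lerXn2r; rewrite ?nnegrE ?addr_ge0 ?mulr_ge0 ?nm_ge0 ?(ltW r0) //; lra.
apply: le_trans (taylor_rem_bound N.+1 zr (fun w _ => eh w) hM) _; rewrite subr0.
have rz : r / 2 <= r - nm z by lra.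
have rz0 : 0 < r - nm z by lra.
apply: (@le_trans _ _ (16 * (K * (3 * r) ^+ N / (r ^+ N.+1 * (r / 2))) * r)).
  apply: ler_wpM2r; first exact: ltW.
  apply: ler_wpM2l => //; apply: ler_wpM2l.
    by rewrite mulr_ge0 // exprn_ge0 // mulr_ge0 // ltW.
  have rN : 0 < r ^+ N.+1 by rewrite exprn_gt0.
  rewrite lef_pV2 ?posrE ?mulr_gt0 ?divr_gt0 // ler_pM2l //.
rewrite exprMn exprSr le_eqVlt; apply/orP; left; apply/eqP.
have rn : r != 0 by rewrite gt_eqF.
by field; rewrite rn expf_neq0.
Qed.

(** The zeros of [h] are [N + 1] roots of the Taylor polynomial, which therefore vanishes; the
    winding factor, at least 4 in modulus, can then be dropped. *)
Lemma liouville_zeros N h (x : 'I_N.+1 -> C) : entire h -> growth N h ->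
  injective x -> (forall j, h (x j) = 0) -> forall z, h z = 0.
Proof.
move=> eh gh injx hx z; have [p [sp hp]] := growth_taylor eh gh.
have p0 : p = 0.
  apply/eqP; apply: contraTT sp => pn0; rewrite -ltnNge.
  have := @max_poly_roots _ p [seq x j | j <- enum 'I_N.+1] pn0.
  rewrite size_map size_enum_ord; apply; last by rewrite map_inj_uniq ?enum_uniq.
  apply/allP => _ /mapP[j _ ->]; apply/rootP.
  have [B hB] := hp (x j); apply/eqP; rewrite -nm_eq0 eq_le nm_ge0 andbT.
  apply: (le0_inv (B := B) (r0 := 2 * nm (x j) + 1)) => r /hB.
  by rewrite hx mul0r sub0r nmN.
have [B hB] := hp z; apply/eqP; rewrite -nm_eq0 eq_le nm_ge0 andbT.
apply: (le0_inv (B := B) (r0 := 2 * nm z + 1)) => r hr; have := hB r hr.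
rewrite p0 horner0 subr0 nmM; apply: le_trans; rewrite ler_peMr ?nm_ge0 //.
have zr : nm (z - 0) < r by rewrite subr0; have := nm_ge0 z; lra.
by apply: le_trans (winding_lb zr); rewrite ler1n.
Qed.

Lemma entire_poly p : entire (fun w => p.[w]).
Proof.
move=> z; under eq_fun do rewrite horner_coef.
apply: cdiff_sum => i; apply: cdiffM; first exact: cdiff_cst.
by apply: cdiffX; exact: cdiff_id.
Qed.

Lemma growthD N f g : growth N f -> growth N g -> growth N (fun w => f w + g w).
Proof.
move=> [K K0 H] [L L0 G]; exists (K + L); first exact: addr_ge0.
move=> w; apply: le_trans (nmD _ _) _; rewrite mulrDl; exact: lerD.
Qed.

Lemma growthZ N f (c : C) : growth N f -> growth N (fun w => c * f w).
Proof.
move=> [K K0 H]; exists (nm c * K); first by rewrite mulr_ge0 ?nm_ge0.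
by move=> w; rewrite nmM -mulrA ler_wpM2l ?nm_ge0.
Qed.

Lemma growth_sum N (I : Type) (r : seq I) (F : I -> C -> C) :
  (forall i, growth N (F i)) -> growth N (fun w => \sum_(i <- r) F i w).
Proof.
move=> H; elim: r => [|i r IH].
  by exists 0 => // w; rewrite big_nil nm0 mul0r.
by under eq_fun do rewrite big_cons; exact: growthD.
Qed.

Lemma growth_poly N p : (size p <= N.+1)%N -> growth N (fun w => p.[w]).
Proof.
move=> sp; under eq_fun do rewrite (horner_coef_wide _ sp).
apply: growth_sum => i; apply: growthZ; exists 1 => // w; rewrite mul1r nmX.
apply: (@le_trans _ _ ((1 + nm w) ^+ i)).
  by apply: lerXn2r; rewrite ?nnegrE ?addr_ge0 ?nm_ge0 ?lerDr.
by apply: ler_weXn2l; rewrite ?lerDl ?nm_ge0 // -ltnS.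
Qed.

Definition lagrange_poly N (x : 'I_N.+1 -> C) (j : 'I_N.+1) : {poly C} :=
  \prod_(i | i != j) ((x j - x i)^-1 *: ('X - (x i)%:P)).

Lemma size_lagrange_poly N (x : 'I_N.+1 -> C) j : (size (lagrange_poly x j) <= N.+1)%N.
Proof.
apply: leq_trans (size_poly_prod_leq _ _) _.
rewrite leq_subLR; apply: (@leq_trans (\sum_(i | i != j) 2).+1); rewrite ?ltnS.
  apply: leq_sum => i _; apply: leq_trans (size_scale_leq _ _) _.
  by rewrite size_XsubC.
by rewrite sum_nat_const /= cardC1 card_ord muln2 -addnn addnS ltnS.
Qed.

Lemma lagrange_poly_node N (x : 'I_N.+1 -> C) i j : injective x ->
  (lagrange_poly x j).[x i] = (i == j)%:R.
Proof.
move=> injx; rewrite horner_prod; have [->|ij] := eqVneq i j.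
  rewrite big1 // => k kj; rewrite hornerZ hornerXsubC mulVf // subr_eq0.
  by rewrite (inj_eq injx) eq_sym.
by rewrite (bigD1 i) //= hornerZ hornerXsubC subrr mulr0 mul0r.
Qed.

(** The difference of the two sides is entire, of growth [N], and vanishes at [N + 1] nodes. Being a
    polynomial of degree at most [N] is thus expressed by values alone. *)
Lemma lagrange_interp N (x : 'I_N.+1 -> C) h : entire h -> growth N h -> injective x ->
  forall z, h z = \sum_(j < N.+1) (lagrange_poly x j).[z] * h (x j).
Proof.
move=> eh gh injx z; apply/eqP; rewrite -subr_eq0; apply/eqP.
pose g w := h w + \sum_(j < N.+1) (- h (x j)) * (lagrange_poly x j).[w].
suff -> : h z - \sum_(j < N.+1) (lagrange_poly x j).[z] * h (x j) = g z.
  apply: (@liouville_zeros N g x) => //.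
  - move=> w; apply: cdiffD => //; apply: cdiff_sum => j.
    by apply: cdiffM; [exact: cdiff_cst|exact: entire_poly].
  - apply: growthD => //; apply: growth_sum => j; apply: growthZ.
    by apply: growth_poly; exact: size_lagrange_poly.
  - move=> i; rewrite /g (bigD1 i) //= lagrange_poly_node // eqxx mulr1 big1 ?addr0 ?subrr //.
    by move=> j ji; rewrite lagrange_poly_node // eq_sym (negbTE ji) mulr0.
rewrite /g -sumrN; congr (_ + _); apply: eq_bigr => j _; by rewrite mulrC mulNr.
Qed.

(** Distinct points of the closed unit disc: dilating by them maps a polydisc about 0 into
    itself. *)
Definition node N (j : 'I_N.+1) : C := (j.+1%:R : R)^-1%:C.

Lemma node_inj N : injective (@node N).
Proof.
move=> i j /(congr1 (@complex.Re R)) /= /invr_inj /eqP.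
by rewrite eqr_nat => /eqP [/val_inj].
Qed.

Lemma nm_node N (j : 'I_N.+1) : nm (node j) <= 1.
Proof.
rewrite nm_real ger0_norm ?invr_ge0 ?ler0n // invf_le1 ?ltr0n //.
by rewrite ler1n.
Qed.

End Liouville.

(** * The sub-mean value property *)

Section BoxOpen.
Variable R : realType.
Local Notation mu := (@lebesgue_measure R).

Definition box_open (U : set (R * R)) := forall p, U p -> exists2 e : R, 0 < e &
  forall q, `|q.1 - p.1| < e -> `|q.2 - p.2| < e -> U q.

(** [U] is the countable union of the boxes with rational centre and radius [1/(m+1)] that it
    contains. *)
Lemma box_open_measurable (U : set (R * R)) : box_open U ->
  measurable (U : set (measurableTypeR R * measurableTypeR R)).
Proof.
move=> oU.
pose B (q1 q2 : rat) (m : nat) : set (R * R) :=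
  (ball (ratr q1 : R) (m.+1%:R^-1 : R) `*` ball (ratr q2 : R) (m.+1%:R^-1 : R))%classic.
have mB q1 q2 m : measurable (B q1 q2 m : set (measurableTypeR R * measurableTypeR R)).
  by apply: measurableX; rewrite ball_itv; exact: measurable_itv.
pose F q1 q2 m : set (R * R) := if `[< (B q1 q2 m `<=` U)%classic >] then B q1 q2 m else set0.
have -> : U = (\bigcup_q1 \bigcup_q2 \bigcup_m F q1 q2 m)%classic.
  apply/seteqP; split; last first.
    by move=> p [q1 _ [q2 _ [m _]]]; rewrite /F; case: asboolP => // BU /BU.
  move=> [x y] /oU[e e0 /= He].
  have [m hm] : exists m : nat, (m.+1%:R^-1 : R) < e / 2.
    exists (Num.bound (2 / e)); have := archi_boundP (x := 2 / e).
    rewrite divr_ge0 ?(ltW e0) // => /(_ isT) h.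
    rewrite invf_plt ?posrE ?divr_gt0 ?ltr0n // invf_div.
    by apply: lt_le_trans h _; rewrite ler_nat.
  have m0 : (0 : R) < m.+1%:R^-1 by rewrite invr_gt0 ltr0n.
  have near (u : R) : exists q : rat, `|ratr q - u| < m.+1%:R^-1.
    have lt : u - m.+1%:R^-1 < u + m.+1%:R^-1 by rewrite ltrD2l gtrN.
    have [q] := rat_in_itvoo lt.
    by rewrite in_itv /= => hq; exists q; rewrite ltr_distl.
  have [q1 h1] := near x; have [q2 h2] := near y.
  exists q1 => //; exists q2 => //; exists m => //.
  rewrite /F; case: asboolP => [_|]; first by split.
  case=> -[x' y'] [/= h1' h2']; apply: He => /=.
    have := ler_normD (x' - ratr q1) (ratr q1 - x); rewrite subrKA (distrC x' (ratr q1)).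
    have : `|ratr q1 - x'| < m.+1%:R^-1 by [].
    by move: h1 hm; set i := m.+1%:R^-1; lra.
  have := ler_normD (y' - ratr q2) (ratr q2 - y); rewrite subrKA (distrC y' (ratr q2)).
  have : `|ratr q2 - y'| < m.+1%:R^-1 by [].
  by move: h2 hm; set i := m.+1%:R^-1; lra.
apply: bigcupT_measurable_rat => q1; apply: bigcupT_measurable_rat => q2.
apply: bigcupT_measurable => m; rewrite /F; case: asboolP => _ //.
Qed.

Lemma lsc_measurable (f : R * R -> R) :
  (forall c, box_open [set p | c < f p]%classic) ->
  measurable_fun setT (f : measurableTypeR R * measurableTypeR R -> measurableTypeR R).
Proof.
move=> H; apply: (measurability _ (RGenOInfty.measurableE R)).
move=> _ [_ [c ->] <-]; apply: measurableI => //.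
apply: box_open_measurable => p; rewrite /= in_itv /= andbT => /H[e e0 He].
by exists e => // q h1 h2; rewrite /= in_itv /= andbT; exact: He.
Qed.

Lemma lsc_tonelli (f : R * R -> R) :
  (forall c, box_open [set p | c < f p]%classic) -> (forall p, 0 <= f p) ->
  (\int[mu]_x \int[mu]_y (f (x, y))%:E = \int[mu]_y \int[mu]_x (f (x, y))%:E)%E.
Proof.
move=> H f0; apply: (@fubini_tonelli _ _ _ _ R mu mu (EFin \o f)).
  by apply/measurable_EFinP; exact: lsc_measurable.
by move=> p; rewrite lee_fin.
Qed.

(** Were [F] above [A / (u - l)] on the whole interval, its integral would be at least [A];
    monotonicity suffices. *)
Lemma average_le (F : R -> \bar R) (l u A : R) : l < u -> (forall x, 0 <= F x)%E ->
  (\int[mu]_x F x < A%:E)%E -> exists2 x, l < x < u & (F x <= (A / (u - l))%:E)%E.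
Proof.
move=> lu F0 FA; apply: contrapT => H.
have ul : 0 < u - l by rewrite subr_gt0.
have A0 : 0 < A.
  by rewrite -lte_fin; apply: le_lt_trans FA; exact: integral_ge0.
have {}H x : l < x < u -> ((A / (u - l))%:E <= F x)%E.
  by move=> hx; rewrite leNgt; apply/negP => /ltW h; apply: H; exists x.
move: FA; apply/negP; rewrite -leNgt.
apply: (@le_trans _ _ (\int[mu]_(x in `]l, u[) (A / (u - l))%:E)%E).
  rewrite integral_cst //= lebesgue_measure_itv /= lte_fin lu -EFinD -EFinM divfK //.
  by rewrite gt_eqF.
apply: ge0_integral_le_setT => [//|x _|x]; first by rewrite lee_fin divr_ge0 // ltW.
by rewrite /= in_itv /= => /H.
Qed.

End BoxOpen.

Section SubMean.
Variable R : realType.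
Local Notation C := R[i].
Local Notation mu := (@lebesgue_measure R).
Implicit Types (h : C -> C).

Definition in_square (x0 y0 dl x y : R) := (`|x - x0| < dl) && (`|y - y0| < dl).

(** Cut off by an open square, [|h|] is in general discontinuous but lower semicontinuous, which is
    what Tonelli requires here. *)
Lemma in_square_box_open h (x0 y0 dl c : R) :
  (forall x y, in_square x0 y0 dl x y -> cdiff h (x +i* y)) ->
  box_open [set p | c < (in_square x0 y0 dl p.1 p.2)%:R * nm (h (p.1 +i* p.2))]%classic.
Proof.
move=> dh [x y] /=; have [c0|c0] := ltP c 0.
  by move=> _; exists 1 => // q _ _; apply: lt_le_trans c0 _; rewrite mulr_ge0 ?nm_ge0.
case: (boolP (in_square x0 y0 dl x y)) => [hin|_]; last by rewrite mul0r ltNge c0.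
rewrite mul1r => hc.
have [d d0 hd] := cdiff_cvg (dh _ _ hin) (e := nm (h (x +i* y)) - c) ltac:(by rewrite subr_gt0).
move: hin; rewrite /in_square => /andP[hx hy].
exists (Num.min (d / 2) (Num.min (dl - `|x - x0|) (dl - `|y - y0|))).
  by rewrite !lt_min divr_gt0 // !subr_gt0 hx hy.
move=> [x' y'] /=; rewrite !lt_min => /andP[a1 /andP[a2 _]] /andP[b1 /andP[_ b2]].
have -> : `|x' - x0| < dl.
  by have := ler_normD (x' - x) (x - x0); rewrite subrKA; lra.
have -> : `|y' - y0| < dl.
  by have := ler_normD (y' - y) (y - y0); rewrite subrKA; lra.
rewrite mul1r; set w' := x' +i* y'; set w := x +i* y in hd hc *.
have := hd (w' - w); rewrite [w + _]addrC subrK.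
have -> : nm (w' - w) < d.
  by apply: le_lt_trans (nm_le_ReIm _) _ => /=; lra.
move=> /(_ isT); have := nm_lerB (h w) (h w'); rewrite nmB; lra.
Qed.

Lemma cint_mul_bound (f g : R -> C) (a b r B : R) : 0 < r ->
  cintble a b (fun x => f x * g x) -> (forall x, a <= x <= b -> nm (g x) <= r^-1) ->
  (\int[mu]_(x in `[a, b]) (nm (f x))%:E <= B%:E)%E ->
  nm (cint a b (fun x => f x * g x)) <= 2 * (r^-1 * B).
Proof.
move=> r0 ok hg hB; rewrite -lee_fin; apply: le_trans (cint_abs ok) _.
rewrite EFinM; apply: lee_wpmul2l; first by rewrite lee_fin.
apply: (@le_trans _ _ (r^-1%:E * \int[mu]_(x in `[a, b]) (nm (f x))%:E)%E); last first.
  by rewrite EFinM; apply: lee_wpmul2l => //; rewrite lee_fin invr_ge0 ltW.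
rewrite -ge0_integral_scale ?invr_gt0 //; last by move=> x _; rewrite lee_fin nm_ge0.
apply: ge0_integral_mono => x; rewrite /= ?in_itv /= => hx; first by rewrite lee_fin nm_ge0.
by rewrite -EFinM lee_fin nmM mulrC; apply: ler_wpM2r; rewrite ?nm_ge0 ?hg.
Qed.

(** In [h z * W = oint (h w / (w - z))] the winding factor satisfies [|W| >= 4], and each of the
    four edges, at distance at least [r] from [z], contributes at most [2 B / r]. *)
Lemma cauchy_rect_estimate h (x0 y0 r al be ga et B : R) : 0 < r ->
  al <= x0 - r -> x0 + r <= be -> ga <= y0 - r -> y0 + r <= et ->
  (forall x y, al <= x <= be -> ga <= y <= et -> cdiff h (x +i* y)) ->
  (\int[mu]_(x in `[al, be]) (nm (h (x +i* ga)))%:E <= B%:E)%E ->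
  (\int[mu]_(x in `[al, be]) (nm (h (x +i* et)))%:E <= B%:E)%E ->
  (\int[mu]_(y in `[ga, et]) (nm (h (al +i* y)))%:E <= B%:E)%E ->
  (\int[mu]_(y in `[ga, et]) (nm (h (be +i* y)))%:E <= B%:E)%E ->
  nm (h (x0 +i* y0)) <= 2 * (r^-1 * B).
Proof.
move=> r0 hal hbe hga het dR Bga Bet Bal Bbe; set z := x0 +i* y0.
have zx : al < x0 < be by lra.
have zy : ga < y0 < et by lra.
have ab : al <= be by lra.
have cd : ga <= et by lra.
have far x y : al <= x <= be -> ga <= y <= et ->
    x = al \/ x = be \/ y = ga \/ y = et -> r <= nm ((x +i* y) - z).
  move=> hx hy hb; have [hr|hr] : r <= `|x - x0| \/ r <= `|y - y0|.
    case: hb => [->|[->|[->|->]]]; [left|left|right|right].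
    - by rewrite distrC ger0_norm; lra.
    - by rewrite ger0_norm; lra.
    - by rewrite distrC ger0_norm; lra.
    - by rewrite ger0_norm; lra.
  - exact: le_trans hr (nm_Re ((x +i* y) - (x0 +i* y0))).
  - exact: le_trans hr (nm_Im ((x +i* y) - (x0 +i* y0))).
have ne x y : al <= x <= be -> ga <= y <= et ->
    x = al \/ x = be \/ y = ga \/ y = et -> (x +i* y) != z.
  by move=> hx hy hb; rewrite -subr_eq0 -nm_gt0; apply: lt_le_trans r0 _; exact: far.
have q0 := @cauchy_quotient _ h z al be ga et zx zy dR.
have kap := @winding_rect_lb _ z al be ga et zx zy.
have okh := cdiff_edges_ok ab cd dR.
have oki : edges_ok (fun w => (w - z)^-1) al be ga et.
  by apply: boundary_edges_ok => // x y hx hy hb; apply: cdiff_inv; exact: ne.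
have okq : edges_ok (fun w => h w * (w - z)^-1) al be ga et.
  apply: boundary_edges_ok => // x y hx hy hb; apply: cdiffM; first exact: dR.
  by apply: cdiff_inv; exact: ne.
have formula : h z * oint (fun w => (w - z)^-1) al be ga et = oint (fun w => h w * (w - z)^-1) al be ga et.
  have := ointD okq (edges_okZ (- h z) oki); rewrite ointZ // mulNr => e1.
  apply/eqP; rewrite eq_sym -subr_eq0 -e1 -[X in _ == X]q0; apply/eqP.
  by apply: eq_oint => // x y _ _ _; rewrite -mulrDl.
have nmi x y : al <= x <= be -> ga <= y <= et ->
    x = al \/ x = be \/ y = ga \/ y = et -> nm ((x +i* y) - z)^-1 <= r^-1.
  move=> hx hy hb; have fx := far x y hx hy hb.
  by rewrite nmV lef_pV2 // posrE //; exact: lt_le_trans fx.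
have [alin bein] : al <= al <= be /\ al <= be <= be by rewrite !lexx ab.
have [gain etin] : ga <= ga <= et /\ ga <= et <= et by rewrite !lexx cd.
have [k1 k2 k3 k4] := okq.
have b1 := cint_mul_bound r0 k1 (fun x hx => nmi x ga hx gain ltac:(tauto)) Bga.
have b2 := cint_mul_bound r0 k2 (fun x hx => nmi x et hx etin ltac:(tauto)) Bet.
have b3 := cint_mul_bound r0 k3 (fun y hy => nmi al y alin hy ltac:(tauto)) Bal.
have b4 := cint_mul_bound r0 k4 (fun y hy => nmi be y bein hy ltac:(tauto)) Bbe.
have total : nm (h z) * 4 <= 4 * (2 * (r^-1 * B)).
  apply: le_trans (ler_wpM2l (nm_ge0 _) kap) _; rewrite -nmM formula ointE //.
  apply: le_trans (nmD _ _) _; rewrite nmM nm_i mul1r.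
  apply: le_trans (lerD (nmBD _ _) (nmBD _ _)) _.
  have -> : 4 * (2 * (r^-1 * B)) = (2 * (r^-1 * B) + 2 * (r^-1 * B)) +
      (2 * (r^-1 * B) + 2 * (r^-1 * B)) by ring.
  exact: lerD (lerD b1 b2) (lerD b4 b3).
by rewrite mulrC ler_pM2l in total.
Qed.

(* Averaging, with Tonelli for the vertical edges, selects a rectangle on whose four edges
   the integral of |h| is controlled, and Cauchy's formula applies to it. *)
Lemma submean_cdiff h (x0 y0 dl : R) : 0 < dl ->
  (forall x y, in_square x0 y0 dl x y -> cdiff h (x +i* y)) ->
  ((nm (h (x0 +i* y0)))%:E <= (8 / dl ^+ 2)%:E *
    \int[mu]_x \int[mu]_y ((in_square x0 y0 dl x y)%:R * nm (h (x +i* y)))%:E)%E.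
Proof.
move=> dl0 dh.
pose f p := (in_square x0 y0 dl p.1 p.2)%:R * nm (h (p.1 +i* p.2)).
have f0 p : 0 <= f p by rewrite /f mulr_ge0 ?nm_ge0.
have k0 : 0 < 8 / dl ^+ 2 by rewrite divr_gt0 // exprn_gt0.
have tonelli := lsc_tonelli (f := f) (fun c => @in_square_box_open h x0 y0 dl c dh) f0.
rewrite -[X in (_ * X)%E]/(\int[mu]_x \int[mu]_y (f (x, y))%:E)%E.
have H0 x : (0 <= \int[mu]_y (f (x, y))%:E)%E by apply: integral_ge0 => y _; rewrite lee_fin.
have G0 y : (0 <= \int[mu]_x (f (x, y))%:E)%E by apply: integral_ge0 => x _; rewrite lee_fin.
have A0 : (0 <= \int[mu]_x \int[mu]_y (f (x, y))%:E)%E by apply: integral_ge0 => x _.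
move EA : (\int[mu]_x \int[mu]_y (f (x, y))%:E)%E A0 tonelli => A A0 tonelli.
case: A EA A0 tonelli => [a| |] EA A0 tonelli; last by [].
  2: by rewrite gt0_muley ?lte_fin // leey.
rewrite lee_fin in A0; rewrite -EFinM lee_fin; apply/ler_addgt0Pr => e e0.
(* The slack turns the value [a] of the integral into the strict bound that [average_le] asks
   for. *)
pose A' := a + e / (8 / dl ^+ 2).
have aA : a < A' by rewrite ltrDl divr_gt0.
have HA : (\int[mu]_x \int[mu]_y (f (x, y))%:E < A'%:E)%E by rewrite EA lte_fin.
have GA : (\int[mu]_y \int[mu]_x (f (x, y))%:E < A'%:E)%E by rewrite -tonelli lte_fin.
have d2 : 0 < dl / 2 by rewrite divr_gt0.
have l1 (u : R) : u - dl < u - dl / 2 by lra.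
have l2 (u : R) : u + dl / 2 < u + dl by lra.
have e1 (u : R) : u - dl / 2 - (u - dl) = dl / 2 by field.
have e2 (u : R) : u + dl - (u + dl / 2) = dl / 2 by field.
(* Each edge is picked in a strip of width [dl/2] between the half-size square and the full one,
   hence at distance at least [dl/2] from the centre; [2 * (2/dl) * (2A'/dl)] is the origin of the
   constant 8. *)
have [al hal] := average_le (l1 x0) H0 HA; rewrite e1 => Hal.
have [be hbe] := average_le (l2 x0) H0 HA; rewrite e2 => Hbe.
have [ga hga] := average_le (l1 y0) G0 GA; rewrite e1 => Hga.
have [et het] := average_le (l2 y0) G0 GA; rewrite e2 => Het.
have -> : 8 / dl ^+ 2 * a + e = 2 * ((dl / 2)^-1 * (A' / (dl / 2))).
  by have dn : dl != 0 by [rewrite gt_eqF]; rewrite /A'; field.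
clear HA GA tonelli EA e1 e2 l1 l2 aA A0 k0.
have inx x : al <= x <= be -> `|x - x0| < dl by move=> hx; rewrite ltr_norml; lra.
have iny y : ga <= y <= et -> `|y - y0| < dl by move=> hy; rewrite ltr_norml; lra.
have [gain etin] : ga <= ga <= et /\ ga <= et <= et by rewrite !lexx; lra.
have [alin bein] : al <= al <= be /\ al <= be <= be by rewrite !lexx; lra.
have [ha hb hc hd] : [/\ al <= x0 - dl / 2, x0 + dl / 2 <= be, ga <= y0 - dl / 2 & y0 + dl / 2 <= et].
  by split; lra.
have edx y : ga <= y <= et -> (\int[mu]_x (f (x, y))%:E <= (A' / (dl / 2))%:E)%E ->
    (\int[mu]_(x in `[al, be]) (nm (h (x +i* y)))%:E <= (A' / (dl / 2))%:E)%E.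
  move=> hy; apply: le_trans; apply: ge0_integral_le_setT => [x|x _|x]; rewrite ?lee_fin ?f0 ?nm_ge0 //.
  by rewrite /= in_itv /= => hx; rewrite ?lee_fin /f /= /in_square inx // iny // mul1r.
have edy x : al <= x <= be -> (\int[mu]_y (f (x, y))%:E <= (A' / (dl / 2))%:E)%E ->
    (\int[mu]_(y in `[ga, et]) (nm (h (x +i* y)))%:E <= (A' / (dl / 2))%:E)%E.
  move=> hx; apply: le_trans; apply: ge0_integral_le_setT => [y|y _|y]; rewrite ?lee_fin ?f0 ?nm_ge0 //.
  by rewrite /= in_itv /= => hy; rewrite ?lee_fin /f /= /in_square inx // iny // mul1r.
apply: (cauchy_rect_estimate d2 ha hb hc hd) (edx _ gain Hga) (edx _ etin Het) (edy _ alin Hal) (edy _ bein Hbe).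
by move=> x y hx hy; apply: dh; rewrite /in_square inx ?iny.
Qed.

End SubMean.

(** * Holomorphic functions of several variables *)

Section Vectors.
Variables (R : realType) (n : nat).
Local Notation C := R[i].
Local Notation V := ('I_n -> C).
Implicit Types (z w : V) (g f : V -> C) (W D : set V) (k l : 'I_n).

Definition upd z k (u : C) : V := fun i => if i == k then u else z i.

Lemma upd_id z k : upd z k (z k) = z.
Proof. by apply/funext => i; rewrite /upd; case: eqP => [->|]. Qed.

Lemma upd_upd z k (u v : C) : upd (upd z k u) k v = upd z k v.
Proof. by apply/funext => i; rewrite /upd; case: eqP. Qed.

Lemma upd_eq z k (u : C) : upd z k u k = u.
Proof. by rewrite /upd eqxx. Qed.

Lemma upd_neq z k (u : C) i : i != k -> upd z k u i = z i.
Proof. by rewrite /upd => /negbTE ->. Qed.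

Definition sep_holo W g := forall z k, W z ->
  holo_at (fun u => g (upd z k u)) (z k).

Lemma circle_accum (h : C -> C) (z0 : C) : z0 != 0 ->
  (exists2 d : R, 0 < d & forall u, nm u = nm z0 -> nm (u - z0) < d -> h u = 0) ->
  zero_accum h z0.
Proof.
move=> z00 [d d0 H] e1 e10; have nz : 0 < nm z0 by rewrite nm_gt0.
pose e := Num.min d e1; have e0 : 0 < e by rewrite lt_min d0.
suff [z [z1 z2 z3]] : exists z : C, [/\ z != z0, nm (z - z0) < e & nm z = nm z0].
  by move: z2; rewrite lt_min => /andP[zd ze]; exists z; split => //; exact: H.
(* Multiplication by [p / q], a quotient of conjugate numbers close to 1, is a small non-trivial
   rotation obtained without trigonometric functions. *)
pose s := e / (4 * nm z0); have s0 : 0 < s by rewrite divr_gt0 // mulr_gt0.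
pose p : C := 1 +i* s; pose q : C := 1 -i* s.
have q1 : 1 <= nm q by apply: le_trans (nm_Re _); rewrite /= normr1.
have q0 : q != 0 by rewrite -nm_gt0; exact: lt_le_trans q1.
have pq : nm p = nm q by rewrite /Normc.normc /= sqrrN.
have dif : p - q = (2 * s) *i.
  by apply/eqP; rewrite eq_complex /= subrr opprK eqxx /= mulrDl mul1r.
have ndif : nm (p - q) = 2 * s.
  by rewrite dif /Normc.normc /= expr0n add0r sqrtr_sqr ger0_norm // mulr_ge0 // ltW.
have eq1 : z0 * (p / q) - z0 = z0 * ((p - q) / q) by field.
exists (z0 * (p / q)); split.
- rewrite -subr_eq0 eq1 !mulf_neq0 ?invr_neq0 // -nm_eq0 ndif mulf_neq0 // gt_eqF //.
- rewrite eq1 !nmM ndif nmV.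
  apply: (@le_lt_trans _ _ (nm z0 * (2 * s))).
    rewrite ler_wpM2l ?nm_ge0 // ler_pdivrMr ?nm_gt0 //.
    by rewrite ler_peMr // mulr_ge0 // ltW.
  rewrite /s; have -> : nm z0 * (2 * (e / (4 * nm z0))) = e / 2.
    by field; rewrite gt_eqF.
  by rewrite ltr_pdivrMr // ltr_pMr // ltr1n.
- by rewrite !nmM nmV pq divff ?mulr1 // gt_eqF // (lt_le_trans _ q1).
Qed.

Definition between (x y t : R) := x <= t <= y \/ y <= t <= x.

Lemma ray_step W g z k (r : R) : sep_holo W g -> 0 < r ->
  (forall u, between r (nm (z k)) (nm u) -> W (upd z k u)) ->
  (forall u, nm u = r -> g (upd z k u) = 0) -> g z = 0.
Proof.
move=> hg r0 Wk gz; pose h u := g (upd z k u).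
have [e [ne ze]] : exists e : C, nm e = 1 /\ z k = (nm (z k))%:C * e.
  have [z0|z0] := eqVneq (z k) 0; first by exists 1; rewrite nm1 z0 nm0 mul0r.
  exists (z k / (nm (z k))%:C); rewrite nmM nmV nm_real ger0_norm ?nm_ge0 //.
  rewrite divff ?nm_eq0 //; split=> //; rewrite mulrC divfK //.
  by apply/eqP => -[] /eqP; rewrite nm_eq0 (negbTE z0).
pose z0 := r%:C * e; pose v := z k - z0.
have nz0 : nm z0 = r by rewrite nmM ne mulr1 nm_real gtr0_norm.
have -> : g z = h (z0 + v) by rewrite /h /v [z0 + _]addrC subrK upd_id.
apply: path_identity; last first.
  apply: circle_accum; first by rewrite -nm_gt0 nz0.
  by exists 1 => // u hu _; apply: gz; rewrite hu.
move=> t /andP[t0 t1]; set p := z0 + t%:C * v.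
have pe : p = ((1 - t) * r + t * nm (z k))%:C * e.
  rewrite /p /v /z0 {1}ze rmorphD !rmorphM rmorphB /=; ring.
have np : nm p = (1 - t) * r + t * nm (z k).
  rewrite pe nmM ne mulr1 nm_real ger0_norm // addr_ge0 // mulr_ge0 ?nm_ge0 ?(ltW r0) //; lra.
have Wp : W (upd z k p).
  apply: Wk; rewrite /between np; have [h1|h1] := leP r (nm (z k)).
    by left; apply/andP; split; nra.
  by right; apply/andP; split; nra.
have := hg _ k Wp; rewrite upd_eq; congr (holo_at _ _).
by apply/funext => u; rewrite upd_upd.
Qed.

(** In the claim, coordinates of index below [j] have arbitrary moduli and the others have modulus
    [|z l|]. Releasing coordinate [j] is one [ray_step] with [r = |z l|]. Points with [z l = 0],
    where that circle degenerates, are reached by continuity from small nonzero values of [z l]. *)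
Lemma polytorus_identity W g l : sep_holo W g ->
  (forall z k, W z -> exists2 d : R, 0 < d & forall u, nm (u - z k) < d -> W (upd z k u)) ->
  (forall z k u, W z -> k != l -> between (nm (z l)) (nm (z k)) (nm u) -> W (upd z k u)) ->
  (forall z, W z -> z l != 0 -> (forall k, nm (z k) = nm (z l)) -> g z = 0) ->
  forall z, W z -> g z = 0.
Proof.
move=> hg Wo Wb g0.
have claim (j : nat) : forall z, W z -> z l != 0 ->
    (forall k, k != l -> (j <= k)%N -> nm (z k) = nm (z l)) -> g z = 0.
  elim: j => [|j IH] z Wz zl H.
    by apply: g0 => // k; have [->//|kl] := eqVneq k l; exact: H.
  have [jn|jn] := ltnP j n; last first.
    by apply: IH => // k kl jk; move: (leq_ltn_trans jk (ltn_ord k)); rewrite ltnNge jn.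
  pose k := Ordinal jn; have [kl|kl] := eqVneq k l.
    apply: IH => // i il ji; apply: H => //; rewrite ltn_neqAle ji andbT.
    by apply: contraNneq il => ji'; rewrite -kl; apply/eqP/val_inj.
  apply: (@ray_step W g z k (nm (z l))); rewrite ?nm_gt0 //; first by move=> u; exact: Wb.
  move=> u hu; have ul : upd z k u l = z l by rewrite upd_neq // eq_sym.
  apply: IH; first by apply: Wb => //; rewrite /between hu lexx /=; case: (leP (nm (z l)) (nm (z k))) => h; [left|right; rewrite ltW].
    by rewrite ul.
  move=> i il ji; rewrite ul; have [->|ik] := eqVneq i k; first by rewrite upd_eq.
  rewrite upd_neq //; apply: H => //; rewrite ltn_neqAle ji andbT.
  by apply: contraNneq ik => ji'; apply/eqP/val_inj.
move=> z Wz; have [zl|zl] := eqVneq (z l) 0; last first.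
  apply: (claim n) => // k _ nk; by move: (ltn_ord k); rewrite ltnNge nk.
pose h u := g (upd z l u); have -> : g z = h (z l) by rewrite /h upd_id.
have [d d0 hd] := hg z l Wz.
have hc : cdiff h (z l) by apply: hd; rewrite subrr nm0.
have [d' d'0 Wd] := Wo z l Wz.
apply: nm0P => e e0; have [d1 d10 hd1] := cdiff_cvg hc e0.
pose t := (Num.min d' d1) / 2.
have m0 : 0 < Num.min d' d1 by rewrite lt_min d'0.
have t0 : 0 < t by rewrite divr_gt0.
have : t < Num.min d' d1 by rewrite /t; lra.
rewrite lt_min => /andP[t1 t2].
have nt : nm (t%:C : C) = t by rewrite nm_real gtr0_norm.
have := hd1 t%:C; rewrite nt => /(_ t2); rewrite zl add0r.
have -> : h t%:C = 0; last by rewrite sub0r nmN => /ltW.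
apply: (claim n); first by apply: Wd; rewrite zl subr0 nt.
  by rewrite upd_eq -nm_gt0 nt.
by move=> k _ nk; move: (ltn_ord k); rewrite ltnNge nk.
Qed.

Lemma holomorphic_line D f (al be : V) (u : C) : holomorphic_on D f ->
  D (fun k => al k + be k * u) -> cdiff (fun v => f (fun k => al k + be k * v)) u.
Proof.
move=> hf /hf[c hc]; exists (\sum_(k < n) c k * be k) => e e0.
pose S : R := \sum_(k < n) nm (be k).
have S0 : 0 <= S by apply: sumr_ge0 => k _; exact: nm_ge0.
have S1 : 0 < S + 1 by lra.
have [d d0 hd] := hc (e / (S + 1)) (divr_gt0 e0 S1).
exists (d / (S + 1)) => [|v]; first exact: divr_gt0.
rewrite ltr_pdivlMr // => hv.
have e1 : \sum_(k < n) nm (be k * v) = S * nm v.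
  by rewrite mulr_suml; apply: eq_bigr => k _; rewrite nmM.
have := hd (fun k => be k * v); rewrite e1 => H.
have /H {H} : S * nm v < d by have := nm_ge0 v; nra.
have -> : (fun k => al k + be k * u + be k * v) = (fun k => al k + be k * (u + v)).
  by apply/funext => k; ring.
have -> : \sum_(k < n) c k * (be k * v) = (\sum_(k < n) c k * be k) * v.
  by rewrite mulr_suml; apply: eq_bigr => k _; rewrite mulrA.
move=> /le_trans; apply; rewrite mulrA; apply: ler_wpM2r; first exact: nm_ge0.
rewrite mulrAC ler_pdivrMr //; nra.
Qed.

Lemma holomorphic_upd D f z k (u : C) : holomorphic_on D f -> D (upd z k u) ->
  cdiff (fun v => f (upd z k v)) u.
Proof.
move=> hf Du.
pose al : V := fun i => if i == k then 0 else z i.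
pose be : V := fun i => if i == k then 1 else 0.
have e v : upd z k v = (fun i => al i + be i * v).
  by apply/funext => i; rewrite /upd /al /be; case: eqP; rewrite ?mul0r ?addr0 ?mul1r ?add0r.
under eq_fun do rewrite e; apply: holomorphic_line hf _; by rewrite -e.
Qed.

End Vectors.

(** * Polynomial functions and their differentiability *)

Section Polynomials.
Variables (R : realType) (n : nat).
Local Notation C := R[i].
Local Notation V := ('I_n -> C).
Implicit Types (z w : V) (g f : V -> C) (k l : 'I_n).

Definition is_poly g := exists s : seq (C * ('I_n -> nat)),
  forall z, g z = \sum_(q <- s) q.1 * monomial q.2 z.

Lemma eq_is_poly f g : f =1 g -> is_poly f -> is_poly g.
Proof. by move=> /funext ->. Qed.

Lemma is_poly_cst (c : C) : is_poly (fun=> c).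
Proof.
exists [:: (c, fun=> 0%N)] => z; rewrite big_seq1 /monomial /= big1 ?mulr1 //.
Qed.

Lemma is_poly_coord k : is_poly (fun z => z k).
Proof.
exists [:: (1, fun i => (i == k) : nat)] => z; rewrite big_seq1 mul1r /monomial /=.
rewrite (bigD1 k) //= eqxx expr1 big1 ?mulr1 // => i /negbTE ->; by rewrite expr0.
Qed.

Lemma is_polyD f g : is_poly f -> is_poly g -> is_poly (fun z => f z + g z).
Proof. by move=> [s hs] [t ht]; exists (s ++ t) => z; rewrite big_cat /= hs ht. Qed.

Lemma monomialD (p q : 'I_n -> nat) z :
  monomial (fun i => (p i + q i)%N) z = monomial p z * monomial q z.
Proof. by rewrite /monomial -big_split /=; apply: eq_bigr => i _; rewrite exprD. Qed.

Lemma is_polyM f g : is_poly f -> is_poly g -> is_poly (fun z => f z * g z).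
Proof.
move=> [s hs] [t ht].
exists [seq (q.1 * r.1, fun i => (q.2 i + r.2 i)%N) | q <- s, r <- t] => z.
rewrite big_allpairs_dep /= hs ht mulr_suml; apply: eq_bigr => q _.
rewrite mulr_sumr; apply: eq_bigr => r _.
by rewrite monomialD mulrACA.
Qed.

Lemma is_poly_sum (I : Type) (r : seq I) (F : I -> V -> C) :
  (forall i, is_poly (F i)) -> is_poly (fun z => \sum_(i <- r) F i z).
Proof.
move=> H; elim: r => [|i r IH].
  by apply: eq_is_poly (is_poly_cst 0) => z; rewrite big_nil.
by apply: eq_is_poly (is_polyD (H i) IH) => z; rewrite big_cons.
Qed.

Lemma is_polyX f m : is_poly f -> is_poly (fun z => f z ^+ m).
Proof.
move=> H; elim: m => [|m IH].
  by apply: eq_is_poly (is_poly_cst 1) => z; rewrite expr0.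
by apply: eq_is_poly (is_polyM H IH) => z; rewrite exprS.
Qed.

Lemma is_poly_horner (p : {poly C}) f : is_poly f -> is_poly (fun z => p.[f z]).
Proof.
move=> H; under eq_fun do rewrite horner_coef.
by apply: is_poly_sum => i; apply: is_polyM; [exact: is_poly_cst|exact: is_polyX].
Qed.

(** This unfolds to the condition at [z] in [holomorphic_on], which makes the small-o calculus
    applicable to it. *)
Definition frechet f z := exists c : V, is_o (fun h : V => \sum_(k < n) nm (h k))
  (fun h => f (fun k => z k + h k) - f z - \sum_(k < n) c k * h k).

Let l1norm (h : V) : R := \sum_(k < n) nm (h k).

Lemma l1norm_ge0 (h : V) : 0 <= l1norm h.
Proof. by apply: sumr_ge0 => k _; exact: nm_ge0. Qed.

Lemma nm_l1norm (h : V) k : nm (h k) <= l1norm h.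
Proof. by rewrite /l1norm (bigD1 k) //= lerDl sumr_ge0 // => i _; exact: nm_ge0. Qed.

Lemma is_O_linear (c : V) : is_O l1norm (fun h => \sum_(k < n) c k * h k).
Proof.
exists (1 + \sum_(k < n) nm (c k)).
  by apply: ltr_wpDr => //; apply: sumr_ge0 => k _; exact: nm_ge0.
exists 1 => // h _; apply: le_trans (nm_sum _ _ _) _.
rewrite mulrDl mul1r mulr_suml; apply: ler_wpDl; first exact: l1norm_ge0.
by apply: ler_sum => k _; rewrite nmM ler_wpM2l ?nm_ge0 ?nm_l1norm.
Qed.

Lemma frechet_O f z : frechet f z -> is_O l1norm (fun h => f (fun k => z k + h k) - f z).
Proof.
move=> [c /is_o_is_O /is_OD - /(_ _ (is_O_linear c))].
by apply: eq_is_O => u; rewrite subrK.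
Qed.

Lemma frechet_cst (c : C) z : frechet (fun=> c) z.
Proof.
exists (fun=> 0); apply: eq_is_o (is_o0 l1norm_ge0) => h.
by rewrite subrr big1 ?subrr // => i _; rewrite mul0r.
Qed.

Lemma frechet_coord k z : frechet (fun z => z k) z.
Proof.
exists (fun i => (i == k)%:R); apply: eq_is_o (is_o0 l1norm_ge0) => h.
rewrite (bigD1 k) //= eqxx mul1r big1 ?addr0; last first.
  by move=> i /negbTE ->; rewrite mul0r.
by ring.
Qed.

Lemma frechetD f g z : frechet f z -> frechet g z -> frechet (fun z => f z + g z) z.
Proof.
move=> [c H] [d G]; exists (fun k => c k + d k).
apply: eq_is_o (is_oD H G) => h.
have -> : \sum_(k < n) (c k + d k) * h k = \sum_(k < n) c k * h k + \sum_(k < n) d k * h k.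
  by rewrite -big_split; apply: eq_bigr => k _; rewrite mulrDl.
ring.
Qed.

Lemma frechetM f g z : frechet f z -> frechet g z -> frechet (fun z => f z * g z) z.
Proof.
move=> df dg; have [c H] := df; have [d G] := dg.
exists (fun k => c k * g z + f z * d k).
have h1 := is_oM_bounded (near_bounded_cst _ (g z)) H.
have h2 := is_oM_bounded (near_bounded_cst _ (f z)) G.
have h3 := is_OM l1norm_ge0 (frechet_O df) (frechet_O dg).
apply: eq_is_o (is_oD (is_oD h1 h2) h3) => h.
have -> : \sum_(k < n) (c k * g z + f z * d k) * h k =
    g z * (\sum_(k < n) c k * h k) + f z * (\sum_(k < n) d k * h k).
  by rewrite !mulr_sumr -big_split; apply: eq_bigr => k _ /=; ring.
ring.
Qed.

Lemma frechet_sum (I : Type) (r : seq I) (F : I -> V -> C) z :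
  (forall i, frechet (F i) z) -> frechet (fun z => \sum_(i <- r) F i z) z.
Proof.
move=> H; elim: r => [|i r IH].
  by under eq_fun do rewrite big_nil; exact: frechet_cst.
by under eq_fun do rewrite big_cons; exact: frechetD.
Qed.

Lemma frechet_prod (I : Type) (r : seq I) (F : I -> V -> C) z :
  (forall i, frechet (F i) z) -> frechet (fun z => \prod_(i <- r) F i z) z.
Proof.
move=> H; elim: r => [|i r IH].
  by under eq_fun do rewrite big_nil; exact: frechet_cst.
by under eq_fun do rewrite big_cons; exact: frechetM.
Qed.

Lemma frechetX f m z : frechet f z -> frechet (fun z => f z ^+ m) z.
Proof.
move=> H; elim: m => [|m IH].
  by under eq_fun do rewrite expr0; exact: frechet_cst.
by under eq_fun do rewrite exprS; exact: frechetM.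
Qed.

Lemma frechet_monomial (p : 'I_n -> nat) z : frechet (monomial p) z.
Proof. by apply: frechet_prod => i; apply: frechetX; exact: frechet_coord. Qed.

Lemma is_poly_holomorphic g (D : set V) : is_poly g -> holomorphic_on D g.
Proof.
move=> [s hs] z _; have -> : g = fun z => \sum_(q <- s) q.1 * monomial q.2 z by exact/funext.
apply: (@frechet_sum _ s (fun q z => q.1 * monomial q.2 z)) => q.
by apply: frechetM; [exact: frechet_cst|exact: frechet_monomial].
Qed.

Lemma is_poly_upd g z k (u : C) : is_poly g -> cdiff (fun v => g (upd z k v)) u.
Proof.
move=> /(is_poly_holomorphic (D := setT)) hg; exact: holomorphic_upd hg I.
Qed.

Lemma is_poly_line g (al be : V) (u : C) : is_poly g ->
  cdiff (fun v => g (fun k => al k + be k * v)) u.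
Proof.
move=> /(is_poly_holomorphic (D := setT)) hg; exact: holomorphic_line hg I.
Qed.

End Polynomials.

(** * From polynomial growth on polytori to a polynomial *)

Section PolynomialGrowth.
Variables (R : realType) (n : nat).
Local Notation C := R[i].
Local Notation V := ('I_n -> C).
Implicit Types (z w : V) (k : 'I_n).

Definition dilate (c : C) z : V := fun k => c * z k.

Lemma dilateA (c d : C) z : dilate c (dilate d z) = dilate (c * d) z.
Proof. by apply/funext => k; rewrite /dilate mulrA. Qed.

Variables (D : set V) (l : 'I_n).
Hypothesis D_open : forall z k, D z ->
  exists2 d : R, 0 < d & forall u, nm (u - z k) < d -> D (upd z k u).
Hypothesis D_between : forall z k (u : C), D z -> k != l ->
  between (nm (z l)) (nm (z k)) (nm u) -> D (upd z k u).
Hypothesis D_polytorus : forall z, (forall k, nm (z k) = nm (z l)) -> D z.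
Hypothesis D_origin : exists2 r : R, 0 < r & forall z, (forall k, nm (z k) < r) -> D z.

Variable f : V -> C.
Hypothesis f_holo : holomorphic_on D f.
Variables (K : R) (N : nat).
Hypothesis K0 : 0 <= K.
Hypothesis f_growth : forall z, (forall k, nm (z k) = nm (z l)) ->
  nm (f z) <= K * (2 + nm (z l)) ^+ N.

Let x := @node R N.
Let L := lagrange_poly x.

(** The whole line through [z] consists of polytorus points, so [c |-> f (c z)] is entire of growth
    [N]. Both sides of the identity are also holomorphic in [z], which lets it leave the polytori in
    [Del_line]. *)
Lemma polytorus_line z : (forall k, nm (z k) = nm (z l)) ->
  forall c : C, f (dilate c z) = \sum_(j < N.+1) (L j).[c] * f (dilate (x j) z).
Proof.
move=> hz c; apply: (lagrange_interp (h := fun c => f (dilate c z))); last exact: node_inj.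
- move=> u; have e v : dilate v z = (fun k => 0 + z k * v).
    by apply/funext => k; rewrite /dilate add0r mulrC.
  under eq_fun do rewrite e; apply: holomorphic_line f_holo _; rewrite -e.
  by apply: D_polytorus => k; rewrite !nmM hz.
- exists (K * (2 + nm (z l)) ^+ N); first by rewrite mulr_ge0 // exprn_ge0 // addr_ge0 ?nm_ge0.
  move=> w; apply: le_trans (f_growth _) _; first by move=> k; rewrite !nmM hz.
  rewrite -mulrA; apply: ler_wpM2l => //; rewrite -exprMn nmM.
  have := nm_ge0 w; have := nm_ge0 (z l) => h1 h2.
  by apply: lerXn2r; rewrite ?nnegrE ?addr_ge0 ?mulr_ge0 ?addr_ge0 //; nra.
Qed.

(** Boundedness near 0 comes from continuity of [f] there; [r <= 1] keeps the dilation factor [tau]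
    below 1. *)
Lemma small_polydisc : exists r : R, [/\ 0 < r, r <= 1,
  (forall z, (forall k, nm (z k) < r) -> D z) &
  exists2 M : R, 0 <= M & forall z, (forall k, nm (z k) < r) -> nm (f z) <= M].
Proof.
have [r r0 Hr] := D_origin.
have D0 : D (fun=> 0) by apply: Hr => k; rewrite nm0.
have [d d0 hd] := is_O_cvg (frechet_O (f_holo D0)) ltr01.
have n1 : (0 : R) < n%:R + 1 by rewrite ltr_wpDl // ler0n.
exists (Num.min (Num.min r 1) (d / (n%:R + 1))); split.
- by rewrite !lt_min r0 ltr01 divr_gt0.
- by rewrite !ge_min lexx orbT.
- by move=> z hz; apply: Hr => k; have := hz k; rewrite !lt_min => /andP[/andP[]].
exists (nm (f (fun=> 0)) + 1); first by rewrite addr_ge0 ?nm_ge0.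
move=> z hz; have : \sum_(k < n) nm (z k) < d.
  apply: (@le_lt_trans _ _ (n%:R * (d / (n%:R + 1)))).
    rewrite -[n in X in _ <= X * _]card_ord mulr_natl -sumr_const; apply: ler_sum => k _.
    by have := hz k; rewrite !lt_min => /andP[_ /ltW].
  rewrite mulrCA gtr_pMr // ltr_pdivrMr // mul1r; lra.
move=> /hd; rewrite (_ : (fun k => 0 + z k) = z); last by apply/funext => k; rewrite add0r.
have := nmD (f z - f (fun=> 0)) (f (fun=> 0)); rewrite subrK; lra.
Qed.

Section Extension.
Variables (r M : R).
Hypotheses (r0 : 0 < r) (r1 : r <= 1).
Let Del z := forall k, nm (z k) < r.
Hypothesis Del_D : forall z, Del z -> D z.
Hypothesis M0 : 0 <= M.
Hypothesis fM : forall z, Del z -> nm (f z) <= M.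

Lemma Del_scal c z : nm c <= 1 -> Del z -> Del (dilate c z).
Proof.
move=> c1 hz k; apply: le_lt_trans (hz k); rewrite nmM.
by rewrite ler_piMl ?nm_ge0.
Qed.

Lemma Del_upd z k u : Del z -> nm u < r -> Del (upd z k u).
Proof. by move=> hz hu i; rewrite /upd; case: eqP. Qed.

Lemma f_scal_upd c z k u : nm c <= 1 -> Del (upd z k u) ->
  cdiff (fun v => f (dilate c (upd z k v))) u.
Proof.
move=> c1 hu.
pose al : V := fun i => if i == k then 0 else c * z i.
pose be : V := fun i => if i == k then c else 0.
have e v : dilate c (upd z k v) = (fun i => al i + be i * v).
  apply/funext => i; rewrite /dilate /upd /al /be.
  by case: eqP; rewrite ?mul0r ?addr0 ?add0r.
under eq_fun do rewrite e; apply: holomorphic_line f_holo _; rewrite -e.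
by apply: Del_D; exact: Del_scal.
Qed.

(** With [c] fixed, the difference of the sides is holomorphic in each variable on the polydisc and
    vanishes on its polytori. *)
Lemma Del_line c z : nm c <= 1 -> Del z ->
  f (dilate c z) = \sum_(j < N.+1) (L j).[c] * f (dilate (x j) z).
Proof.
move=> c1 hz; apply/eqP; rewrite -subr_eq0; apply/eqP.
pose g w := f (dilate c w) - \sum_(j < N.+1) (L j).[c] * f (dilate (x j) w).
apply: (@polytorus_identity R n Del g l) => //.
- move=> w k hw; exists (r - nm (w k)); first by rewrite subr_gt0.
  move=> u hu; have hDu : Del (upd w k u).
    apply: Del_upd => //; have := nmD (u - w k) (w k); rewrite subrK; lra.
  apply: cdiffB; first exact: f_scal_upd.
  apply: cdiff_sum => j; apply: cdiffM; first exact: cdiff_cst.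
  by apply: f_scal_upd => //; exact: nm_node.
- move=> w k hw; exists (r - nm (w k)); first by rewrite subr_gt0.
  move=> u hu; apply: Del_upd => //; have := nmD (u - w k) (w k); rewrite subrK; lra.
- move=> w k u hw _ hb; apply: Del_upd => //; case: hb => /andP[_ hb].
    exact: le_lt_trans hb (hw k).
  exact: le_lt_trans hb (hw l).
- by move=> w _ _ hw; rewrite /g -polytorus_line // subrr.
Qed.

(* The value at [1] of the polynomial of degree at most [N] interpolating
   [c |-> f (c z)] at the points [t * x j]. *)
Let Ft (t : R) z := \sum_(j < N.+1) (L j).[t%:C^-1] * f (dilate (t%:C * x j) z).

(** Let [y = t z], and let [p] be the polynomial with [p(c) = f (c y)] for [|c| <= 1]. Both sides
    equal [p(1/t)], interpolated once at the points [m * x j] and once at the nodes [x j]. *)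
Lemma Ft_indep (t m : R) z : 0 < t -> 0 < m -> m <= 1 -> Del (dilate t%:C z) ->
  Ft (m * t) z = Ft t z.
Proof.
move=> t0 m0 m1 hz; set y := dilate t%:C z in hz.
pose p : {poly C} := \sum_(j < N.+1) f (dilate (x j) y) *: L j.
have pE c : p.[c] = \sum_(j < N.+1) (L j).[c] * f (dilate (x j) y).
  by rewrite /p horner_sum; apply: eq_bigr => j _; rewrite hornerZ mulrC.
have sp : (size p <= N.+1)%N.
  apply: (leq_trans (size_sum _ _ _)); apply/bigmax_leqP => j _.
  by apply: leq_trans (size_scale_leq _ _) _; exact: size_lagrange_poly.
have pl c : nm c <= 1 -> f (dilate c y) = p.[c] by move=> c1; rewrite pE Del_line.
have nm_m : nm (m%:C : C) = m by rewrite nm_real gtr0_norm.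
transitivity (\sum_(j < N.+1) (L j).[(m * t)%:C^-1] * p.[m%:C * x j]).
  apply: eq_bigr => j _; congr (_ * _); rewrite -pl; last first.
    by rewrite nmM nm_m mulr_ile1 ?nm_ge0 ?(ltW m0) // nm_node.
  by rewrite /y dilateA rmorphM /=; congr (f (dilate _ _)); ring.
rewrite -(lagrange_interp (h := fun c => p.[m%:C * c])); last exact: node_inj.
- rewrite rmorphM /= invfM mulrA divff ?mul1r; last first.
    by rewrite -nm_eq0 nm_m gt_eqF.
  rewrite pE; apply: eq_bigr => j _; congr (_ * _).
  by rewrite /y dilateA; congr (f (dilate _ _)); rewrite mulrC.
- move=> w; under eq_fun do rewrite -[m%:C * _]add0r.
  by apply: (cdiff_aff (h := fun c => p.[c])); exact: entire_poly.
- have [B B0 hB] := growth_poly sp; exists B => // w.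
  apply: le_trans (hB _) _; apply: ler_wpM2l => //; have := nm_ge0 w => w0.
  by apply: lerXn2r; rewrite ?nnegrE ?addr_ge0 ?nm_ge0 // nmM nm_m; nra.
Qed.

Let S z : R := \sum_(k < n) nm (z k).
(** A dilation factor that brings [z] into the polydisc and whose inverse grows only linearly in the
    coordinates, as the growth of [F] requires. *)
Let tau z : R := r / (2 * (1 + S z)).
Let F z := Ft (tau z) z.

Lemma S_ge0 z : 0 <= S z.
Proof. by apply: sumr_ge0 => k _; exact: nm_ge0. Qed.

Lemma tau_gt0 z : 0 < tau z.
Proof. by rewrite divr_gt0 // mulr_gt0 // ltr_wpDr ?S_ge0. Qed.

Lemma tau_Del z : Del (dilate (tau z)%:C z).
Proof.
move=> k; rewrite nmM nm_real gtr0_norm ?tau_gt0 // /tau.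
have h : nm (z k) <= S z by rewrite /S (bigD1 k) //= lerDl sumr_ge0 // => i _; exact: nm_ge0.
have S0 := S_ge0 z; rewrite mulrAC ltr_pdivrMr; last by rewrite mulr_gt0 // ltr_wpDr.
by rewrite ltr_pM2l //; lra.
Qed.

Lemma F_Ft z (t : R) : 0 < t -> t <= tau z -> F z = Ft t z.
Proof.
move=> t0 tt; have tau0 := tau_gt0 z.
have m0 : 0 < t / tau z by exact: divr_gt0.
have m1 : t / tau z <= 1 by rewrite ler_pdivrMr // mul1r.
by rewrite /F -(Ft_indep tau0 m0 m1 (@tau_Del z)) divfK // gt_eqF.
Qed.

Lemma F_Del z : Del z -> F z = f z.
Proof.
move=> hz; have tau0 := tau_gt0 z.
have tau1 : tau z <= 1.
  have := S_ge0 z => S0; rewrite /tau ler_pdivrMr ?mul1r; last by rewrite mulr_gt0 // ltr_wpDr.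
  by apply: le_trans r1 _; lra.
have s1 : dilate 1 z = z by apply/funext => k; rewrite /dilate mul1r.
rewrite /F -[tau z]mulr1 Ft_indep // ?s1 // -[RHS](congr1 f s1) Del_line ?nm1 //.
by rewrite /Ft invr1; apply: eq_bigr => j _; rewrite mul1r.
Qed.

Lemma S_upd z k u : S (upd z k u) <= S z + nm u.
Proof.
rewrite /S (bigD1 k) //= upd_eq addrC lerD2r [leRHS](bigD1 k) //=.
apply: ler_wpDl; first exact: nm_ge0.
by rewrite le_eqVlt; apply/orP; left; apply/eqP/eq_bigr => i ik; rewrite upd_neq.
Qed.

(** [tau] does not vary holomorphically with [u]; near a given [u] it is replaced by a constant [t]
    below all nearby values, which leaves [F] unchanged by [F_Ft]. *)
Lemma F_entire z k : entire (fun u => F (upd z k u)).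
Proof.
move=> u; pose t := r / (2 * (1 + (S z + (nm u + 1)))).
have S0 := S_ge0 z; have u0 := nm_ge0 u.
have d0 : 0 < 2 * (1 + (S z + (nm u + 1))) by lra.
have t0 : 0 < t by rewrite divr_gt0.
have tt v : nm (v - u) < 1 -> t <= tau (upd z k v).
  move=> vu; rewrite /t /tau ler_pM2l //; have Sv := S_ge0 (upd z k v).
  have d1 : 0 < 2 * (1 + S (upd z k v)) by lra.
  rewrite lef_pV2 ?posrE // ler_pM2l // lerD2l.
  apply: le_trans (S_upd z k v) _; rewrite lerD2l.
  by have := nmD (v - u) u; rewrite subrK; lra.
apply: (@cdiff_near _ (fun v => Ft t (upd z k v)) _ _ 1) => //.
  move=> v v1; rewrite (@F_Ft _ t) // tt // addrAC subrr add0r //.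
apply: cdiff_sum => j; apply: cdiffM; first exact: cdiff_cst.
have ntx : nm (t%:C * x j) <= t.
  by rewrite nmM nm_real gtr0_norm // ler_piMr ?nm_node // ltW.
pose al : V := fun i => if i == k then 0 else t%:C * x j * z i.
pose be : V := fun i => if i == k then t%:C * x j else 0.
have e v : dilate (t%:C * x j) (upd z k v) = (fun i => al i + be i * v).
  apply/funext => i; rewrite /dilate /upd /al /be.
  by case: eqP; rewrite ?mul0r ?addr0 ?add0r.
under eq_fun do rewrite e; apply: holomorphic_line f_holo _; rewrite -e.
apply: Del_D => i; rewrite nmM.
apply: (@le_lt_trans _ _ (tau (upd z k u) * nm (upd z k u i))).
  apply: ler_wpM2r; first exact: nm_ge0.
  by apply: le_trans ntx _; apply: tt; rewrite subrr nm0.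
have := tau_Del (upd z k u) i; rewrite nmM nm_real gtr0_norm //; exact: tau_gt0.
Qed.

(** The factors [(L j).[1 / tau]] have degree at most [N] in [1 / tau], itself at most affine in
    [|u|], while the values of [f] are taken in the polydisc and bounded by [M]. *)
Lemma F_growth z k : growth N (fun u => F (upd z k u)).
Proof.
have gL j : {B : R | 0 <= B & forall w : C, nm (L j).[w] <= B * (1 + nm w) ^+ N}.
  by apply: cid2; apply: growth_poly; exact: size_lagrange_poly.
pose B j := s2val (gL j).
have B0 j : 0 <= B j by exact: (s2valP (gL j)).
have hB j (w : C) : nm (L j).[w] <= B j * (1 + nm w) ^+ N by exact: (s2valP' (gL j)).
have S0 := S_ge0 z.
pose A := 1 + 2 / r * (1 + S z).
have A0 : 0 <= A by rewrite addr_ge0 // mulr_ge0 ?addr_ge0 // divr_ge0 // ltW.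
exists (\sum_(j < N.+1) B j * M * A ^+ N).
  by apply: sumr_ge0 => j _; rewrite !mulr_ge0 ?exprn_ge0.
move=> u; rewrite mulr_suml; apply: le_trans (nm_sum _ _ _) _.
apply: ler_sum => j _; rewrite nmM.
have tD := tau_Del (upd z k u); have tau0 := tau_gt0 (upd z k u).
have fb : nm (f (dilate ((tau (upd z k u))%:C * x j) (upd z k u))) <= M.
  by apply: fM; rewrite mulrC -dilateA; apply: Del_scal => //; exact: nm_node.
apply: le_trans (ler_pM (nm_ge0 _) (nm_ge0 _) (hB j _) fb) _.
rewrite mulrAC -!mulrA; apply: ler_wpM2l => //; apply: ler_wpM2l => //.
rewrite -exprMn; have u0 := nm_ge0 u.
have p1 : 0 <= 1 + nm (tau (upd z k u))%:C^-1 by rewrite addr_ge0 ?nm_ge0.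
have p2 : 0 <= A * (1 + nm u) by rewrite mulr_ge0 // addr_ge0.
apply: lerXn2r; rewrite ?nnegrE //.
rewrite nmV nm_real gtr0_norm // /tau invf_div.
have Su := S_upd z k u; have ri0 : 0 < r^-1 by rewrite invr_gt0.
have -> : 2 * (1 + S (upd z k u)) / r = 2 / r * (1 + S (upd z k u)) by ring.
have q0 : 0 < 2 / r by rewrite divr_gt0.
rewrite /A; set q := 2 / r in q0 *.
have h1 : q * (1 + S (upd z k u)) <= q * (1 + S z + nm u) by rewrite ler_pM2l //; lra.
have h2 : 0 <= q * (S z * nm u) by rewrite mulr_ge0 ?mulr_ge0 // ltW.
nra.
Qed.

Lemma F_coord z k : F z = \sum_(j < N.+1) (L j).[z k] * F (upd z k (x j)).
Proof.
rewrite -[in LHS](upd_id z k).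
exact: (lagrange_interp (@F_entire z k) (@F_growth z k) (@node_inj R N)).
Qed.

(** Interpolation one variable at a time: [mix m sg] leaves the first [m] coordinates free and
    freezes the others at nodes, and [F_coord] releases one more. *)
Lemma F_poly : is_poly F.
Proof.
pose mix (m : nat) (sg : 'I_n -> 'I_N.+1) z : V := fun i => if (i < m)%N then z i else x (sg i).
suff H m sg : (m <= n)%N -> is_poly (fun z => F (mix m sg z)).
  have := H n (fun=> ord0) (leqnn n); apply: eq_is_poly => z; congr F.
  by apply/funext => i; rewrite /mix ltn_ord.
elim: m sg => [|m IH] sg mn.
  by apply: eq_is_poly (is_poly_cst _ (F (fun i => x (sg i)))) => z; congr F.
pose k := Ordinal mn.
apply: (@eq_is_poly _ _ (fun z => \sum_(j < N.+1) (L j).[z k] *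
    F (mix m (fun i => if i == k then j else sg i) z))).
  move=> z; rewrite (F_coord (mix m.+1 sg z) k); apply: eq_bigr => j _.
  congr (_ .[_] * F _); first by rewrite /mix ltnSn.
  apply/funext => i; rewrite /mix /upd; have [->|ik] := eqVneq i k; first by rewrite ltnn.
  have im : (nat_of_ord i == m) = false by apply: contraNF ik => /eqP im; apply/eqP/val_inj.
  by have -> : (i < m.+1)%N = (i < m)%N by rewrite ltnS leq_eqVlt im.
apply: is_poly_sum => j; apply: is_polyM; first by apply: is_poly_horner; exact: is_poly_coord.
by apply: IH; exact: ltnW.
Qed.

(** On the line through [z], [f] and [F] agree near 0, hence also at the parameter 1. *)
Lemma F_polytorus z : (forall k, nm (z k) = nm (z l)) -> f z = F z.
Proof.
move=> hz; apply/eqP; rewrite -subr_eq0; apply/eqP.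
pose h c := f (dilate c z) - F (dilate c z).
have s1 : dilate 1 z = z by apply/funext => k; rewrite /dilate mul1r.
rewrite -{1 2}s1 -/(h 1) -[1]add0r.
have e v : dilate v z = (fun k => 0 + z k * v).
  by apply/funext => k; rewrite /dilate add0r mulrC.
apply: path_identity => [t _|d d0].
  exists 1 => // w _; rewrite /h; apply: cdiffB.
    under eq_fun do rewrite e; apply: holomorphic_line f_holo _; rewrite -e.
    by apply: D_polytorus => k; rewrite !nmM hz.
  under eq_fun do rewrite e; exact: is_poly_line F_poly.
pose c := Num.min (d / 2) (r / (2 * (1 + nm (z l)))).
have z0 := nm_ge0 (z l).
have c0 : 0 < c by rewrite lt_min !divr_gt0 // mulr_gt0 //; lra.
have nc : nm (c%:C : C) = c by rewrite nm_real gtr0_norm.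
exists c%:C; split.
- by rewrite -nm_eq0 nc gt_eqF.
- by rewrite subr0 nc; apply: (@le_lt_trans _ _ (d / 2)); [rewrite ge_min lexx|lra].
- rewrite /h F_Del ?subrr // => k; rewrite nmM nc hz.
  apply: (@le_lt_trans _ _ (r / (2 * (1 + nm (z l))) * nm (z l))).
    by apply: ler_wpM2r => //; rewrite ge_min lexx orbT.
  have q0 : 0 < 2 * (1 + nm (z l)) by lra.
  by rewrite mulrAC ltr_pdivrMr // ltr_pM2l //; lra.
Qed.

Lemma F_domain z : D z -> f z = F z.
Proof.
move=> Dz; apply/eqP; rewrite -subr_eq0; apply/eqP.
apply: (@polytorus_identity R n D (fun w => f w - F w) l) => //.
- move=> w k Dw; have [d d0 hd] := D_open k Dw; exists d => // u hu.
  apply: cdiffB; first by apply: holomorphic_upd f_holo _; exact: hd.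
  by apply: is_poly_upd; exact: F_poly.
- by move=> w _ _ hw; rewrite (F_polytorus hw) subrr.
Qed.

End Extension.

Theorem polynomial_growth : exists g, is_poly g /\ forall z, D z -> f z = g z.
Proof.
have [r [r0 r1 DD [M M0 fM]]] := small_polydisc.
eexists; split; first exact: (F_poly r0 DD M0 fM).
by move=> z; exact: (F_domain r0 r1 DD M0 fM).
Qed.

End PolynomialGrowth.

(** * Square-integrable holomorphic functions on D(a) are polynomials *)

Section IteratedIntegral.
Variable R : realType.
Local Notation mu := (@lebesgue_measure R).
Implicit Types (v x : nat -> R) (G H : (nat -> R) -> \bar R) (m j : nat) (s t : R).

Definition cons2 s t v : nat -> R := fun i =>
  if i is i'.+1 then (if i' is i''.+1 then v i'' else t) else s.

Lemma iter_int2E m G : iter_int (2 * m.+1) G =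
  (\int[mu]_s \int[mu]_t iter_int (2 * m) (fun v => G (cons2 s t v)))%E.
Proof.
rewrite mulnS /=; apply: eq_integral => s _; apply: eq_integral => t _.
by congr iter_int; apply/funext => v; congr G; apply/funext => -[|[]].
Qed.

Lemma iter_int_ge0 m G : (forall v, 0 <= G v)%E -> (0 <= iter_int m G)%E.
Proof.
elim: m G => [|m IH] G H /=; first exact: H.
by apply: integral_ge0 => x _; exact: IH.
Qed.

Definition upd2 v j s t : nat -> R := fun i =>
  if i == (2 * j)%N then s else if i == (2 * j).+1 then t else v i.

Lemma upd2_cons2 s t s' t' v j :
  upd2 (cons2 s t v) j.+1 s' t' = cons2 s t (upd2 v j s' t').
Proof. by apply/funext => -[|[|i]]; rewrite /upd2 mulnS. Qed.

(** The inequality in variable [j] is used at points whose earlier coordinates have already moved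
    inside their squares and whose later ones are still those of [x]. The zeros of [x] beyond
    [2 * m] match the base case of [iter_int]. *)
Lemma iter_submean (c dl : R) m x G : 0 < c ->
  (forall v, 0 <= G v)%E -> (forall i, (2 * m <= i)%N -> x i = 0) ->
  (forall j v, (j < m)%N ->
    (forall i, (i < j)%N -> in_square (x (2 * i)%N) (x (2 * i).+1) dl (v (2 * i)%N) (v (2 * i).+1)) ->
    (forall i, (2 * j <= i)%N -> v i = x i) ->
    G v <= c%:E * \int[mu]_s \int[mu]_t
      ((in_square (x (2 * j)%N) (x (2 * j).+1) dl s t)%:R%:E * G (upd2 v j s t)))%E ->
  (G x <= (c ^+ m)%:E * iter_int (2 * m) G)%E.
Proof.
move=> c0; elim: m x G => [|m IH] x G G0 x0 H.
  rewrite expr0 mul1e /=; have -> : x = (fun=> 0) by apply/funext => i; exact: x0.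
  exact: lexx.
apply: le_trans (H 0%N x _ _ _) _ => //.
rewrite iter_int2E exprS EFinM -muleA; apply: lee_wpmul2l; first by rewrite lee_fin ltW.
have cm : 0 < c ^+ m by rewrite exprn_gt0.
have I0 s t : (0 <= iter_int (2 * m) (fun v => G (cons2 s t v)))%E.
  by apply: iter_int_ge0 => v.
have J0 s : (0 <= \int[mu]_t iter_int (2 * m) (fun v => G (cons2 s t v)))%E.
  by apply: integral_ge0.
rewrite -ge0_integral_scale //; apply: ge0_integral_mono => s _.
  by apply: integral_ge0 => t _; rewrite mule_ge0 // lee_fin.
rewrite -ge0_integral_scale //; apply: ge0_integral_mono => t _.
  by rewrite mule_ge0 // lee_fin.
case: (boolP (in_square _ _ _ _ _)) => [hin|_]; last by rewrite mul0e mule_ge0 // lee_fin ltW.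
rewrite mul1e; pose x' i := x i.+2.
have -> : upd2 x 0 s t = cons2 s t x' by apply/funext => -[|[]].
apply: (IH x' (fun v => G (cons2 s t v))) => //.
  by move=> i hi; apply: x0; rewrite mulnS.
move=> j v jm h1 h2.
have -> : (fun s' => \int[mu]_t' ((in_square (x' (2 * j)%N) (x' (2 * j).+1) dl s' t')%:R%:E *
    G (cons2 s t (upd2 v j s' t'))))%E = (fun s' => \int[mu]_t'
   ((in_square (x (2 * j.+1)%N) (x (2 * j.+1).+1) dl s' t')%:R%:E *
    G (upd2 (cons2 s t v) j.+1 s' t')))%E.
  apply/funext => s'; apply: eq_integral => t' _; rewrite upd2_cons2.
  by rewrite /x' mulnS.
apply: H => //.
  by move=> [|i] ij; [exact: hin|have := h1 i ij; rewrite /x' !mulnS].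
by move=> [|[|i]]; rewrite mulnS // => hi; exact: h2.
Qed.

End IteratedIntegral.

Section PointwiseBound.
Variables (R : realType) (n : nat).
Local Notation C := R[i].
Local Notation V := ('I_n -> C).
Local Notation mu := (@lebesgue_measure R).
Implicit Types (z w : V) (f : V -> C) (k : 'I_n) (D : set V).

(** A section of [cplx_of_reals], padded with 0 as [iter_int] does. *)
Definition reals_of z (i : nat) : R :=
  if insub i./2 is Some k then (if odd i then cIm (z k) else cRe (z k)) else 0.

Lemma reals_of_even z k : reals_of z (2 * k)%N = cRe (z k).
Proof. by rewrite /reals_of mul2n doubleK valK odd_double. Qed.

Lemma reals_of_odd z k : reals_of z (2 * k).+1 = cIm (z k).
Proof. by rewrite /reals_of mul2n /= uphalf_double valK odd_double. Qed.

Lemma reals_ofK z : cplx_of_reals (reals_of z) = z.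
Proof.
apply/funext => k; rewrite /cplx_of_reals reals_of_even reals_of_odd.
by case: (z k).
Qed.

Lemma cplx_upd2 (v : nat -> R) k (s t : R) :
  cplx_of_reals (n := n) (upd2 v k s t) = upd (cplx_of_reals v) k (s +i* t).
Proof.
apply/funext => i; rewrite /cplx_of_reals /upd /upd2; have [->|ik] := eqVneq i k.
  by rewrite !eqxx (gtn_eqF (ltnSn _)).
have ne : (nat_of_ord i == k) = false by apply: contraNF ik => /eqP/val_inj ->.
rewrite !mul2n !eqSS (inj_eq double_inj) ne.
have o : (i.*2 == k.*2.+1) = false by apply/negP => /eqP /(congr1 odd); rewrite /= !odd_double.
have o' : (i.*2.+1 == k.*2) = false by apply/negP => /eqP /(congr1 odd); rewrite /= !odd_double.
by rewrite o o'.
Qed.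

Lemma pointwise_L2_bound D f z (dl : R) : 0 < dl -> holomorphic_on D f ->
  (forall w, (forall k, in_square (cRe (z k)) (cIm (z k)) dl (cRe (w k)) (cIm (w k))) -> D w) ->
  ((nm (f z) ^+ 2)%:E <= ((8 / dl ^+ 2) ^+ n)%:E * L2_norm2 D f)%E.
Proof.
move=> dl0 hf hD.
pose G (v : nat -> R) : \bar R := ((\1_D (cplx_of_reals (n:=n) v) : R)
                              * Normc.normc (f (cplx_of_reals (n:=n) v)) ^+ 2)%:E.
have in0 x y : in_square x y dl x y by rewrite /in_square !subrr normr0 dl0.
have Dz : D z by apply: hD => k.
have Gz : G (reals_of z) = (nm (f z) ^+ 2)%:E.
  by rewrite /G reals_ofK indicE mem_set // mul1r.
rewrite -Gz; apply: (iter_submean (dl := dl)).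
- by rewrite divr_gt0 // exprn_gt0.
- by move=> v; rewrite lee_fin mulr_ge0 // ?indicE ?ler0n // sqr_ge0.
- move=> i ni; rewrite /reals_of insubF //; apply/negbTE; rewrite -leqNgt.
  by rewrite -(doubleK n) half_leq // -mul2n.
move=> j v jn h1 h2; pose k := Ordinal jn; pose w : V := cplx_of_reals v.
have hw i (u : C) : in_square (cRe (z k)) (cIm (z k)) dl (cRe u) (cIm u) ->
    in_square (cRe (z i)) (cIm (z i)) dl (cRe (upd w k u i)) (cIm (upd w k u i)).
  move=> hu; rewrite /upd; have [->//|ik] := eqVneq i k.
  have [ij|ij] := ltnP i j.
    by have := h1 i ij; rewrite reals_of_even reals_of_odd.
  have ji : (2 * j <= 2 * i)%N by rewrite leq_mul2l ij.
  by rewrite /w /cplx_of_reals /= !h2 ?(leqW ji) // reals_of_even reals_of_odd.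
have wk : w k = z k.
  rewrite /w /cplx_of_reals /= !h2 // (reals_of_even z k) (reals_of_odd z k).
  by case: (z k).
have Dw u : in_square (cRe (z k)) (cIm (z k)) dl (cRe u) (cIm u) -> D (upd w k u).
  by move=> hu; apply: hD => i; exact: hw.
(* The sub-mean inequality concerns the modulus of a holomorphic function; squaring [f] first
   produces [|f|^2]. *)
pose h u := f (upd w k u) ^+ 2.
have hh x y : in_square (cRe (z k)) (cIm (z k)) dl x y -> cdiff h (x +i* y).
  move=> hxy; apply: cdiffX; apply: (holomorphic_upd hf); exact: (Dw (x +i* y)).
have Gv : G v = (nm (h (cRe (z k) +i* cIm (z k))))%:E.
  rewrite /G -/w /h (_ : cRe (z k) +i* cIm (z k) = w k); last by rewrite wk; case: (z k).
  rewrite upd_id nmX indicE mem_set ?mul1r //.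
  by rewrite -(upd_id w k); apply: Dw; rewrite wk.
rewrite Gv (reals_of_even z k) (reals_of_odd z k).
apply: le_trans (submean_cdiff dl0 hh) _; apply: lee_wpmul2l.
  by rewrite lee_fin divr_ge0 // exprn_ge0 // ltW.
apply: ge0_integral_mono => s _.
  by apply: integral_ge0 => t _; rewrite lee_fin mulr_ge0 ?nm_ge0.
apply: ge0_integral_mono => t _; first by rewrite lee_fin mulr_ge0 ?nm_ge0.
case: (boolP (in_square _ _ _ _ _)) => [hin|_]; last by rewrite mul0r mul0e.
rewrite !mul1r mul1e /G (cplx_upd2 v k) -/w indicE mem_set ?mul1r /h ?nmX //.
exact: Dw.
Qed.

End PointwiseBound.

(** * Geometry of D(a) and growth of its Bergman functions *)

Section DomGeometry.
Variables (R : realType) (n : nat) (a : R).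
Local Notation C := R[i].
Local Notation V := ('I_n -> C).
Implicit Types (z w : V) (f : V -> C) (k : 'I_n).

Definition dom_width (t : R) : R := 1 / ((t + 1) `^ a).

Hypothesis a0 : 0 < a.

Lemma dom_width_gt0 t : 0 <= t -> 0 < dom_width t.
Proof. by move=> t0; rewrite divr_gt0 // powR_gt0 // ltr_wpDl. Qed.

Lemma dom_width_le1 t : 0 <= t -> dom_width t <= 1.
Proof.
move=> t0; have p0 : 0 < (t + 1) `^ a by rewrite powR_gt0 // ltr_wpDl.
by rewrite /dom_width ler_pdivrMr // mul1r -[leLHS](powRr0 (t + 1)) ler_powR ?(ltW a0) // lerDr.
Qed.

Lemma dom_width_cvg t : 0 <= t -> forall e : R, 0 < e ->
  exists2 d : R, 0 < d & forall s, `|s - t| < d -> `|dom_width s - dom_width t| < e.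
Proof.
move=> t0 e e0.
have t1 : 0 < t + 1 by rewrite ltr_wpDl.
have c : {for t, continuous dom_width}.
  have p0 : (t + 1) `^ a != 0 by rewrite gt_eqF // powR_gt0.
  have : {for t + 1, continuous (@powR R ^~ a)}.
    apply: differentiable_continuous; apply/derivable1_diffP.
    by apply: derivable_powR; rewrite in_itv /= t1.
  move=> c1; apply: cvgM; first exact: cvg_cst.
  apply: (cvgV p0); apply: (@cvg_comp _ _ _ (fun s => s + 1) (@powR R ^~ a)); last exact: c1.
  by apply: cvgD; [exact: cvg_id|exact: cvg_cst].
have /cvgrPdist_lt /(_ e e0) := c => /nbhs_ballP [d /= d0 H]; exists d => // s hs.
by have := H s; rewrite /ball /= distrC => /(_ hs); rewrite distrC.
Qed.

Lemma nm_sqr_cvg (z : C) (e : R) : 0 < e -> exists2 d : R, 0 < d &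
  forall w : C, nm (w - z) < d -> `|nm w ^+ 2 - nm z ^+ 2| < e.
Proof.
move=> e0; have z0 := nm_ge0 z; have z1 : 0 < 2 * nm z + 1 by lra.
exists (Num.min 1 (e / (2 * nm z + 1))); first by rewrite lt_min ltr01 divr_gt0.
move=> w; rewrite lt_min ltr_pdivlMr // => /andP[w1 w2].
rewrite subr_sqr normrM; have w0 := nm_ge0 w.
have h1 : `|nm w - nm z| <= nm (w - z).
  by rewrite ler_norml; have := nm_lerB w z; have := nm_lerB z w; rewrite nmB; lra.
have h2 : `|nm w + nm z| <= 2 * nm z + 1.
  rewrite ger0_norm; last lra.
  have := nm_lerB w z; lra.
by apply: le_lt_trans w2; apply: ler_pM.
Qed.

Variable l : 'I_n.
Hypothesis hl : val l = n.-1.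

Lemma DomP z : Dom n a z <-> forall k, k != l ->
  `|nm (z k) ^+ 2 - nm (z l) ^+ 2| < dom_width (nm (z l) ^+ 2).
Proof.
split=> H k.
  move=> kl; apply: H => //; have kn := ltn_ord k.
  have : (k <= n.-1)%N by rewrite -ltnS prednK // (leq_ltn_trans _ kn).
  rewrite leq_eqVlt => /orP[/eqP kE|//].
  by move: kl; rewrite -(inj_eq val_inj) hl /= kE eqxx.
move=> l' hl' kn; have -> : l' = l by apply: val_inj; rewrite hl hl'.
by apply: H; rewrite -(inj_eq val_inj) hl ltn_eqF.
Qed.

Lemma fin_radius (P : 'I_n -> R -> Prop) :
  (forall k d d', d' <= d -> P k d -> P k d') ->
  (forall k, exists2 d : R, 0 < d & P k d) -> exists2 d : R, 0 < d & forall k, P k d.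
Proof.
move=> mono H; have {}H k : {d : R | 0 < d & P k d} by apply: cid2; exact: H.
exists (\big[Num.min/1]_k (s2val (H k))).
  by elim/big_ind: _ => // [x y x0 y0|k _]; [rewrite lt_min x0|exact: (s2valP (H k))].
move=> k; apply: mono (s2valP' (H k)).
by rewrite (bigD1 k) //= ge_min lexx.
Qed.

Lemma Dom_open z : Dom n a z -> exists2 d : R, 0 < d &
  forall w, (forall k, nm (w k - z k) < d) -> Dom n a w.
Proof.
move=> /DomP Dz.
pose P k (d : R) := forall w, (forall i, nm (w i - z i) < d) -> k != l ->
  `|nm (w k) ^+ 2 - nm (w l) ^+ 2| < dom_width (nm (w l) ^+ 2).
have [d d0 hd] : exists2 d : R, 0 < d & forall k, P k d.
  apply: fin_radius => [k d d' dd Pd w hw|k].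
    by apply: Pd => i; exact: lt_le_trans (hw i) dd.
  have [->|kl] := eqVneq k l; first by exists 1 => // w _; rewrite eqxx.
  have gap := Dz k kl.
  (* A quarter of the gap for each of the three quantities that vary leaves the inequality
     strict. *)
  pose e := (dom_width (nm (z l) ^+ 2) - `|nm (z k) ^+ 2 - nm (z l) ^+ 2|) / 4.
  have e0 : 0 < e by rewrite divr_gt0 // subr_gt0.
  have [d1 d10 h1] := dom_width_cvg (sqr_ge0 (nm (z l))) e0.
  have [d2 d20 h2] := nm_sqr_cvg (z l) d10.
  have [d3 d30 h3] := nm_sqr_cvg (z l) e0.
  have [d4 d40 h4] := nm_sqr_cvg (z k) e0.
  exists (Num.min d2 (Num.min d3 d4)); first by rewrite !lt_min d20 d30.
  move=> w hw _.
  have := hw l; rewrite !lt_min => /and3P[/h2 /h1 k1 /h3 k3 _].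
  have := hw k; rewrite !lt_min => /and3P[_ _ /h4 k4].
  have : `|nm (w k) ^+ 2 - nm (w l) ^+ 2| <= `|nm (z k) ^+ 2 - nm (z l) ^+ 2| +
      (`|nm (w k) ^+ 2 - nm (z k) ^+ 2| + `|nm (w l) ^+ 2 - nm (z l) ^+ 2|).
    have -> : nm (w k) ^+ 2 - nm (w l) ^+ 2 = (nm (z k) ^+ 2 - nm (z l) ^+ 2) +
       ((nm (w k) ^+ 2 - nm (z k) ^+ 2) - (nm (w l) ^+ 2 - nm (z l) ^+ 2)) by ring.
    by apply: le_trans (ler_normD _ _) _; rewrite lerD2l ler_normB.
  have := ler_norm (dom_width (nm (z l) ^+ 2) - dom_width (nm (w l) ^+ 2)); rewrite distrC.
  have eE : 4 * e = dom_width (nm (z l) ^+ 2) - `|nm (z k) ^+ 2 - nm (z l) ^+ 2|.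
    by rewrite /e; field.
  move: k1 k3 k4 eE e0; clear; lra.
by exists d => // w hw; apply/DomP => k; exact: hd.
Qed.

Lemma Dom_between z k (u : C) : Dom n a z -> k != l ->
  between (nm (z l)) (nm (z k)) (nm u) -> Dom n a (upd z k u).
Proof.
move=> /DomP Dz kl hb; apply/DomP => i il.
rewrite (upd_neq _ _ (i := l)) 1?eq_sym //.
have [->|ik] := eqVneq i k; last by rewrite upd_neq // Dz.
rewrite upd_eq; apply: le_lt_trans (Dz k kl).
have z0 := nm_ge0 (z l); have u0 := nm_ge0 u; have k0 := nm_ge0 (z k).
case: hb => /andP[h1 h2].
  by rewrite !ger0_norm ?subr_ge0 ?lerD2r; nra.
by rewrite !ler0_norm ?subr_le0 ?lerN2 ?lerD2r; nra.
Qed.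

Lemma Dom_polytorus z : (forall k, nm (z k) = nm (z l)) -> Dom n a z.
Proof.
by move=> hz; apply/DomP => k _; rewrite hz subrr normr0 dom_width_gt0 // sqr_ge0.
Qed.

Lemma Dom_origin : exists2 r : R, 0 < r & forall z, (forall k, nm (z k) < r) -> Dom n a z.
Proof.
have z0 : Dom n a (fun=> 0 : C) by apply: Dom_polytorus.
have [r r0 H] := Dom_open z0; exists r => // z hz.
by apply: H => k; rewrite subr0.
Qed.

(* [1 / (t + 1) `^ a] is bounded below by an integral power, whence the width of
   the domain around a polytorus of radius [r] decays at most polynomially. *)
Lemma Dom_polytorus_box (K : nat) z w : a <= K%:R -> (forall k, nm (z k) = nm (z l)) ->
  (forall k, in_square (cRe (z k)) (cIm (z k)) ((8 * (2 + nm (z l)) ^+ (2 * K).+1)^-1)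
     (cRe (w k)) (cIm (w k))) -> Dom n a w.
Proof.
move=> aK hz hw; set r := nm (z l); have r0 : 0 <= r by exact: nm_ge0.
(* [q] bounds [(|w l|^2 + 1)^a] because [(r + 1)^2 + 1 <= (r + 2)^2] and [a <= K]. Displacements of
   at most [eta] separate two squared moduli by at most [4 eta (r + 1)], which is below [1/q]. *)
pose q := (2 + r) ^+ (2 * K); pose eta := (4 * ((2 + r) * q))^-1.
have q1 : 1 <= q by rewrite exprn_ege1 //; lra.
have q0 : 0 < q by lra.
have eta0 : 0 < eta by rewrite invr_gt0; nra.
have etaq : 4 * ((2 + r) * q) * eta = 1 by rewrite mulfV // gt_eqF //; nra.
have dE : (8 * (2 + r) ^+ (2 * K).+1)^-1 = eta / 2.
  by rewrite /eta -exprS; field; rewrite expf_neq0 // gt_eqF //; lra.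
have near k : nm (w k - z k) <= eta.
  have := hw k; rewrite -/r dE /in_square => /andP[h1 h2].
  apply: le_trans (nm_le_ReIm _) _; move: h1 h2.
  by case: (w k) (z k) => x y [x' y'] /=; lra.
have X1 : 1 <= 4 * ((2 + r) * q) by nra.
have eta1 : eta <= 1 by rewrite /eta invf_le1 // (lt_le_trans ltr01).
have mods k : r - eta <= nm (w k) <= r + eta.
  have := near k; have := nm_lerB (w k) (z k); have := nm_lerB (z k) (w k).
  by rewrite (nmB (z k)) hz -/r; lra.
apply/DomP => k kl.
have [h1 h2] := (mods k, mods l).
have w0 := nm_ge0 (w k); have wl0 := nm_ge0 (w l).
have up : `|nm (w k) ^+ 2 - nm (w l) ^+ 2| <= 4 * eta * (r + 1).
  rewrite subr_sqr normrM.
  have e1 : `|nm (w k) - nm (w l)| <= 2 * eta by rewrite ler_norml; lra.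
  have e2 : `|nm (w k) + nm (w l)| <= 2 * (r + 1) by rewrite ger0_norm; lra.
  apply: le_trans (ler_pM (normr_ge0 _) (normr_ge0 _) e1 e2) _; lra.
apply: le_lt_trans up _.
have low : q^-1 <= dom_width (nm (w l) ^+ 2).
  rewrite /dom_width div1r lef_pV2 ?posrE // ?powR_gt0 ?ltr_wpDl ?sqr_ge0 //.
  have b0 : 1 <= nm (w l) ^+ 2 + 1 by rewrite lerDr sqr_ge0.
  apply: le_trans (ler_powR b0 aK) _; rewrite powR_mulrn; last lra.
  rewrite /q exprM; apply: lerXn2r; rewrite ?nnegrE ?sqr_ge0 //; nra.
apply: lt_le_trans low; rewrite -[ltRHS]div1r ltr_pdivlMr //; nra.
Qed.

Theorem bergman_poly f : bergman (Dom n a) f ->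
  exists g, is_poly g /\ forall z, Dom n a z -> f z = g z.
Proof.
move=> [hf hL].
have [K aK] : exists K : nat, a <= K%:R.
  by exists (Num.bound a); apply/ltW/archi_boundP/ltW.
have L0 : (0 <= L2_norm2 (Dom n a) f)%E.
  by apply: iter_int_ge0 => v; rewrite lee_fin mulr_ge0 // ?indicE ?ler0n // sqr_ge0.
have LE : L2_norm2 (Dom n a) f = (fine (L2_norm2 (Dom n a) f))%:E.
  by rewrite fineK // ge0_fin_numE.
pose M := fine (L2_norm2 (Dom n a) f).
have M0 : 0 <= M by rewrite fine_ge0.
have [B [B0 BE]] : exists B : R, 0 <= B /\ B = 8 * 8 ^+ 2.
  by exists (8 * 8 ^+ 2); split => //; rewrite mulr_ge0 ?exprn_ge0 ?ler0n.
have BM0 : 0 <= B ^+ n * M by rewrite mulr_ge0 // exprn_ge0.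
(* Since [A >= 1], the bound [B^n M <= A <= A^2] avoids taking a square root. *)
pose A := B ^+ n * M + 1.
have A1 : 1 <= A by rewrite lerDr.
apply: (@polynomial_growth R n (Dom n a) l _ _ _ _ f hf A (n * (2 * K).+1)%N).
- move=> z k Dz; have [d d0 hd] := Dom_open Dz; exists d => // u hu.
  apply: hd => i; rewrite /upd; case: eqP => [->//|_].
  by rewrite subrr nm0.
- by move=> z k u; exact: Dom_between.
- exact: Dom_polytorus.
- exact: Dom_origin.
- lra.
move=> z hz; set r := nm (z l); have r0 : 0 <= r by exact: nm_ge0.
pose dl := (8 * (2 + r) ^+ (2 * K).+1)^-1.
have p0 : 0 < (2 + r) ^+ (2 * K).+1 by rewrite exprn_gt0 //; lra.
have dl0 : 0 < dl by rewrite invr_gt0 mulr_gt0.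
have := pointwise_L2_bound dl0 hf (fun w hw => Dom_polytorus_box aK hz hw).
rewrite LE -EFinM lee_fin -/M => H.
have A0 : 0 <= A by lra.
rewrite -(ler_pXn2r (n := 2)) ?nnegrE ?nm_ge0 //; last first.
  by rewrite mulr_ge0 // exprn_ge0 //; lra.
apply: le_trans H _.
have -> : (8 / dl ^+ 2) ^+ n = B ^+ n * ((2 + r) ^+ (n * (2 * K).+1)) ^+ 2.
  have -> : 8 / dl ^+ 2 = B * ((2 + r) ^+ (2 * K).+1) ^+ 2.
    by rewrite /dl BE; field; rewrite gt_eqF.
  by rewrite exprMn -!exprM mulnAC (mulnC _ n).
rewrite exprMn mulrAC; apply: ler_wpM2r; first exact: sqr_ge0.
have : B ^+ n * M <= A by rewrite /A lerDl.
move/le_trans; apply; rewrite expr2 ler_peMr //.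
Qed.

End DomGeometry.

(** * Polynomials of high degree are not square-integrable *)

Section HomogeneousParts.
Variables (R : realType) (n : nat).
Local Notation C := R[i].
Local Notation V := ('I_n -> C).
Implicit Types (z w : V) (g : V -> C) (k : 'I_n) (s : seq (C * ('I_n -> nat))).

Lemma monomial_dilate (p : 'I_n -> nat) (c : C) z :
  monomial p (dilate c z) = c ^+ mi_size p * monomial p z.
Proof.
rewrite /monomial /dilate /mi_size -prodrXr -big_split /=.
by apply: eq_bigr => k _; rewrite exprMn.
Qed.

Definition homog_part s (d : nat) z := \sum_(q <- s | mi_size q.2 == d) q.1 * monomial q.2 z.

Lemma is_poly_homog_part s d : is_poly (homog_part s d).
Proof. by exists [seq q <- s | mi_size q.2 == d] => z; rewrite big_filter. Qed.

Lemma mi_size_bounded s : exists B : nat, forall q, q \in s -> (mi_size q.2 < B)%N.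
Proof.
exists (\max_(q <- s) mi_size q.2).+1 => q qs; rewrite ltnS.
by rewrite (big_rem q) //= leq_maxl.
Qed.

Lemma homog_part_decomp s (B : nat) (c : C) z : (forall q, q \in s -> mi_size q.2 < B)%N ->
  \sum_(q <- s) q.1 * monomial q.2 (dilate c z) = \sum_(d < B) c ^+ d * homog_part s d z.
Proof.
move=> sB; under [RHS]eq_bigr do rewrite /homog_part big_mkcond mulr_sumr.
rewrite exchange_big /= [LHS]big_seq [RHS]big_seq; apply: eq_bigr => q qs.
rewrite (bigD1 (Ordinal (sB q qs))) //= eqxx big1 ?addr0 => [|d ne].
  by rewrite monomial_dilate mulrCA.
case: ifP => [/eqP h|]; last by rewrite mulr0.
by case/eqP: ne; apply: val_inj.
Qed.

(* A neighbourhood of [1 + i] in the circle through [1 + i]. *)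
Definition in_arc (u : C) := [&& nm u ^+ 2 == 2, 1 / 2 < cRe u & 1 / 2 < cIm u].

(** This supplies the axis of the cone for a nonzero leading part. Equal moduli put the axis on a
    polytorus, and real and imaginary parts above 1/2 make the circle a graph with bounded slope
    there. *)
Lemma arc_identity g : (forall z k, entire (fun u => g (upd z k u))) ->
  (forall z, (forall k, in_arc (z k)) -> g z = 0) -> forall z, g z = 0.
Proof.
move=> eg g0; suff claim (j : nat) : forall z, (forall k, (j <= k)%N -> in_arc (z k)) -> g z = 0.
  by move=> z; apply: (claim n) => k nk; move: (ltn_ord k); rewrite ltnNge nk.
elim: j => [|j IH] z H; first by apply: g0 => k; exact: H.
have [jn|jn] := ltnP j n; last first.
  by apply: IH => k jk; move: (leq_ltn_trans jk (ltn_ord k)); rewrite ltnNge jn.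
pose k := Ordinal jn; pose h u := g (upd z k u).
have h0 u : in_arc u -> h u = 0.
  move=> hu; apply: IH => i ji; rewrite /upd; have [//|ik] := eqVneq i k.
  apply: H; rewrite ltn_neqAle ji andbT.
  by apply: contraNneq ik => ji'; apply/eqP/val_inj.
pose u0 : C := 1 +i* 1.
have nu0 : nm u0 ^+ 2 = 2 by rewrite nm_sqr /= expr1n -mulr2n.
have -> : g z = h (u0 + (z k - u0)) by rewrite /h [u0 + _]addrC subrK upd_id.
apply: path_identity => [t _|].
  by exists 1 => // u _; exact: eg.
apply: circle_accum; first by rewrite -nm_eq0 -sqrf_eq0 nu0 pnatr_eq0.
exists (1 / 2) => [|u hu du]; first by rewrite divr_gt0.
apply: h0; rewrite /in_arc hu nu0 eqxx /=.
have hR := le_lt_trans (nm_Re (u - u0)) du; have hI := le_lt_trans (nm_Im (u - u0)) du.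
case: u hR hI {hu du} => x y /=; rewrite !ltr_norml => hR hI.
by apply/andP; split; lra.
Qed.

Lemma is_poly_cvg g z : is_poly g -> forall e : R, 0 < e -> exists2 d : R, 0 < d &
  forall w, \sum_(k < n) nm (w k - z k) < d -> nm (g w - g z) < e.
Proof.
move=> pg e e0.
have [d d0 hd] := is_O_cvg (frechet_O (is_poly_holomorphic (D := setT) pg (z := z) I)) e0.
exists d => // w hw; have := hd (fun k => w k - z k) hw.
by rewrite (_ : (fun k => z k + (w k - z k)) = w) //; apply/funext => k; rewrite addrC subrK.
Qed.

(** Near [xi] the part of degree [d] contributes at least [t^d m / 2], and the lower ones at most
    [S t^(d-1)], which is at most [t^d m / 4] once [t >= 4 S / m]. *)
Lemma leading_lower_bound s (d : nat) (xi : V) : homog_part s d xi != 0 ->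
  (forall e z, (d < e)%N -> homog_part s e z = 0) ->
  exists c t0 e0 : R, [/\ 0 < c, 1 <= t0, 0 < e0 &
    forall (t : R) z, t0 <= t -> \sum_(k < n) nm (z k - xi k) < e0 ->
      c * t ^+ d <= nm (\sum_(q <- s) q.1 * monomial q.2 (dilate t%:C z))].
Proof.
move=> Hd Hhigh; set m := nm (homog_part s d xi).
have m0 : 0 < m by rewrite nm_gt0.
have [B sB] := mi_size_bounded s.
have [e1 e10 h1] : exists2 e1 : R, 0 < e1 & forall z, \sum_(k < n) nm (z k - xi k) < e1 ->
    m / 2 <= nm (homog_part s d z).
  have m20 : 0 < m / 2 by rewrite divr_gt0.
  have [e1 e10 h1] := is_poly_cvg xi (is_poly_homog_part s d) m20.
  exists e1 => // z /h1; have := nm_lerB (homog_part s d xi) (homog_part s d z).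
  by rewrite nmB -/m; lra.
have [e2 e20 h2] : exists2 e2 : R, 0 < e2 & forall e : 'I_d, forall z,
    \sum_(k < n) nm (z k - xi k) < e2 -> nm (homog_part s e z) <= nm (homog_part s e xi) + 1.
  apply: fin_radius => [k r r' rr H z hz|e]; first by apply: H; exact: lt_le_trans hz rr.
  have [r r0 H] := is_poly_cvg xi (is_poly_homog_part s e) ltr01; exists r => // z /H hz.
  by have := nmD (homog_part s e z - homog_part s e xi) (homog_part s e xi); rewrite subrK; lra.
pose S : R := \sum_(e < d) (nm (homog_part s e xi) + 1).
have S0 : 0 <= S by apply: sumr_ge0 => e _; rewrite addr_ge0 ?nm_ge0.
exists (m / 4), (1 + 4 * S / m), (Num.min e1 e2).
have q0 : 0 <= 4 * S / m by rewrite divr_ge0 ?mulr_ge0 // ltW.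
split; [by rewrite divr_gt0|lra|by rewrite lt_min e10|].
move=> t z ht; rewrite lt_min => /andP[z1 z2].
have t1 : 1 <= t by lra.
have t0 : 0 < t by lra.
have nt : nm (t%:C : C) = t by rewrite nm_real gtr0_norm.
have St : 4 * S <= m * t.
  by have : 4 * S / m <= t by [lra]; rewrite ler_pdivrMr // (mulrC t).
have low : nm (\sum_(e < d) t%:C ^+ e * homog_part s e z) <= t ^+ d * (m / 4).
  apply: le_trans (nm_sum _ _ _) _.
  apply: (@le_trans _ _ (\sum_(e < d) t ^+ d / t * (nm (homog_part s e xi) + 1))).
    apply: ler_sum => e _; rewrite nmM nmX nt; apply: ler_pM; rewrite ?exprn_ge0 ?nm_ge0 ?(ltW t0) //.
      rewrite ler_pdivlMr // -exprSr; apply: ler_weXn2l => //; exact: ltn_ord.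
    exact: h2.
  rewrite -mulr_sumr -/S -mulrA; apply: ler_wpM2l; first by rewrite exprn_ge0 // ltW.
  rewrite mulrC ler_pdivrMr //; lra.
pose B' := maxn B d.+1.
have sB' q : q \in s -> (mi_size q.2 < B')%N by move=> /sB h; rewrite leq_max h.
have dB' : (d < B')%N by rewrite leq_max ltnSn orbT.
have split_sum : \sum_(e < B') t%:C ^+ e * homog_part s e z =
    \sum_(e < d) t%:C ^+ e * homog_part s e z + t%:C ^+ d * homog_part s d z.
  rewrite -!(big_mkord xpredT (fun e => t%:C ^+ e * homog_part s e z)).
  rewrite (big_cat_nat (n := d.+1)) //= [X in _ + X]big1_seq ?addr0; last first.
    by move=> e /andP[_]; rewrite mem_index_iota => /andP[de _]; rewrite Hhigh ?mulr0.
  by rewrite big_nat_recr.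
rewrite (homog_part_decomp _ _ sB') split_sum [X in nm X]addrC.
have := nm_lerB (t%:C ^+ d * homog_part s d z) (- \sum_(e < d) t%:C ^+ e * homog_part s e z).
rewrite nmN opprK nmM nmX nt => h3.
have h4 : t ^+ d * (m / 2) <= t ^+ d * nm (homog_part s d z).
  by apply: ler_wpM2l; [rewrite exprn_ge0 // ltW|exact: h1].
move: low h3 h4; set X := nm (_ + _); set Y := nm (\sum_(e < d) _).
set Z := t ^+ d * nm _; set T := t ^+ d; lra.
Qed.

End HomogeneousParts.

(** * Lower bounds for iterated integrals *)

Section LowerIntegral.
Variable R : realType.
Local Notation mu := (@lebesgue_measure R).
Implicit Types (v : nat -> R) (G : (nat -> R) -> \bar R) (m j : nat) (s t : R).

Lemma iter_int_box_lb m G (A : nat -> R -> R -> bool) (c al : R) : 0 <= c -> 0 < al ->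
  (forall v, 0 <= G v)%E ->
  (forall j, (j < m)%N -> (al%:E <= \int[mu]_s \int[mu]_t ((A j s t)%:R)%:E)%E) ->
  (forall v, (forall j, (j < m)%N -> A j (v (2 * j)%N) (v (2 * j).+1)) -> (c%:E <= G v)%E) ->
  ((c * al ^+ m)%:E <= iter_int (2 * m) G)%E.
Proof.
move=> c0 al0; elim: m G A => [|m IH] G A G0 hA hG.
  by rewrite expr0 mulr1; exact: hG.
have [->|cn] := eqVneq c 0; first by rewrite mul0r; exact: iter_int_ge0.
have {}c0 : 0 < c by rewrite lt0r cn.
have cm : 0 < c * al ^+ m by rewrite mulr_gt0 // exprn_gt0.
rewrite iter_int2E exprS mulrCA mulrC EFinM.
apply: (@le_trans _ _ ((c * al ^+ m)%:E * \int[mu]_s \int[mu]_t ((A 0%N s t)%:R)%:E)%E).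
  by apply: lee_wpmul2l; [rewrite lee_fin ltW|exact: hA].
rewrite -ge0_integral_scale //; last by move=> s _; apply: integral_ge0 => t _; rewrite lee_fin.
apply: ge0_integral_mono => s _.
  by rewrite mule_ge0 ?lee_fin ?(ltW cm) //; apply: integral_ge0 => t _; rewrite lee_fin.
rewrite -ge0_integral_scale //.
apply: ge0_integral_mono => t _; first by rewrite -EFinM lee_fin mulr_ge0 // ltW.
case: (boolP (A 0%N s t)) => [hst|_]; last first.
  by rewrite mule0; apply: iter_int_ge0.
rewrite mule1; apply: (IH _ (fun j => A j.+1)) => //.
  by move=> j jm; exact: hA.
move=> v hv; apply: hG => -[|j] jm; first exact: hst.
by have := hv j jm; rewrite mulnS.
Qed.

Lemma integral_itv_cst (a b c : R) : a <= b ->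
  (\int[mu]_(x in `[a, b]) c%:E = (c * (b - a))%:E)%E.
Proof.
move=> ab; rewrite integral_cst //= lebesgue_measure_itv /= lte_fin EFinM; congr (_ * _)%E.
by case: ltgtP ab => [//|//|->]; rewrite ?subrr.
Qed.

Lemma integral_indic_itv (f : R -> bool) (a b : R) : a <= b ->
  (forall x, a <= x <= b -> f x) -> ((b - a)%:E <= \int[mu]_x ((f x)%:R)%:E)%E.
Proof.
move=> ab H; rewrite -[b - a]mul1r -integral_itv_cst //.
apply: ge0_integral_le_setT => x; rewrite ?lee_fin ?ler0n //.
by rewrite /= in_itv /= => /H ->.
Qed.

Lemma strip_area (p : R -> R) (a b tau : R) (A : R -> R -> bool) : a <= b -> 0 <= tau ->
  (forall x y, a <= x <= b -> p x <= y <= p x + tau -> A x y) ->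
  ((tau * (b - a))%:E <= \int[mu]_x \int[mu]_y ((A x y)%:R)%:E)%E.
Proof.
move=> ab tau0 H; rewrite -integral_itv_cst //.
have I0 x : (0 <= \int[mu]_y ((A x y)%:R)%:E)%E by apply: integral_ge0 => y _; rewrite lee_fin.
apply: ge0_integral_le_setT => [x|x _|x]; [exact: I0|by rewrite lee_fin|].
rewrite /= in_itv /= => hx.
have -> : tau = p x + tau - p x by rewrite addrAC subrr add0r.
by apply: integral_indic_itv => [|y]; [rewrite lerDl|exact: H].
Qed.

(** Divergence of the logarithmic integral: truncated at [s0 * exp(M / c)] it equals [M] exactly. *)
Lemma integral_inv_lb (s0 c M : R) : 0 < s0 -> 0 < c -> 0 < M ->
  (M%:E <= \int[mu]_(s in `[s0, +oo[) (c / s)%:E)%E.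
Proof.
move=> s00 c0 M0; pose b := s0 * expR (M / c).
have sb : s0 < b by rewrite ltr_pMr // expR_gt1 divr_gt0.
have b0 : 0 < b by exact: lt_trans sb.
have dln (x : R) : 0 < x -> is_derive (x : R^o) (1 : R^o) (c \*: (@ln R : R^o -> R^o)) (c / x).
  move=> x0; have dl := is_derive1_ln x0.
  exact: is_deriveZ.
have cln (x : R) : 0 < x -> {for x, continuous (fun y : R => c * ln y : R)}.
  by move=> x0; apply: cvgMl_tmp; exact: continuous_ln.
have -> : M%:E = (\int[mu]_(s in `[s0, b]) (c / s)%:E)%E.
  rewrite (@continuous_FTC2 _ (fun s => c / s) (fun y => c * ln y)) //.
  - rewrite -EFinD; congr EFin.
    by rewrite /b lnM ?posrE ?expR_gt0 // expRK; field; rewrite gt_eqF.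
  - apply: continuous_in_subspaceT => x; rewrite inE /= in_itv /= => /andP[h _].
    apply: cvgMl_tmp; apply: cvgV; last exact: cvg_id.
    by rewrite gt_eqF // (lt_le_trans s00).
  - split.
    + move=> x; rewrite in_itv /= => /andP[h _].
      by have [] := dln x (lt_trans s00 h).
    + exact/cvg_at_right_filter/cln.
    + exact/cvg_at_left_filter/cln.
  - move=> x; rewrite in_itv /= => /andP[h _]; rewrite derive1E.
    by have [_ ->] := dln x (lt_trans s00 h).
have pos x : s0 <= x -> (0 <= (c / x)%:E)%E.
  by move=> h; rewrite lee_fin divr_ge0 ?(ltW c0) // (le_trans (ltW s00)).
rewrite [leRHS]integral_mkcond; apply: ge0_integral_le_setT => x.
- by rewrite patchE; case: ifPn => //; rewrite inE /= in_itv /= andbT => /pos.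
- by rewrite /= in_itv /= => /andP[/pos].
- by rewrite /= in_itv /= => /andP[h _]; rewrite patchE mem_set //= in_itv /= h.
Qed.

End LowerIntegral.

(** * Divergence of the norm over an asymptotic cone *)

Section HighDegree.
Variable R : realType.
Local Notation C := R[i].
Local Notation mu := (@lebesgue_measure R).

Lemma sqr_near (eta x y Y : R) : 0 < eta -> eta <= 1 / 20 -> 1 / 2 < x -> 1 / 2 < y ->
  x ^+ 2 + y ^+ 2 = 2 -> y <= Y <= y + eta -> y ^+ 2 <= Y ^+ 2 <= y ^+ 2 + 4 * eta.
Proof.
move=> e0 e1 x0 y0 xy /andP[Y1 Y2].
have y2 : y <= 3 / 2 by nra.
by apply/andP; split; nra.
Qed.

Lemma arc_strip (eta x y r2 X : R) : 0 < eta -> eta <= 1 / 20 -> 1 / 2 < x -> 1 / 2 < y ->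
  x ^+ 2 + y ^+ 2 = 2 -> 2 <= r2 <= 2 + 4 * eta -> x <= X <= x + eta ->
  y ^+ 2 - 4 * eta <= r2 - X ^+ 2 <= y ^+ 2 + 4 * eta /\ 0 <= r2 - X ^+ 2.
Proof.
move=> e0 e1 x0 y0 xy /andP[r1 r3] hX.
have /andP[h1 h2] : x ^+ 2 <= X ^+ 2 <= x ^+ 2 + 4 * eta.
  by apply: (sqr_near e0 e1 y0 x0) => //; rewrite addrC.
have h3 : 1 / 4 < y ^+ 2 by nra.
by split; [apply/andP; split|]; lra.
Qed.

(** The strip estimate scaled to radius about 1: [P] is the height over [X] of the circle of squared
    radius [r2], and rising from it by at most [sg] adds at most [sg (2P + sg) <= 5 sg] to the
    squared modulus. *)
Lemma arc_strip_near (eta x y r2 X P Y sg : R) : 0 < eta -> eta <= 1 / 20 ->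
  1 / 2 < x -> 1 / 2 < y ->
  x ^+ 2 + y ^+ 2 = 2 -> 2 <= r2 <= 2 + 4 * eta -> x <= X <= x + eta ->
  0 <= P -> P ^+ 2 = r2 - X ^+ 2 -> P <= Y <= P + sg -> 0 <= sg -> sg <= eta ->
  [/\ 0 <= X ^+ 2 + Y ^+ 2 - r2, X ^+ 2 + Y ^+ 2 - r2 <= 5 * sg,
     `|X - x| <= eta & `|Y - y| <= 9 * eta].
Proof.
move=> e0 e1 x0 y0 xy hr hX P0 PE /andP[Y1 Y2] sg0 sg1.
have [/andP[q1 q2] q3] := arc_strip e0 e1 x0 y0 xy hr hX.
move: hr hX => /andP[r1 r3] /andP[X1 X2].
have P2 : P <= 2 by nra.
have d1 : P - y <= 8 * eta by nra.
have d2 : y - P <= 8 * eta by nra.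
split.
- nra.
- nra.
- by rewrite ler_norml; lra.
- by rewrite ler_norml; lra.
Qed.

Variables (m : nat) (a : R).
Hypothesis a0 : 0 < a.
Local Notation V := ('I_m.+1 -> C).

Lemma iter_int_integrand_ge0 (D : set V) (f : V -> C) v :
  (0 <= ((\1_D (cplx_of_reals (n:=m.+1) v) : R) * nm (f (cplx_of_reals (n:=m.+1) v)) ^+ 2)%:E)%E.
Proof. by rewrite lee_fin mulr_ge0 // ?indicE ?ler0n // sqr_ge0. Qed.

Section Slice.
Variables (xi : V) (c1 eta T s t : R).
Hypothesis xi_arc : forall k, in_arc (xi k).
Hypotheses (eta0 : 0 < eta) (eta1 : eta <= 1 / 20).
Hypothesis c1E : c1 = (10 `^ a)^-1 / 6.
Hypotheses (T_ge : eta^-1 <= T).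
Hypothesis sE : s = T * cRe (xi ord0).
Hypothesis t_in : T * cIm (xi ord0) <= t <= T * (cIm (xi ord0) + eta).

(** [P] is the order of the inverse width of D(a) at radius about [T]. In variable [k] the strip has
    height [tau] above the circle [|z_k| = |z_1|], near [T * xi k], so squared moduli exceed
    [|z_1|^2] by at most [5 T tau = 5 c1 / P]. As [|z_n|^2 + 1 <= 10 T^2], the choice of [c1] keeps
    this at 5/6 of a lower bound of the width. *)
Let P := T `^ (2 * a).
Let tau := c1 / (T * P).
Let r2 := (s ^+ 2 + t ^+ 2) / T ^+ 2.
Let p x := T * Num.sqrt (r2 - (x / T) ^+ 2).

Definition strip (z : C) x y :=
  (T * cRe z <= x <= T * (cRe z + eta)) && (p x <= y <= p x + tau).

Lemma in_arcP (z : C) : in_arc z -> [/\ 1 / 2 < cRe z, 1 / 2 < cIm z & cRe z ^+ 2 + cIm z ^+ 2 = 2].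
Proof. by move=> /and3P[/eqP h1 h2 h3]; split => //; rewrite -nm_sqr. Qed.

Lemma scale_ge1 : 1 <= T.
Proof.
apply: le_trans T_ge; rewrite -(invr1 R) lef_pV2 ?posrE //.
by apply: le_trans eta1 _; lra.
Qed.

Lemma ten_powR_ge1 : 1 <= 10 `^ a :> R.
Proof. by rewrite -[leLHS](powRr0 10) ler_powR ?(ltW a0) // ler1n. Qed.

Lemma gap_const_bounds : 0 < c1 /\ c1 <= 1 / 6.
Proof.
have h := ten_powR_ge1; have h0 : 0 < 10 `^ a :> R by exact: lt_le_trans h.
rewrite c1E; split; first by rewrite divr_gt0 // invr_gt0.
by rewrite ler_pM2r // invf_le1.
Qed.

Lemma scale_powR_ge1 : 1 <= P.
Proof. by rewrite -[leLHS](powRr0 T) ler_powR ?scale_ge1 // mulr_ge0 // ltW. Qed.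

Lemma strip_height_bounds : [/\ 0 < tau, tau / T <= eta & T * tau = c1 / P].
Proof.
have T1 := scale_ge1; have P1 := scale_powR_ge1; have [c0 c2] := gap_const_bounds.
have T0 : 0 < T by lra.
have P0 : 0 < P by lra.
have TP : 0 < T * P by rewrite mulr_gt0.
split; first by rewrite divr_gt0.
  have e : eta^-1 * eta = 1 by rewrite mulVf // gt_eqF.
  rewrite ler_pdivrMr // /tau ler_pdivrMr //.
  have h1 : 1 <= T * eta by rewrite -e ler_wpM2r ?(ltW eta0).
  have h2 : 1 <= T * P by nra.
  have -> : eta * T * (T * P) = (T * eta) * (T * P) by ring.
  nra.
by rewrite /tau; field; rewrite (gt_eqF T0) (gt_eqF P0).
Qed.

Lemma slice_radius_bounds : 2 <= r2 <= 2 + 4 * eta.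
Proof.
have T1 := scale_ge1; have T0 : 0 < T by lra.
have [x0 y0 xy] := in_arcP (xi_arc ord0).
pose Y := t / T.
have tE : t = T * Y by rewrite /Y mulrC divfK // gt_eqF.
have -> : r2 = cRe (xi ord0) ^+ 2 + Y ^+ 2.
  by rewrite /r2 sE tE; field; rewrite gt_eqF.
move: t_in; rewrite tE !ler_pM2l // => /andP[Y1 Y2].
have Y12 : cIm (xi ord0) <= Y <= cIm (xi ord0) + eta by rewrite Y1.
by have /andP[? ?] := sqr_near eta0 eta1 x0 y0 xy Y12; apply/andP; split; lra.
Qed.

Lemma strip_near (z : C) x y : in_arc z -> strip z x y ->
  [/\ 0 <= x ^+ 2 + y ^+ 2 - (s ^+ 2 + t ^+ 2),
      x ^+ 2 + y ^+ 2 - (s ^+ 2 + t ^+ 2) <= 5 * (T * tau) &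
      nm (T%:C^-1 * (x +i* y) - z) <= 10 * eta].
Proof.
move=> hz /andP[hx hy].
have T1 := scale_ge1; have T0 : 0 < T by lra.
have Tn : T != 0 by rewrite gt_eqF.
have [x0 y0 xy] := in_arcP hz; have [tau0 tau1 _] := strip_height_bounds.
pose X := x / T; pose Y := y / T; pose sg := tau / T.
pose Q := Num.sqrt (r2 - X ^+ 2).
have xE : x = T * X by rewrite /X mulrC divfK.
have yE : y = T * Y by rewrite /Y mulrC divfK.
have tE : tau = T * sg by rewrite /sg mulrC divfK.
have hX : cRe z <= X <= cRe z + eta by move: hx; rewrite xE !ler_pM2l.
have [_ q0] := arc_strip eta0 eta1 x0 y0 xy slice_radius_bounds hX.
have Q0 : 0 <= Q by exact: sqrtr_ge0.
have QE : Q ^+ 2 = r2 - X ^+ 2 by rewrite sqr_sqrtr.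
have hY : Q <= Y <= Q + sg.
  by move: hy; rewrite /p -/X -/Q yE tE -mulrDr !ler_pM2l.
have sg0 : 0 <= sg by rewrite divr_ge0 // ltW.
have [b1 b2 b3 b4] := arc_strip_near eta0 eta1 x0 y0 xy slice_radius_bounds hX Q0 QE hY sg0 tau1.
have rE : s ^+ 2 + t ^+ 2 = T ^+ 2 * r2 by rewrite /r2 mulrC divfK // expf_neq0.
have eE : x ^+ 2 + y ^+ 2 - (s ^+ 2 + t ^+ 2) = T ^+ 2 * (X ^+ 2 + Y ^+ 2 - r2).
  by rewrite rE xE yE; ring.
have T20 : 0 < T ^+ 2 by rewrite exprn_gt0.
split.
- by rewrite eE mulr_ge0 // ltW.
- rewrite eE tE; have -> : 5 * (T * (T * sg)) = T ^+ 2 * (5 * sg) by ring.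
  by rewrite ler_pM2l.
- apply: le_trans (nm_le_ReIm _) _.
  have -> : T%:C^-1 * (x +i* y) - z = (X - cRe z) +i* (Y - cIm z).
    rewrite -[T%:C^-1](rmorphV (real_complex R)) ?unitfE //; case: z {hz hx x0 y0 xy hX b3 b4} => u w.
    apply/eqP; rewrite eq_complex /= /X /Y !mul0r subr0 addr0.
    by apply/andP; split; apply/eqP; ring.
  rewrite /=; lra.
Qed.

Lemma first_near : nm (T%:C^-1 * (s +i* t) - xi ord0) <= 10 * eta.
Proof.
have T1 := scale_ge1; have T0 : 0 < T by lra.
have Tn : T != 0 by rewrite gt_eqF.
apply: le_trans (nm_le_ReIm _) _.
pose Y := t / T.
have tE : t = T * Y by rewrite /Y mulrC divfK.
move: t_in; rewrite tE !ler_pM2l // => hY.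
have -> : T%:C^-1 * (s +i* (T * Y)) - xi ord0 = 0 +i* (Y - cIm (xi ord0)).
  rewrite -[T%:C^-1](rmorphV (real_complex R)) ?unitfE // sE.
  case: (xi ord0) => u w; apply/eqP; rewrite eq_complex /= !mul0r subr0 addr0.
  by apply/andP; split; apply/eqP; field.
rewrite /= normr0 add0r ger0_norm; lra.
Qed.

(** All squared moduli lie in one interval of length [5 T tau] starting at [|z_1|^2]; so any two of
    them, in particular those of [z_k] and [z_n], are close enough. *)
Lemma slice_point (z : V) : z ord0 = s +i* t ->
  (forall k, k != ord0 -> strip (xi k) (cRe (z k)) (cIm (z k))) ->
  Dom m.+1 a z /\ forall k, nm (T%:C^-1 * z k - xi k) <= 10 * eta.
Proof.
move=> z0 hz; have T1 := scale_ge1; have T0 : 0 < T by lra.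
have P1 := scale_powR_ge1; have P0 : 0 < P by lra.
have [c0 c2] := gap_const_bounds; have [tau0 _ tauE] := strip_height_bounds.
have zE k : z k = cRe (z k) +i* cIm (z k) by case: (z k).
have near k : k != ord0 -> _ := fun h => strip_near (xi_arc k) (hz k h).
split; last first.
  move=> k; have [->|k0] := eqVneq k ord0; first by rewrite z0; exact: first_near.
  by rewrite zE; case: (near k k0).
pose rho := s ^+ 2 + t ^+ 2.
have mods k : rho <= nm (z k) ^+ 2 <= rho + 5 * (T * tau).
  have [->|k0] := eqVneq k ord0.
    by have Tt0 : 0 < T * tau by [rewrite mulr_gt0]; rewrite z0 nm_sqr /= -/rho; lra.
  by have [] := near k k0; rewrite nm_sqr -/rho; lra.
have rho3 : rho <= 3 * T ^+ 2.
  have /andP[_ h] := slice_radius_bounds; move: h; rewrite /r2 -/rho ler_pdivrMr ?exprn_gt0 // => h.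
  by apply: le_trans h _; rewrite ler_pM2r ?exprn_gt0 //; have := eta1; lra.
have rho0 : 0 <= rho by rewrite addr_ge0 ?sqr_ge0.
have Ttau : 5 * (T * tau) <= 5 / 6 * (10 `^ a * P)^-1.
  by rewrite tauE c1E invfM; lra.
have Q1 : 1 <= 10 `^ a * P by have := ten_powR_ge1; nra.
have Q0 : 0 < 10 `^ a * P by lra.
have Qi : 0 < (10 `^ a * P)^-1 by rewrite invr_gt0.
have Qi1 : (10 `^ a * P)^-1 <= 1 by rewrite invf_le1.
apply/(@DomP R m.+1 a ord_max erefl) => k _.
have [/andP[k1 k2] /andP[l1 l2]] := (mods k, mods ord_max).
have low : (10 `^ a * P)^-1 <= dom_width a (nm (z ord_max) ^+ 2).
  rewrite /dom_width div1r lef_pV2 ?posrE ?powR_gt0 ?ltr_wpDl ?sqr_ge0 //.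
  have -> : 10 `^ a * P = (10 * T ^+ 2) `^ a.
    rewrite powRM ?exprn_ge0 ?(ltW T0) ?ler0n // -powR_mulrn ?(ltW T0) // -powRrM.
    by rewrite /P.
  have T21 : 1 <= T ^+ 2 by rewrite exprn_ege1.
  have p1 : 0 <= 10 * T ^+ 2 by lra.
  apply: ge0_ler_powR; rewrite ?nnegrE ?(ltW a0) ?p1 ?addr_ge0 ?sqr_ge0 //; lra.
apply: lt_le_trans low; apply: le_lt_trans (_ : _ <= 5 * (T * tau)) _; last lra.
by rewrite ler_norml; lra.
Qed.

Lemma strip_measure (z : C) :
  ((c1 * eta / P)%:E <= \int[mu]_x \int[mu]_y ((strip z x y)%:R)%:E)%E.
Proof.
have T1 := scale_ge1; have T0 : 0 < T by lra.
have [tau0 _ tauE] := strip_height_bounds.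
have -> : c1 * eta / P = tau * (T * (cRe z + eta) - T * cRe z).
  have -> : T * (cRe z + eta) - T * cRe z = T * eta by ring.
  by rewrite mulrA [tau * T]mulrC tauE mulrAC.
apply: (@strip_area _ p); [|exact: ltW|].
  by rewrite ler_pM2l // lerDl ltW.
by move=> x y hx hy; rewrite /strip hx hy.
Qed.

End Slice.

(** Take [d] maximal with a nonzero part, and [z_1] at scale [T]. The integrand is at least a
    multiple of [T^(2d)] on a slice of measure of order [T^(-2am)], the range of [t] has length
    [T eta], and what remains dominates a multiple of the integral of [1/s]. *)
Theorem high_degree_vanish (f : V -> C) (sq : seq (C * ('I_m.+1 -> nat))) :
  (forall z, Dom m.+1 a z -> f z = \sum_(q <- sq) q.1 * monomial q.2 z) ->
  (L2_norm2 (Dom m.+1 a) f < +oo)%E ->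
  forall d : nat, m%:R * a - 1 <= d%:R -> forall z, homog_part sq d z = 0.
Proof.
move=> fE hL d0 hd0 z0; apply: contrapT => Hz0.
have [B sB] := mi_size_bounded sq.
pose bad d := `[< m%:R * a - 1 <= d%:R /\ exists z, homog_part sq d z <> 0 >].
have exbad : exists d, bad d by exists d0; apply/asboolP; split => //; exists z0.
have badB d : bad d -> (d <= B)%N.
  move=> /asboolP[_ [z hz]]; rewrite leqNgt; apply/negP => Bd; apply: hz.
  rewrite /homog_part big1_seq // => q /andP[/eqP qd qs].
  by have := ltn_trans (sB q qs) Bd; rewrite qd ltnn.
case: (ex_maxnP exbad badB) => d /asboolP[hd [z1 hz1]] dmax.
have Hhigh e z : (d < e)%N -> homog_part sq e z = 0.
  move=> de; apply: contrapT => he; have /dmax : bad e; last by rewrite leqNgt de.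
  apply/asboolP; split; last by exists z.
  by apply: le_trans hd _; rewrite ler_nat ltnW.
have [xi xi_arc Hxi] : exists2 xi : V, (forall k, in_arc (xi k)) & homog_part sq d xi != 0.
  apply: contrapT => H; apply: hz1; apply: (@arc_identity _ _ (homog_part sq d)).
    by move=> z k u; apply: is_poly_upd; exact: is_poly_homog_part.
  move=> z hz; apply: contrapT => h; apply: H; exists z => //; exact/eqP.
have [c [t0 [e0 [c0 t01 e00 lead]]]] := leading_lower_bound Hxi Hhigh.
pose n1 : R := m.+1%:R.
have n10 : 0 < n1 by rewrite ltr0n.
(* Each of the [m.+1] coordinates stays within [10 * eta] of [xi], so the l1 distance is below [e0];
   the strip estimates ask for [1 / 20]. *)
pose eta := Num.min (1 / 20) (e0 / (20 * n1)).
have eta0 : 0 < eta by rewrite lt_min !divr_gt0 // mulr_gt0.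
have eta1 : eta <= 1 / 20 by rewrite ge_min lexx.
have eta2 : n1 * (10 * eta) < e0.
  have : eta <= e0 / (20 * n1) by rewrite ge_min lexx orbT.
  rewrite ler_pdivlMr ?mulr_gt0 //; nra.
pose c1 : R := (10 `^ a)^-1 / 6.
have [c10 _] := gap_const_bounds (erefl c1).
pose x0 := cRe (xi ord0); pose y0 := cIm (xi ord0).
have [x00 y00 _] := in_arcP (xi_arc ord0).
have x0p : 0 < x0 by rewrite /x0; lra.
pose T0 := Num.max t0 eta^-1.
have T0e : eta^-1 <= T0 by rewrite le_max lexx orbT.
have T0t : t0 <= T0 by rewrite le_max lexx.
pose s0 := x0 * T0.
have s00 : 0 < s0 by rewrite mulr_gt0 //; lra.
pose G (v : nat -> R) : \bar R := ((\1_(Dom m.+1 a) (cplx_of_reals (n:=m.+1) v) : R)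
   * nm (f (cplx_of_reals (n:=m.+1) v)) ^+ 2)%:E.
have G0 v : (0 <= G v)%E by exact: iter_int_integrand_ge0.
pose kap := c ^+ 2 * (c1 * eta) ^+ m.
have kap0 : 0 < kap by rewrite mulr_gt0 ?exprn_gt0 // mulr_gt0.
have slice s t : s0 <= s -> s / x0 * y0 <= t <= s / x0 * (y0 + eta) ->
    ((kap / (s / x0) ^+ 2)%:E <= iter_int (2 * m) (fun v => G (cons2 s t v)))%E.
  move=> hs ht; set T := s / x0 in ht *.
  have TT : T0 <= T by rewrite ler_pdivlMr // mulrC.
  have Te : eta^-1 <= T by exact: le_trans TT.
  have T1 := scale_ge1 eta0 eta1 Te; have Tp : 0 < T by lra.
  have sE : s = T * cRe (xi ord0) by rewrite divfK // gt_eqF.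
  clearbody T.
  have P1 := scale_powR_ge1 eta0 eta1 Te; have Pp : 0 < T `^ (2 * a) by lra.
  have lowG v : (forall j, (j < m)%N ->
      strip c1 eta T s t (xi (inord j.+1)) (v (2 * j)%N) (v (2 * j).+1)) ->
      (((c * T ^+ d) ^+ 2)%:E <= G (cons2 s t v))%E.
    move=> hv; set z := cplx_of_reals (n := m.+1) (cons2 s t v).
    have z00 : z ord0 = s +i* t by [].
    have zk k : k != ord0 -> strip c1 eta T s t (xi k) (cRe (z k)) (cIm (z k)).
      move=> k0; have kp : (0 < k)%N by rewrite lt0n; apply: contraNneq k0 => k0; apply/eqP/val_inj.
      have jm : (k.-1 < m)%N by rewrite -ltnS prednK // ltn_ord.
      have := hv k.-1 jm; rewrite prednK //.
      have -> : inord k = k by apply: val_inj; rewrite /= inordK.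
      have kE : (2 * k = (2 * k.-1).+2)%N by rewrite -[in LHS](prednK kp) mulnS.
      by rewrite /z /cplx_of_reals /= kE.
    have [Dz near] := slice_point xi_arc eta0 eta1 (erefl c1) Te sE ht z00 zk.
    rewrite /G -/z indicE mem_set // mul1r lee_fin fE //.
    apply: lerXn2r; rewrite ?nnegrE ?nm_ge0 ?mulr_ge0 ?exprn_ge0 ?(ltW c0) ?(ltW Tp) //.
    have -> : z = dilate T%:C (dilate T%:C^-1 z).
      rewrite dilateA divff; first by apply/funext => k; rewrite /dilate mul1r.
      by rewrite -nm_eq0 nm_real normr_eq0 gt_eqF.
    apply: lead; first exact: le_trans TT.
    apply: (@le_lt_trans _ _ (\sum_(k < m.+1) 10 * eta)).
      by apply: ler_sum => k _; exact: near.
    by move: eta2; rewrite /n1 mulr_natl sumr_const card_ord.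
  have area j : (j < m)%N -> ((c1 * eta / T `^ (2 * a))%:E <= \int[mu]_x \int[mu]_y
      ((strip c1 eta T s t (xi (inord j.+1)) x y)%:R)%:E)%E.
    by move=> _; exact: (strip_measure s t eta0 eta1 (erefl c1) Te).
  have al0 : 0 < c1 * eta / T `^ (2 * a) by rewrite divr_gt0 // mulr_gt0.
  have cT0 : 0 <= (c * T ^+ d) ^+ 2 by exact: sqr_ge0.
  apply: le_trans (iter_int_box_lb cT0 al0 (fun v => G0 (cons2 s t v)) area lowG).
  rewrite lee_fin expr_div_n /kap (exprMn 2 c (T ^+ d)).
  (* The degree condition enters here, as [2 a m <= 2 d + 2]. *)
  have hP : (T `^ (2 * a)) ^+ m <= T ^+ (2 * d + 2).
    rewrite -!powR_mulrn ?(ltW Tp) ?powR_ge0 // -powRrM; apply: ler_powR => //.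
    rewrite natrD natrM; lra.
  have Pm : 0 < (T `^ (2 * a)) ^+ m by rewrite exprn_gt0.
  rewrite ler_pdivrMr ?exprn_gt0 //.
  set K := (c1 * eta) ^+ m; set PP := (T `^ (2 * a)) ^+ m in hP Pm *.
  have K0 : 0 < K by rewrite exprn_gt0 // mulr_gt0.
  have -> : c ^+ 2 * (T ^+ d) ^+ 2 * (K / PP) * T ^+ 2 = c ^+ 2 * K * (T ^+ (2 * d + 2) / PP).
    by rewrite exprD mulnC exprM; ring.
  have cK : 0 < c ^+ 2 * K by rewrite mulr_gt0 // exprn_gt0.
  by rewrite ler_pMr // ler_pdivlMr // mul1r.
have LE : L2_norm2 (Dom m.+1 a) f =
    (\int[mu]_s \int[mu]_t iter_int (2 * m) (fun v => G (cons2 s t v)))%E.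
  by rewrite /L2_norm2 iter_int2E.
have I0 s t : (0 <= iter_int (2 * m) (fun v => G (cons2 s t v)))%E.
  by apply: iter_int_ge0 => v.
have J0 s : (0 <= \int[mu]_t iter_int (2 * m) (fun v => G (cons2 s t v)))%E.
  by apply: integral_ge0.
(* The range of [t] has length [(s / x0) * eta], which turns the bound in [1/s^2] into one in
   [1/s]. *)
have inner s : s0 <= s -> ((kap * eta * x0 / s)%:E <=
    \int[mu]_t iter_int (2 * m) (fun v => G (cons2 s t v)))%E.
  move=> hs; have sp : 0 < s by exact: lt_le_trans hs.
  have Tp : 0 < s / x0 by rewrite divr_gt0.
  have -> : kap * eta * x0 / s =
      kap / (s / x0) ^+ 2 * (s / x0 * (y0 + eta) - s / x0 * y0).
    by field; rewrite (gt_eqF sp) (gt_eqF x0p).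
  have kT : 0 <= kap / (s / x0) ^+ 2 by rewrite divr_ge0 ?exprn_ge0 ?(ltW kap0) ?(ltW Tp).
  rewrite -integral_itv_cst; last by rewrite ler_pM2l // lerDl ltW.
  apply: ge0_integral_le_setT => [//|t _|t]; first by rewrite lee_fin.
  by rewrite /= in_itv /=; exact: slice.
have k0 : 0 < kap * eta * x0 by apply: mulr_gt0 => //; exact: mulr_gt0.
have LB M : 0 < M -> (M%:E <= L2_norm2 (Dom m.+1 a) f)%E.
  move=> M0; rewrite LE; apply: le_trans (integral_inv_lb s00 k0 M0) _.
  apply: ge0_integral_le_setT => [//|s|s]; rewrite /= in_itv /= andbT => hs; last exact: inner.
  by rewrite lee_fin divr_ge0 ?(ltW k0) // (le_trans (ltW s00)).
have L0 : (0 <= L2_norm2 (Dom m.+1 a) f)%E by apply: le_trans (LB 1 ltr01); rewrite lee_fin.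
have f0 : 0 <= fine (L2_norm2 (Dom m.+1 a) f) by exact: fine_ge0.
have := LB (fine (L2_norm2 (Dom m.+1 a) f) + 1) (ltr_wpDl f0 ltr01).
rewrite -[X in (_ <= X)%E]fineK ?ge0_fin_numE // lee_fin.
by rewrite leNgt ltrDl ltr01.
Qed.

End HighDegree.

(** * Polynomials of low degree are square-integrable *)

Section UpperIntegral.
Variable R : realType.
Local Notation mu := (@lebesgue_measure R).
Implicit Types (v : nat -> R) (G : (nat -> R) -> \bar R) (m j : nat) (s t x y : R).

Lemma iter_int0 m : iter_int m (fun=> 0%E) = 0%E :> \bar R.
Proof. by elim: m => //= m IH; apply: integral0_eq => x _. Qed.

Lemma iter_int_box_ub m G (A : nat -> R -> R -> bool) (c al : R) : 0 < c -> 0 < al ->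
  (forall v, 0 <= G v)%E -> (forall v, G v <= c%:E)%E ->
  (forall j, (j < m)%N -> (\int[mu]_s \int[mu]_t ((A j s t)%:R)%:E <= al%:E)%E) ->
  (forall v j, (j < m)%N -> ~~ A j (v (2 * j)%N) (v (2 * j).+1) -> G v = 0%E) ->
  (iter_int (2 * m) G <= (c * al ^+ m)%:E)%E.
Proof.
move=> c0 al0; elim: m G A => [|m IH] G A G0 Gc hA hG.
  by rewrite expr0 mulr1; exact: Gc.
have cm : 0 < c * al ^+ m by rewrite mulr_gt0 // exprn_gt0.
rewrite iter_int2E exprS mulrCA mulrC EFinM.
apply: (@le_trans _ _ ((c * al ^+ m)%:E * \int[mu]_s \int[mu]_t ((A 0%N s t)%:R)%:E)%E); last first.
  by apply: lee_wpmul2l; [rewrite lee_fin ltW|exact: hA].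
rewrite -ge0_integral_scale //; last by move=> s _; apply: integral_ge0 => t _; rewrite lee_fin.
apply: ge0_integral_mono => s _.
  by apply: integral_ge0 => t _; exact: iter_int_ge0.
rewrite -ge0_integral_scale //.
apply: ge0_integral_mono => t _; first exact: iter_int_ge0.
case: (boolP (A 0%N s t)) => [hst|hst].
  rewrite mule1; apply: (IH _ (fun j => A j.+1)) => //.
    by move=> j jm; exact: hA.
  by move=> v j jm hv; apply: (hG _ j.+1) => //; rewrite mulnS.
rewrite mule0.
have -> : (fun v => G (cons2 s t v)) = (fun=> 0%E).
  by apply/funext => v; apply: (hG _ 0%N).
by rewrite iter_int0.
Qed.

Lemma open_box_open (U : set (R * R)) : open U -> box_open U.
Proof.
rewrite openE => oU p /oU/nbhs_ballP[e e0 He]; exists e => // q h1 h2.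
by apply: He; split => /=; rewrite /ball /= distrC.
Qed.

Lemma box_open_lt (F : R * R -> R) (c : R) : continuous F -> box_open [set p | F p < c]%classic.
Proof.
move=> cF; apply: open_box_open.
by apply: (@open_comp _ _ F [set u | u < c]%classic) => [p _|]; [exact: cF|exact: open_lt].
Qed.

Lemma box_openI (U U' : set (R * R)) : box_open U -> box_open U' -> box_open (U `&` U')%classic.
Proof.
move=> oU oU' p [/oU[e e0 H] /oU'[e' e0' H']].
exists (Num.min e e') => [|q]; first by rewrite lt_min e0.
by rewrite !lt_min => /andP[q1 q2] /andP[q3 q4]; split; [exact: H|exact: H'].
Qed.

Lemma box_open_indic (A : R * R -> bool) (c : R) : box_open [set p | A p]%classic ->
  box_open [set p | c < (A p)%:R]%classic.
Proof.
move=> oA p /=; have [c0|c0] := ltP c 0.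
  by move=> _; exists 1 => // q _ _ /=; exact: lt_le_trans c0 _.
case Ap: (A p) => /= hc; last by move: (le_lt_trans c0 hc); rewrite ltxx.
by have [e e0 He] := oA p Ap; exists e => // q h1 h2; rewrite /= (He q h1 h2).
Qed.

(** Unlike monotonicity, additivity of the integral rests on measurability, which openness
    provides. *)
Lemma box_open_integralU (A B : R * R -> bool) :
  box_open [set p | A p]%classic -> box_open [set p | B p]%classic ->
  (\int[mu]_x \int[mu]_y ((A (x, y) || B (x, y))%:R)%:E <=
   \int[mu]_x \int[mu]_y ((A (x, y))%:R)%:E + \int[mu]_x \int[mu]_y ((B (x, y))%:R)%:E)%E.
Proof.
move=> oA oB.
have mf (D : R * R -> bool) : box_open [set p | D p]%classic ->
    measurable_fun setT (fun p : measurableTypeR R * measurableTypeR R => ((D p)%:R : R)%:E).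
  move=> oD; apply/measurable_EFinP; apply: (lsc_measurable (f := fun p => (D p)%:R)) => c.
  exact: box_open_indic.
have mF (D : R * R -> bool) : box_open [set p | D p]%classic ->
    measurable_fun setT (fun x => \int[mu]_y ((D (x, y))%:R)%:E)%E.
  move=> oD; apply: (@measurable_fun_fubini_tonelli_F _ _ _ _ R mu _ (mf D oD)).
  by move=> p; rewrite lee_fin.
have pos (D : R * R -> bool) x : (0 <= \int[mu]_y ((D (x, y))%:R)%:E)%E.
  by apply: integral_ge0 => y _; rewrite lee_fin.
rewrite -ge0_integralD //; [|exact: mF..].
apply: ge0_integral_mono => x _.
  by apply: integral_ge0 => y _; rewrite lee_fin.
rewrite -ge0_integralD //.
- apply: ge0_integral_mono => y _; first by rewrite lee_fin.
  by rewrite -EFinD lee_fin; case: (A _); case: (B _); rewrite /= ?addr0 ?add0r ?lerDl.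
- exact: (measurable_fun_pair2 x (mf A oA)).
- exact: (measurable_fun_pair2 x (mf B oB)).
Qed.

(** On the slice [P - 2 eps < y^2 < P], so [y] lies in one of two intervals of length [q - lo <=
    (q^2 - lo^2) / q <= 2 eps / rho]. *)
Lemma annulus_slice (A : R -> bool) s (eps rho x : R) : 0 < eps -> 0 < rho ->
  rho ^+ 2 = (s + eps) / 2 -> 2 * x ^+ 2 < s + eps ->
  (forall y, A y -> `|x ^+ 2 + y ^+ 2 - s| < eps) ->
  (\int[mu]_y ((A y)%:R)%:E <= (4 * eps / rho)%:E)%E.
Proof.
move=> e0 r0 rE hx hA.
(* If [P < 2 * eps] then [lo] is 0, the value of [Num.sqrt] at negative numbers, and the length
   bound still holds. *)
pose P := s + eps - x ^+ 2; pose q := Num.sqrt P; pose lo := Num.sqrt (P - 2 * eps).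
have P1 : rho ^+ 2 <= P by rewrite rE /P; lra.
have P0 : 0 <= P by apply: le_trans P1; exact: sqr_ge0.
have qE : q ^+ 2 = P by rewrite sqr_sqrtr.
have q0 : 0 <= q by exact: sqrtr_ge0.
have lo0 : 0 <= lo by exact: sqrtr_ge0.
have qr : rho <= q by rewrite -(ler_pXn2r (n := 2)) ?nnegrE ?(ltW r0) // qE.
have loq : lo <= q by apply: ler_wsqrtr; lra.
have diff : q - lo <= 2 * eps / rho.
  rewrite ler_pdivlMr //; apply: (@le_trans _ _ ((q - lo) * (q + lo))).
    by apply: ler_wpM2l; lra.
  rewrite -subr_sqr qE; have [h|h] := leP 0 (P - 2 * eps).
    by rewrite /lo sqr_sqrtr //; lra.
  rewrite /lo ler0_sqrtr ?(ltW h) //; lra.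
have inA y : A y -> (`[lo, q] `|` `[- q, - lo])%classic y.
  move=> /hA; rewrite ltr_norml => /andP[h1 h2] /=; rewrite !in_itv /=.
  have y2 : P - 2 * eps <= y ^+ 2 by rewrite /P; lra.
  have y3 : y ^+ 2 <= P by rewrite /P; lra.
  have ay1 : `|y| <= q by rewrite -sqrtr_sqr ler_wsqrtr.
  have ay2 : lo <= `|y| by rewrite -sqrtr_sqr ler_wsqrtr.
  have [y0|y0] := leP 0 y.
    by left; rewrite ger0_norm // in ay1 ay2; rewrite ay1 ay2.
  by right; rewrite ltr0_norm // in ay1 ay2; rewrite lerNl ay1 lerNr ay2.
have mI (u w : R) : measurable (`[u, w]%classic : set (measurableTypeR R)) by exact: measurable_itv.
apply: (@le_trans _ _ (\int[mu]_y (\1_(`[lo, q] `|` `[- q, - lo]) y)%:E)%E).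
  apply: ge0_integral_mono => y _; rewrite lee_fin // indicE.
  by case Ay: (A y) => //; rewrite mem_set //; exact: inA.
rewrite integral_indic ?setIT //; last exact: measurableU.
apply: le_trans (measureU2 _ _ _) _ => //.
have len (u w : R) : u <= w -> (mu `[u, w]%classic = (w - u)%:E)%E.
  by move=> uw; have := integral_itv_cst 1 uw; rewrite integral_cst //= !mul1e mul1r.
rewrite [X in (X + _)%E]len // [X in (_ + X)%E]len; last by rewrite lerN2.
by rewrite -EFinD lee_fin; lra.
Qed.

(* The slice over [x] has length O(eps / rho), and [x] ranges over an interval of length
   2 rho; the other half of the annulus is obtained by exchanging [x] and [y]. *)
Lemma annulus_half (A : R -> R -> bool) s (eps : R) : 0 < eps -> 0 <= s ->
  (forall x y, A x y -> `|x ^+ 2 + y ^+ 2 - s| < eps /\ 2 * x ^+ 2 < s + eps) ->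
  (\int[mu]_x \int[mu]_y ((A x y)%:R)%:E <= (8 * eps)%:E)%E.
Proof.
move=> e0 s0 hA; pose rho := Num.sqrt ((s + eps) / 2).
have h0 : 0 < (s + eps) / 2 by lra.
have r0 : 0 < rho by rewrite sqrtr_gt0.
have rE : rho ^+ 2 = (s + eps) / 2 by rewrite sqr_sqrtr // ltW.
have -> : 8 * eps = 4 * eps / rho * (rho - - rho) by field; rewrite gt_eqF.
rewrite -integral_itv_cst; last lra.
rewrite [leRHS]integral_mkcond; apply: ge0_integral_mono => x _.
  by apply: integral_ge0 => y _; rewrite lee_fin.
rewrite patchE; have [hx|hx] := ltP (2 * x ^+ 2) (s + eps).
  have xr : `|x| <= rho by rewrite -sqrtr_sqr ler_wsqrtr //; lra.
  rewrite mem_set; last by rewrite /= in_itv /= -ler_norml.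
  by apply: (annulus_slice e0 r0 rE hx) => y /hA[].
rewrite integral0_eq => [|y _].
  by case: ifP => // _; rewrite lee_fin divr_ge0 ?(ltW r0) // mulr_ge0 // ltW.
by case Axy: (A x y) => //; have [_] := hA _ _ Axy; rewrite ltNge hx.
Qed.

Lemma annulus_area s (eps : R) : 0 < eps -> 0 <= s ->
  (\int[mu]_x \int[mu]_y ((`|x ^+ 2 + y ^+ 2 - s| < eps)%R%:R)%:E <= (16 * eps)%:E)%E.
Proof.
move=> e0 s0.
pose N (p : R * R) := `|p.1 ^+ 2 + p.2 ^+ 2 - s| < eps.
pose A p := N p && (2 * p.1 ^+ 2 < s + eps).
pose B p := N p && (2 * p.2 ^+ 2 < s + eps).
have c1 : continuous (fun p : R * R => p.1 ^+ 2).
  by move=> p; apply: (@cvg_comp _ _ _ fst (fun u : R => u ^+ 2)); [exact: cvg_fst|exact: exprn_continuous].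
have c2 : continuous (fun p : R * R => p.2 ^+ 2).
  by move=> p; apply: (@cvg_comp _ _ _ snd (fun u : R => u ^+ 2)); [exact: cvg_snd|exact: exprn_continuous].
have oN : box_open [set p | N p]%classic.
  apply: box_open_lt => p; apply: cvg_norm; apply: cvgB; last exact: cvg_cst.
  by apply: cvgD; [exact: c1|exact: c2].
have oA : box_open [set p | A p]%classic.
  have -> : [set p | A p]%classic = ([set p | N p] `&` [set p | (2 * p.1 ^+ 2 < s + eps)%R])%classic.
    by apply/seteqP; split => p /= => [/andP|[h1 h2]] //; apply/andP.
  by apply: box_openI => //; apply: box_open_lt => p; apply: cvgMl_tmp; exact: c1.
have oB : box_open [set p | B p]%classic.
  have -> : [set p | B p]%classic = ([set p | N p] `&` [set p | (2 * p.2 ^+ 2 < s + eps)%R])%classic.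
    by apply/seteqP; split => p /= => [/andP|[h1 h2]] //; apply/andP.
  by apply: box_openI => //; apply: box_open_lt => p; apply: cvgMl_tmp; exact: c2.
have hN x y : N (x, y) -> A (x, y) || B (x, y).
  rewrite /A /B => h; rewrite h /=; move: h; rewrite /N /= ltr_norml => /andP[_ h].
  by apply/orP; have [?|?] := ltP (2 * x ^+ 2) (s + eps); [left|right; lra].
apply: (@le_trans _ _ (\int[mu]_x \int[mu]_y ((A (x, y) || B (x, y))%:R)%:E)%E).
  apply: ge0_integral_mono => x _; first by apply: integral_ge0 => y _; rewrite lee_fin.
  apply: ge0_integral_mono => y _; rewrite lee_fin // -/(N (x, y)).
  by case: (boolP (N (x, y))) => // /hN ->.
apply: le_trans (box_open_integralU oA oB) _.
have -> : 16 * eps = 8 * eps + 8 * eps by ring.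
rewrite EFinD; apply: leeD.
  by apply: (annulus_half (A := fun x y => A (x, y)) e0 s0) => x y /andP[h1 h2].
rewrite (lsc_tonelli (f := fun p => (B p)%:R)) => [|c|p]; [|exact: box_open_indic|by []].
by apply: (annulus_half (A := fun y x => B (x, y)) e0 s0) => y x /andP[h1 h2]; rewrite [y ^+ 2 + _]addrC.
Qed.

End UpperIntegral.

(** * Integrability of powers of 1 + x^2 + y^2 *)

Section JapaneseBracket.
Variable R : realType.
Local Notation mu := (@lebesgue_measure R).
Implicit Types (c x : R).

Lemma powR_continuous_at c x : 0 < x -> {for x, continuous (fun u : R => u `^ c)}.
Proof.
move=> x0; apply: differentiable_continuous; apply/derivable1_diffP.
by apply: derivable_powR; rewrite in_itv /= x0.
Qed.

Lemma integral_powR_tail (d : R) : 0 < d ->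
  (\int[mu]_(x in `[0%R, +oo[) ((1 + x) `^ (- d - 1))%:E = (d^-1)%:E)%E.
Proof.
move=> d0.
have aff (x : R) : is_derive (x : R^o) (1 : R^o) (fun u : R => 1 + u) (1 : R^o).
  by rewrite -[X in is_derive _ _ _ X]add0r; apply: is_deriveD.
pose F x := - d^-1 * (1 + x) `^ (- d).
have caff (x : R) (f : R -> R) : {for 1 + x, continuous f} ->
    {for x, continuous (fun u : R => f (1 + u))}.
  move=> cf; apply: (@cvg_comp _ _ _ (fun u : R => 1 + u) f); last exact: cf.
  by apply: cvgD; [exact: cvg_cst|exact: cvg_id].
have dF (x : R) : -1 < x -> is_derive (x : R^o) (1 : R^o) (F : R^o -> R^o) ((1 + x) `^ (- d - 1)).
  move=> x1; have p : 0 < 1 + x by lra.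
  have -> : (1 + x) `^ (- d - 1) = - d^-1 *: (- d * (1 + x) `^ (- d - 1) * 1).
    by rewrite mulr1 /GRing.scale /= mulrA mulrNN mulVf ?mul1r // gt_eqF.
  apply: is_deriveZ; apply: (is_derive1_comp (f := fun u : R => u `^ (- d)) (g := fun u => 1 + u)).
  exact: is_derive1_powR.
rewrite (@ge0_continuous_FTC2y R (fun x => (1 + x) `^ (- d - 1)) F 0 0).
- by rewrite /F addr0 powR1 mulr1 -EFinD sub0r opprK.
- by move=> x _; exact: powR_ge0.
- apply: continuous_in_subspaceT => x; rewrite inE /= in_itv /= andbT => x0.
  by apply: (caff x (fun u => u `^ (- d - 1))); apply: powR_continuous_at; rewrite ltr_wpDr.
- apply/cvgrPdist_le => e e0.
  pose K := (e * d) `^ (- d^-1).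
  near=> y.
  have x0 : 0 <= y by near: y; apply: nbhs_pinfty_ge; exact: num_real.
  have xK : K <= y by near: y; apply: nbhs_pinfty_ge; exact: num_real.
  have K0 : 0 <= K by exact: powR_ge0.
  have ed : 0 < e * d by rewrite mulr_gt0.
  rewrite sub0r normrN /F mulNr normrN ger0_norm ?mulr_ge0 ?invr_ge0 ?powR_ge0 ?(ltW d0) //.
  rewrite mulrC ler_pdivrMr // powRN -[leRHS]invrK lef_pV2 ?posrE ?invr_gt0 ?powR_gt0 //; last lra.
  have -> : (e * d)^-1 = K `^ d.
    by rewrite /K -powRrM mulNr mulVf ?gt_eqF // powR_inv1 // ltW.
  by apply: ge0_ler_powR; rewrite ?nnegrE ?(ltW d0) //; lra.
- by move=> x x0; have [] := dF x (lt_trans (ltrN10 _) x0).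
- apply: cvg_at_right_filter; apply: cvgMl_tmp.
  by apply: (caff 0 (fun u => u `^ (- d))); apply: powR_continuous_at; lra.
- move=> x; rewrite in_itv /= andbT => x0; rewrite derive1E.
  by have [_ ->] := dF x (lt_trans (ltrN10 _) x0).
Unshelve. all: by end_near. Qed.

(** By evenness and [(1 + x)^2 <= 2 (1 + x^2)] this reduces to the tail integral with
    [d = 2c - 1]. *)
Lemma bracket_integrable c : 1 / 2 < c ->
  (\int[mu]_x ((1 + x ^+ 2) `^ (- c))%:E < +oo)%E.
Proof.
move=> hc; have p (x : R) : 0 < 1 + x ^+ 2 by rewrite ltr_pwDl // sqr_ge0.
rewrite ge0_symfun_integralT; first last.
- by move=> x /=; rewrite sqrrN.
- move=> x; apply: (@cvg_comp _ _ _ (fun u : R => 1 + u ^+ 2) (fun u => u `^ (- c))); last first.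
    by apply: powR_continuous_at.
  by apply: cvgD; [exact: cvg_cst|exact: exprn_continuous].
- by move=> x; exact: powR_ge0.
have d0 : 0 < 2 * c - 1 by lra.
have c2 : 0 < 2 `^ c :> R by exact: powR_gt0.
apply: (@le_lt_trans _ _ (2%:E * ((2 `^ c)%:E * ((2 * c - 1)^-1)%:E))%E); last first.
  by rewrite -!EFinM ltry.
apply: lee_wpmul2l => //.
rewrite -(integral_powR_tail d0) -ge0_integral_scale //; last first.
  by move=> x _; rewrite lee_fin powR_ge0.
have -> : [set x : R | 0 <= x]%classic = `[0, +oo[%classic.
  by apply/seteqP; split => x /=; rewrite in_itv /= andbT.
apply: ge0_integral_mono => x; first by rewrite lee_fin powR_ge0.
rewrite /= in_itv /= andbT => x0; rewrite lee_fin.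
have -> : - (2 * c - 1) - 1 = - (2 * c) by ring.
have x1 : 0 < 1 + x by lra.
rewrite !powRN powRrM powR_mulrn ?(ltW x1) //.
rewrite -[2 `^ c]invrK -invfM lef_pV2 ?posrE ?mulr_gt0 ?invr_gt0 ?powR_gt0 ?exprn_gt0 //.
rewrite mulrC ler_pdivrMr // -powRM ?(ltW (p x)) //.
apply: ge0_ler_powR; rewrite ?nnegrE ?mulr_ge0 ?exprn_ge0 ?(ltW (p x)) ?(ltW x1) //; try lra.
by have := sqr_ge0 (1 - x); nra.
Qed.

(** Instead of polar coordinates, [(1 + x^2 + y^2)^2 >= (1 + x^2)(1 + y^2)] splits the bracket into
    two one-variable brackets of exponent [b/2 > 1/2]. *)
Lemma bracket2_integrable (b K : R) : 1 < b -> 0 < K ->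
  (\int[mu]_x \int[mu]_y (K * (1 + x ^+ 2 + y ^+ 2) `^ (- b))%:E < +oo)%E.
Proof.
move=> b1 K0; have hc : 1 / 2 < b / 2 by lra.
have := bracket_integrable hc; set I := (\int[mu]_x _)%E => Ifin.
have I0 : (0 <= I)%E by apply: integral_ge0 => x _; rewrite lee_fin powR_ge0.
pose w (x : R) := (1 + x ^+ 2) `^ (- (b / 2)).
have p (x : R) : 0 < 1 + x ^+ 2 by rewrite ltr_pwDl // sqr_ge0.
have w0 x : 0 < w x by exact: powR_gt0.
have IE : I = (fine I)%:E by rewrite fineK // ge0_fin_numE.
pose L := fine I + 1.
have L0 : 0 < L by rewrite ltr_wpDl // fine_ge0.
have IL : (I <= L%:E)%E by rewrite IE lee_fin lerDl.
apply: (@le_lt_trans _ _ ((K * L)%:E * I)%E); last by rewrite IE -EFinM ltry.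
have KL0 : 0 < K * L by exact: mulr_gt0.
have w0' x : setT x -> (0 <= (w x)%:E)%E by move=> _; rewrite lee_fin ltW.
rewrite /I -(ge0_integral_scale mu KL0 w0').
apply: ge0_integral_mono => x _.
  by apply: integral_ge0 => y _; rewrite lee_fin mulr_ge0 ?powR_ge0 // ltW.
apply: (@le_trans _ _ ((K * w x)%:E * I)%E); last first.
  have -> : ((K * L)%:E * (w x)%:E = (K * w x)%:E * L%:E)%E by rewrite -!EFinM mulrAC.
  by apply: lee_wpmul2l; rewrite // lee_fin mulr_ge0 // ltW.
have Kw0 : 0 < K * w x by exact: mulr_gt0.
rewrite /I -(ge0_integral_scale mu Kw0 w0').
apply: ge0_integral_mono => y _; first by rewrite lee_fin mulr_ge0 ?powR_ge0 // ltW.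
rewrite -EFinM lee_fin -mulrA ler_pM2l // /w -powRM ?(ltW (p _)) //.
set J := 1 + x ^+ 2 + y ^+ 2.
have J0 : 0 < J by rewrite /J ltr_wpDr // sqr_ge0.
have -> : J `^ (- b) = (J ^+ 2) `^ (- (b / 2)).
  by rewrite -powR_mulrn ?(ltW J0) // -powRrM; congr (_ `^ _); field.
have q0 : 0 < (1 + x ^+ 2) * (1 + y ^+ 2) by rewrite mulr_gt0.
rewrite !powRN lef_pV2 ?posrE ?powR_gt0 ?exprn_gt0 //.
apply: ge0_ler_powR; rewrite ?nnegrE ?(ltW q0) ?exprn_ge0 ?(ltW J0) //; first lra.
have x2 := sqr_ge0 x; have y2 := sqr_ge0 y; rewrite /J; nra.
Qed.

End JapaneseBracket.

(** * Convergence of the norm in low degree *)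

Section LowDegree.
Variable R : realType.
Local Notation C := R[i].
Local Notation mu := (@lebesgue_measure R).

Lemma monomial_bound n (p : 'I_n -> nat) (z : 'I_n -> C) (S : R) :
  (forall k, nm (z k) <= S) -> nm (monomial p z) <= S ^+ mi_size p.
Proof.
move=> H; rewrite /monomial nm_prod /mi_size -prodrXr; apply: ler_prod => k _.
rewrite nmX exprn_ge0 ?nm_ge0 //=; apply: lerXn2r; rewrite ?nnegrE ?nm_ge0 //.
exact: le_trans (nm_ge0 (z k)) _.
Qed.

Lemma monomial_sum_bound n (sq : seq (C * ('I_n -> nat))) (M : nat) : exists2 c : R, 0 < c &
  forall (z : 'I_n -> C) (S : R), (forall q, q \in sq -> (mi_size q.2 <= M)%N) -> 1 <= S ->
    (forall k, nm (z k) <= S) -> nm (\sum_(q <- sq) q.1 * monomial q.2 z) <= c * S ^+ M.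
Proof.
exists (1 + \sum_(q <- sq) nm q.1).
  by rewrite ltr_pwDl // sumr_ge0 // => q _; exact: nm_ge0.
move=> z S hM S1 H; have SM : 0 <= S ^+ M by rewrite exprn_ge0 //; lra.
apply: le_trans (nm_sum _ _ _) _; apply: (@le_trans _ _ (\sum_(q <- sq) nm q.1 * S ^+ M)).
  rewrite big_seq [leRHS]big_seq; apply: ler_sum => q qs; rewrite nmM.
  apply: ler_wpM2l; first exact: nm_ge0.
  apply: le_trans (monomial_bound _ H) _; apply: ler_weXn2l => //; exact: hM.
by rewrite -mulr_suml ler_wpM2r // lerDr.
Qed.

Variables (m : nat) (a : R).
Hypotheses (m1 : (0 < m)%N) (a0 : 0 < a).
Local Notation V := ('I_m.+1 -> C).

(** Recentres the conditions from z_n to z_1. Widths are at most 1, so [|z_n|^2 + 1 >= J / 2], which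
    costs [2^a]; comparing with z_1 through z_n costs the factor 2. *)
Lemma Dom_annuli (z : V) (J : R) : Dom m.+1 a z -> J = 1 + nm (z ord0) ^+ 2 ->
  (forall k, nm (z k) ^+ 2 <= 2 * J) /\
  (forall k, k != ord0 -> `|nm (z k) ^+ 2 - nm (z ord0) ^+ 2| < 2 * 2 `^ a * J `^ (- a)).
Proof.
move=> /(DomP a (l := ord_max) erefl) Dz JE.
set W := nm (z ord0) ^+ 2 in JE *; set L := nm (z ord_max) ^+ 2 in Dz.
have W0 : 0 <= W by exact: sqr_ge0.
have L0 : 0 <= L by exact: sqr_ge0.
have J0 : 0 < J by lra.
have w1 := dom_width_le1 a0 L0.
have ne : ord0 != ord_max :> 'I_m.+1 by rewrite -(inj_eq val_inj) /= eq_sym -lt0n.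
have := Dz _ ne; rewrite -/W => h0.
have h1 := lt_le_trans h0 w1; move: (h1); rewrite ltr_norml => /andP[h2 h3].
have width : dom_width a L <= 2 `^ a * J `^ (- a).
  rewrite powRN -powR_inv1 ?powR_ge0 // -[in leRHS]powRrM mulrN1 -[_ * _]/(_ * _).
  rewrite /dom_width div1r -powRN.
  have -> : 2 `^ a * J `^ (- a) = (2^-1 * J) `^ (- a).
    by rewrite powRM ?invr_ge0 ?(ltW J0) // -[2^-1]powR_inv1 // -powRrM mulrNN mul1r.
  rewrite !powRN lef_pV2 ?posrE ?powR_gt0 ?mulr_gt0 ?invr_gt0 //; last lra.
  by apply: ge0_ler_powR; rewrite ?nnegrE ?(ltW a0) //; lra.
have near k : k != ord_max -> `|nm (z k) ^+ 2 - L| < dom_width a L by move=> /Dz.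
split=> k.
  have [->|kn] := eqVneq k ord_max; first by rewrite -/L; lra.
  have := lt_le_trans (near k kn) w1; rewrite ltr_norml => /andP[_ h]; lra.
move=> k0; have w2 : dom_width a L + dom_width a L <= 2 * 2 `^ a * J `^ (- a).
  by rewrite -mulrA mulr2n mulrDl mul1r lerD.
have w0 := dom_width_gt0 a L0.
apply: lt_le_trans w2.
have [->|kn] := eqVneq k ord_max; first by rewrite -/L distrC; lra.
have := near k kn; move: h0; rewrite !ltr_norml => /andP[a1 a2] /andP[a3 a4].
by apply/andP; split; lra.
Qed.

Theorem low_degree_L2 (f : V -> C) (sq : seq (C * ('I_m.+1 -> nat))) (M : nat) :
  (forall z, Dom m.+1 a z -> f z = \sum_(q <- sq) q.1 * monomial q.2 z) ->
  (forall q, q \in sq -> (mi_size q.2 <= M)%N) -> M%:R < m%:R * a - 1 ->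
  (L2_norm2 (Dom m.+1 a) f < +oo)%E.
Proof.
move=> fE hM hMa; have [c c0 cb] := monomial_sum_bound sq M.
pose G (v : nat -> R) : \bar R := ((\1_(Dom m.+1 a) (cplx_of_reals (n:=m.+1) v) : R)
   * nm (f (cplx_of_reals (n:=m.+1) v)) ^+ 2)%:E.
have G0 v : (0 <= G v)%E by exact: iter_int_integrand_ge0.
pose b := m%:R * a - M%:R.
have b1 : 1 < b by rewrite /b; lra.
pose E0 : R := 2 * 2 `^ a.
have E00 : 0 < E0 by rewrite mulr_gt0 // powR_gt0.
pose K := c ^+ 2 * 2 ^+ M * (16 * E0) ^+ m.
have K0 : 0 < K by rewrite !mulr_gt0 ?exprn_gt0 // mulr_gt0.
apply: le_lt_trans (bracket2_integrable b1 K0).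
have -> : L2_norm2 (Dom m.+1 a) f =
    (\int[mu]_s \int[mu]_t iter_int (2 * m) (fun v => G (cons2 s t v)))%E.
  by rewrite /L2_norm2 iter_int2E.
have I0 s t : (0 <= iter_int (2 * m) (fun v => G (cons2 s t v)))%E.
  by apply: iter_int_ge0 => v.
apply: ge0_integral_mono => s _; first by apply: integral_ge0.
apply: ge0_integral_mono => [//|t _].
set J := 1 + s ^+ 2 + t ^+ 2.
have J1 : 1 <= J by rewrite /J -addrA lerDl addr_ge0 ?sqr_ge0.
have J0 : 0 < J by lra.
pose eps := E0 * J `^ (- a).
have e0 : 0 < eps by rewrite mulr_gt0 // powR_gt0.
(* The sup bound [c^2 (2J)^M] for [|f|^2], times [m] annulus areas [16 eps], is a multiple of
   [J^(-b)], and the degree condition says [b > 1]. *)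
have mE : c ^+ 2 * (2 * J) ^+ M * (16 * eps) ^+ m = K * J `^ (- b).
  rewrite /eps mulrA ![(_ * J) ^+ _]exprMn [(_ * J `^ _) ^+ _]exprMn /K.
  rewrite -[J ^+ M]powR_mulrn ?(ltW J0) // -[(J `^ _) ^+ m]powR_mulrn ?powR_ge0 // -powRrM.
  have -> : - b = M%:R + - a * m%:R by rewrite /b; ring.
  rewrite powRD; last by rewrite (gt_eqF J0) implybT.
  by ring.
rewrite -mE; set A := fun (_ : nat) x y => `|x ^+ 2 + y ^+ 2 - (s ^+ 2 + t ^+ 2)| < eps.
have z0 v : nm (cplx_of_reals (n := m.+1) (cons2 s t v) ord0) ^+ 2 = s ^+ 2 + t ^+ 2.
  by rewrite nm_sqr.
have JE v : J = 1 + nm (cplx_of_reals (n := m.+1) (cons2 s t v) ord0) ^+ 2.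
  by rewrite z0 addrA.
apply: (iter_int_box_ub (A := A)).
- by rewrite mulr_gt0 ?exprn_gt0 // mulr_gt0.
- by rewrite mulr_gt0.
- by move=> v; exact: G0.
- move=> v; rewrite lee_fin indicE; set z := cplx_of_reals _.
  case: (boolP (z \in Dom m.+1 a)) => [|_]; last first.
    by rewrite mul0r mulr_ge0 ?exprn_ge0 ?mulr_ge0 ?(ltW c0) ?(ltW J0).
  rewrite inE => Dz; rewrite mul1r fE //.
  have [nb _] := Dom_annuli Dz (JE v).
  have J2 : 1 <= 2 * J by rewrite mulrDl mul1r ler_wpDr ?(ltW J0).
  have S1 : 1 <= Num.sqrt (2 * J) by move/ler_wsqrtr: J2; rewrite sqrtr1.
  have Sb k : nm (z k) <= Num.sqrt (2 * J).
    by rewrite -[leLHS]ger0_norm ?nm_ge0 // -sqrtr_sqr ler_wsqrtr.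
  have := cb z _ hM S1 Sb => h.
  have -> : c ^+ 2 * (2 * J) ^+ M = (c * Num.sqrt (2 * J) ^+ M) ^+ 2.
    by rewrite [RHS]exprMn -[in RHS]exprM mulnC [in RHS]exprM sqr_sqrtr // mulr_ge0 // ltW.
  by apply: lerXn2r; rewrite ?nnegrE ?nm_ge0 // mulr_ge0 ?exprn_ge0 ?sqrtr_ge0 // ltW.
- by move=> j _; apply: annulus_area => //; rewrite addr_ge0 ?sqr_ge0.
- move=> v j jm; rewrite /A => hA; rewrite /G indicE; set z := cplx_of_reals _.
  case: (boolP (z \in Dom m.+1 a)) => [|_]; last by rewrite mul0r.
  rewrite inE => Dz; have [_ nb] := Dom_annuli Dz (JE v).
  have jm1 : (j.+1 < m.+1)%N by [].
  have zj : z (Ordinal jm1) = v (2 * j)%N +i* v (2 * j).+1.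
    by rewrite /z /cplx_of_reals (mulnS 2 j).
  by have := nb (Ordinal jm1) isT; rewrite z0 nm_sqr -/z zj /= (negbTE hA).
Qed.

Theorem monomial_span_bergman (f : V -> C) : 
  in_monomial_span (Dom m.+1 a) (fun p => (mi_size p)%:R < m%:R * a - 1) f ->
  bergman (Dom m.+1 a) f.
Proof.
move=> [sq [hs fE]]; split.
  pose g z := \sum_(q <- sq) q.1 * monomial q.2 z.
  have hg : holomorphic_on (Dom m.+1 a) g by apply: is_poly_holomorphic; exists sq.
  move=> z Dz; have [c hc] := hg z Dz; exists c => e e0.
  (* [f] is a polynomial only on D(a), so the increments must stay in D(a) for its derivative to be
     transferred. *)
  have [d d0 hd] := hc e e0; have [r r0 hr] := Dom_open (l := ord_max) erefl Dz.
  exists (Num.min d r) => [|h]; first by rewrite lt_min d0.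
  rewrite lt_min => /andP[h1 h2]; rewrite !fE //; first exact: hd.
  apply: hr => k; rewrite addrC addKr; apply: le_lt_trans h2.
  by rewrite (bigD1 k) //= lerDl sumr_ge0 // => i _; exact: nm_ge0.
(* For [x <= 0] no exponent is admissible and [f] vanishes on D(a); otherwise [M] is the largest
   natural number below [x]. *)
set x := m%:R * a - 1 in hs; have [x0|x0] := ltP 0 x; last first.
  have f0 z : Dom m.+1 a z -> f z = 0.
    move=> /fE ->; rewrite big_seq big1 // => q /hs hq.
    by have := lt_le_trans hq x0; rewrite ltrn0.
  rewrite /L2_norm2 (_ : (fun _ => _) = fun=> 0%E) ?iter_int0 //.
  apply/funext => v; rewrite indicE; set z := cplx_of_reals _.
  case: (boolP (z \in Dom m.+1 a)) => [|_]; last by rewrite mul0r.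
  by rewrite inE => /f0 ->; rewrite nm0 expr0n mulr0.
have exM : exists M : nat, M%:R < x by exists 0%N.
have ubM M : M%:R < x -> (M <= Num.bound x)%N.
  move=> h; rewrite -(ler_nat R); apply/ltW/(lt_trans h)/archi_boundP; exact: ltW.
case: (ex_maxnP exM ubM) => M hM maxM.
by apply: (low_degree_L2 fE _ hM) => q /hs; exact: maxM.
Qed.

End LowDegree.

(** * Dimension *)

Section Kronecker.
Variable R : realType.
Local Notation C := R[i].

Lemma base_digits_inj (n B : nat) (p q : nat -> nat) :
  (forall j, p j < B)%N -> (forall j, q j < B)%N ->
  (\sum_(j < n) p j * B ^ j = \sum_(j < n) q j * B ^ j)%N -> forall j, (j < n)%N -> p j = q j.
Proof.
elim: n p q => [//|n IH] p q pB qB; have B0 : (0 < B)%N by exact: leq_ltn_trans (pB 0%N).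
have rec (u : nat -> nat) : (\sum_(j < n.+1) u j * B ^ j =
    (\sum_(j < n) u j.+1 * B ^ j) * B + u 0)%N.
  rewrite big_ord_recl muln1 addnC big_distrl /=; congr (_ + _)%N.
  by apply: eq_bigr => j _; rewrite expnSr mulnA.
rewrite !rec => E; have E0 : p 0%N = q 0%N.
  by have := congr1 (modn^~ B) E; rewrite !modnMDl !modn_small.
have {}E := congr1 (divn^~ B) E.
rewrite !divnMDl // !divn_small // !addn0 in E.
by move=> [//|j] jn; apply: (IH (fun i => p i.+1) (fun i => q i.+1)).
Qed.

Lemma poly_small_roots (P : {poly C}) (r : R) : 0 < r ->
  (forall x : R, 0 < x -> x < r -> P.[x%:C] = 0) -> P = 0.
Proof.
move=> r0 H; apply/eqP; apply: contraT => P0.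
pose h : R := r / 2; have h0 : 0 < h by rewrite divr_gt0.
pose N := size P; pose pt (j : 'I_N.+1) : R := h / j.+1%:R.
have ptp j : 0 < pt j by rewrite divr_gt0 // ltr0n.
have ptr j : pt j < r.
  apply: (@le_lt_trans _ _ h); last by rewrite /h; lra.
  by rewrite ler_pdivrMr ?ltr0n // ler_peMr ?ler1n // ltW.
suff : (size [seq (pt j)%:C | j : 'I_N.+1] < N)%N.
  by rewrite size_map -cardE card_ord ltnNge leqnSn.
apply: max_poly_roots => //.
  by apply/allP => _ /mapP[j _ ->]; rewrite rootE; apply/eqP/H.
rewrite map_inj_uniq ?enum_uniq // => i j /(@complexI R) /(mulfI (lt0r_neq0 h0)).
by move=> /invr_inj /eqP; rewrite eqr_nat => /eqP[] /val_inj.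
Qed.

(* Kronecker substitution: on z_j = x^(B^j) distinct monomials become distinct powers of x. *)
Lemma monomials_free (n B I : nat) (p : 'I_I -> 'I_n -> nat) (c : 'I_I -> C) (r : R) :
  0 < r -> (forall i j, p i j < B)%N -> (forall i i', p i =1 p i' -> i = i') ->
  (forall z : 'I_n -> C, (forall k, nm (z k) < r) -> \sum_(i < I) c i * monomial (p i) z = 0) ->
  forall i, c i = 0.
Proof.
move=> r0 pB pI H i0.
pose e i := (\sum_(j < n) p i j * B ^ j)%N.
have eI i i' : e i = e i' -> i = i'.
  pose u i (j : nat) := if insub j is Some k then p i k else 0%N.
  have uE i1 (k : 'I_n) : u i1 k = p i1 k by rewrite /u valK.
  have B0 i1 k : (p i1 k < B)%N by exact: pB.
  have uB i1 j : (0 < n)%N -> (u i1 j < B)%N.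
    move=> n0; rewrite /u; case: insub => [k|]; first exact: pB.
    by apply: leq_ltn_trans (pB i1 (Ordinal n0)).
  move=> E; apply: pI => k; have n0 : (0 < n)%N by exact: leq_ltn_trans (ltn_ord k).
  have := @base_digits_inj n B (u i) (u i') (fun j => uB i j n0) (fun j => uB i' j n0).
  move=> /(_ _ k (ltn_ord k)); rewrite !uE; apply.
  by under eq_bigr do rewrite uE; under [RHS]eq_bigr do rewrite uE.
pose P : {poly C} := \sum_(i < I) c i *: 'X^(e i).
have P0 : P = 0.
  apply: (@poly_small_roots _ (Num.min r 1)) => [|x x0]; first by rewrite lt_min r0 ltr01.
  rewrite lt_min => /andP[xr x1].
  rewrite -[RHS](H (fun j => x%:C ^+ (B ^ j))); last first.
    move=> j; rewrite nmX nm_real gtr0_norm //; apply: le_lt_trans xr.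
    have : (0 < B ^ j)%N by rewrite expn_gt0 (leq_ltn_trans _ (pB i0 j)).
    by case: (B ^ j)%N => // b _; rewrite exprS ler_piMr ?(ltW x0) // exprn_ile1 ?(ltW x0) ?(ltW x1).
  rewrite horner_sum; apply: eq_bigr => i _; rewrite hornerZ hornerXn /monomial /e -prodrXr.
  by congr (_ * _); apply: eq_bigr => j _; rewrite -exprM mulnC.
have := congr1 (fun Q : {poly C} => Q`_(e i0)) P0; rewrite coef0 coef_sum (bigD1 i0) //=.
rewrite coefZ coefXn eqxx mulr1 big1 ?addr0 // => i ii0.
rewrite coefZ coefXn; case: eqP => [/eI h|_]; last by rewrite mulr0.
by rewrite h eqxx in ii0.
Qed.

End Kronecker.

(** * The Bergman space of D(a) and its dimension *)

Section Main.
Variables (R : realType) (m : nat) (a : R).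
Local Notation C := R[i].
Hypotheses (m1 : (0 < m)%N) (a0 : 0 < a).
Local Notation D := (Dom m.+1 a).
Local Notation V := ('I_m.+1 -> C).

Lemma bergman_monomial_span (f : V -> C) : bergman D f <->
  in_monomial_span D (fun p => (mi_size p)%:R < m%:R * a - 1) f.
Proof.
split; last exact: monomial_span_bergman.
move=> bf; have [g [[s gE] fg]] := bergman_poly a0 (l := ord_max) erefl bf.
have fE z : D z -> f z = \sum_(q <- s) q.1 * monomial q.2 z by move=> /fg ->; exact: gE.
pose low (q : C * ('I_m.+1 -> nat)) := (mi_size q.2)%:R < m%:R * a - 1.
exists [seq q <- s | low q]; split=> [q|z Dz]; first by rewrite mem_filter => /andP[].
rewrite fE // (bigID low) /= big_filter -[LHS]/(_ + _) -[RHS]addr0; congr (_ + _).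
(* The list may repeat monomials, so the discarded terms vanish only in total: each homogeneous part
   of [s'] is either empty or the corresponding part of [s], which is zero. *)
pose s' := [seq q <- s | ~~ low q].
rewrite -big_filter -/s'.
have [B sB] := mi_size_bounded s'.
have zE : dilate 1 z = z by apply/funext => k; rewrite /dilate mul1r.
rewrite -zE (homog_part_decomp _ _ sB) big1 // => d _.
rewrite /homog_part big_filter_cond; have [hd|hd] := ltP (d%:R) (m%:R * a - 1).
  rewrite big_pred0 ?mulr0 // => q; apply/negbTE; rewrite negb_and negbK /low.
  by case: eqP => [->|]; rewrite ?hd ?orbT.
rewrite (eq_bigl (fun q => mi_size q.2 == d)) => [|q].
  by rewrite -/(homog_part s d z) (high_degree_vanish a0 fE bf.2 hd) mulr0.
by rewrite /low; case: eqP => [->|_]; rewrite ?andbT ?andbF // -leNgt.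
Qed.

Lemma bergman_trivial : a <= 1 / m%:R -> has_dim D (bergman D) 0.
Proof.
have m0 : 0 < m%:R :> R by rewrite ltr0n.
rewrite ler_pdivlMr // mulrC => ha; exists (fun _ _ => 0); split; first by case.
split=> [c _ []//|f /bergman_monomial_span[s [hs fE]]].
exists (fun=> 0) => z /fE ->; rewrite big_ord0 big_seq big1 // => q /hs.
by rewrite ltNge (le_trans _ (ler0n _ _)) // subr_le0.
Qed.

Lemma bergman_dim (k : nat) : k.+1%:R / m%:R < a -> a <= k.+2%:R / m%:R ->
  has_dim D (bergman D) 'C(m.+1 + k, k).
Proof.
have m0 : 0 < m%:R :> R by rewrite ltr0n.
rewrite ltr_pdivrMr // ler_pdivlMr // (mulrC a) -[k.+2%:R]natr1 -[k.+1%:R]natr1 => lo hi.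
have degP (p : 'I_m.+1 -> nat) : ((mi_size p)%:R < m%:R * a - 1) = (mi_size p <= k)%N.
  apply/idP/idP => h; last first.
    by have : (mi_size p)%:R <= k%:R :> R by [rewrite ler_nat]; lra.
  by rewrite -ltnS -(ltr_nat R) -natr1; lra.
(* By symmetry the binomial counts the [m.+1]-tuples over [{0, ..., k}] with sum at most [k], which
   serve as the exponents of the basis. *)
rewrite -[X in 'C(_, X)](addKn m.+1 k) bin_sub ?leq_addr //.
rewrite -card_partial_ord_partitions.
set A := [set t | _]; pose p (i : 'I_#|A|) (j : 'I_m.+1) : nat := tnth (enum_val i) j.
have pk i : (mi_size (p i) <= k)%N.
  by have := enum_valP i; rewrite inE big_tuple.
exists (fun i => monomial (p i)); split=> [i|].
  apply/bergman_monomial_span; exists [:: (1, p i)]; split=> [q|z _].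
    by rewrite inE => /eqP ->; rewrite degP pk.
  by rewrite big_seq1 mul1r.
split=> [c hc|f /bergman_monomial_span[s [hs fE]]].
  have [r r0 hr] := Dom_origin a (l := ord_max : 'I_m.+1) erefl.
  (* Independence is tested on a polydisc about 0 inside D(a); exponents are at most [k], whence the
     base [k.+1]. *)
  apply: (monomials_free (B := k.+1) (p := p) r0) => [i j|i i' pp|z hz].
  - exact: ltn_ord.
  - by apply: enum_val_inj; apply: eq_from_tnth => j; apply: val_inj; exact: pp.
  - by apply: hc; exact: hr.
pose eqm (u v : 'I_m.+1 -> nat) := [forall j, u j == v j].
(* Coefficients of equal monomials in the list are collected. *)
exists (fun i => \sum_(q <- s | eqm q.2 (p i)) q.1) => z Dz; rewrite fE //.
under [RHS]eq_bigr do rewrite mulr_suml big_mkcond.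
rewrite exchange_big /= big_seq [RHS]big_seq; apply: eq_bigr => q /hs; rewrite degP => qk.
have qjk j : (q.2 j <= k)%N by apply: leq_trans qk; rewrite /mi_size (bigD1 j) //= leq_addr.
pose t := [tuple inord (q.2 j) : 'I_k.+1 | j < m.+1].
have tA : t \in A.
  rewrite inE big_tuple; apply: leq_trans qk; apply: leq_sum => j _.
  by rewrite tnth_mktuple inordK // ltnS.
pose i0 := enum_rank_in tA t.
have pi0 j : p i0 j = q.2 j by rewrite /p enum_rankK_in // tnth_mktuple inordK // ltnS.
have Ei i : eqm q.2 (p i) = (i == i0).
  apply/forallP/eqP => [h|-> j]; last by rewrite pi0.
  apply: enum_val_inj; rewrite enum_rankK_in //; apply: eq_from_tnth => j.
  by apply: val_inj; rewrite tnth_mktuple /= inordK ?ltnS //; apply/esym/eqP/h.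
rewrite (bigD1 i0) //= Ei eqxx big1 => [|i]; last by rewrite Ei => /negbTE ->.
by rewrite addr0; congr (_ * _); apply: eq_bigr => j _; rewrite pi0.
Qed.

End Main.

Theorem theorem2p1 (R : realType) (n : nat) (a : R) :
  (2 <= n)%N -> 0 < a ->
  (* main statement *)
  (1 / (n.-1)%:R < a ->
     forall f : ('I_n -> R[i]) -> R[i],
       bergman (Dom n a) f <->
       in_monomial_span (Dom n a)
         (fun p => (mi_size p)%:R < (n.-1)%:R * a - 1) f) /\
  (* consequence: the dimension *)
  (a <= 1 / (n.-1)%:R -> has_dim (Dom n a) (bergman (Dom n a)) 0) /\
  (forall k : nat, k.+1%:R / (n.-1)%:R < a -> a <= k.+2%:R / (n.-1)%:R ->
     has_dim (Dom n a) (bergman (Dom n a)) 'C(n + k, k)).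
Proof.
case: n => [//|[//|m]] _ a0.
split=> [_ f|]; first exact: bergman_monomial_span.
by split=> [|k]; [exact: bergman_trivial|exact: bergman_dim].
Qed.
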